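(* Let $t_o\in\Delta\subset T=\mathbb C^n$, $S_o=S(t_o)$. Let $A_1$ be a constant complex $n\times n$ matrix and $\omega_o\in\mathbb C^n$ such that (1) $A_1^{\mathrm{nd}}\in\operatorname{im}\operatorname{ad}(\Lambda(t_o))$, (2) $A_1-(w/2)\mathrm{Id}$ is skew-symmetric for some integer $w$, (3) $\omega_o$ is an eigenvector of $A_1$ all of whose entries are nonzero. Let $U$ be an open subset of $T$ containing $S_o$ which is star shaped with respect to $S_o$ and such that $U\cap\overline S=\emptyset$ for every stratum $S$ with $\overline S\cap S_o=\emptyset$, and let $\widetilde U$ be its universal covering. Let $\Theta$, $\omega$ and $\Theta_{\omega_o}$ be the hypersurface, the flat vector function and the hypersurface of $\widetilde U$ attached to $(\Lambda(t_o),A_1,\omega_o)$ (see context). Then the infinitesimal period mapping associated with $\omega$ endows the manifold $\widetilde U\smallsetminus(\Theta\cup\Theta_{\omega_o})$ with a Frobenius manifold structure.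
   Context: Notation. For $t\in T=\mathbb C^n$, $\Lambda(t)=\operatorname{diag}(t_1,\dots,t_n)$. For a square matrix $M$, $M=M^{\mathrm d}+M^{\mathrm{nd}}$ is its decomposition into diagonal and non-diagonal parts. $\operatorname{ad}(\Lambda(t_o))(B)=[\Lambda(t_o),B]$. Strata. $\Delta$ is the union of the diagonal hyperplanes $\{t_i=t_j\}$, $i\ne j$. Two points $t,t'$ belong to the same stratum iff, for all $i,j$, $t_i=t_j\Leftrightarrow t'_i=t'_j$; $S(t)$ is the stratum of $t$; $T\smallsetminus\Delta$ is the open stratum. The closure of a stratum is a linear subspace. Star-shapedness. A stratum $S_o$ of $\Delta$ determines a partition $\{1,\dots,n\}=\bigsqcup_{r\in R}I_r$ with $i,j$ in the same $I_r$ iff $t_i=t_j$ on $S_o$. Choose an element of each $I_r$, also denoted $r$, set $I'_r=I_r\smallsetminus\{r\}$, and use the coordinates $(t_r)_{r\in R}$ and $\tau_i^r=t_i-t_r$ ($r\in R$, $i\in I'_r$) to identify $T$ with $\overline{S_o}\times\mathbb C^m$, $m=n-\#R$. Let $p_o$ be the projection forgetting the $\tau$-coordinates, and endow $\mathbb C^m$ with its standard Euclidean metric. (For $U$ as in the claim, $p_o(U)\subset S_o$.) Then $U$ is star shaped with respect to $U\cap S_o$ if, for every $t\in U$, $U$ contains the Euclidean ball, centered at the origin (that is, at $p_o(t)$) and containing $t$ (i.e. of radius $|\tau(t)|$), of the linear subspace $\overline{S(t)}\cap p_o^{-1}(p_o(t))$ of $p_o^{-1}(p_o(t))\simeq\mathbb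 C^m$. Deformation. The functions $t_1,\dots,t_n$ are pulled back to $\widetilde U$ (where they are local coordinates), and a lift of $t_o$ to $\widetilde U$, still denoted $t_o$, is fixed. Under assumptions (1) and (2) (which gives $A_1^{\mathrm d}=(w/2)\mathrm{Id}$) there exist a complex hypersurface $\Theta$ of $\widetilde U$ not containing $t_o$ and a matrix $F_1^{\mathrm{nd}}(t)$, holomorphic on $\widetilde U\smallsetminus\Theta$, meromorphic along $\Theta$ and with zeros on the diagonal, such that the connection on the trivial bundle of rank $n$ with matrix $$-d(\Lambda(t)/z)+\bigl([\Lambda(t),F_1^{\mathrm{nd}}(t)]+A_1^{\mathrm d}\bigr)\frac{dz}{z}-[d\Lambda(t),F_1^{\mathrm{nd}}(t)]$$ is integrable, restricts to $\bigl(\frac{\Lambda(t_o)}{z}+A_1\bigr)\frac{dz}{z}$ at $t=t_o$, and is formally equivalent at $z=0$ (by a base change formal in $z$ and locally holomorphic in $t$) to $-d(\Lambda(t)/z)+A_1^{\mathrm d}\frac{dz}{z}$. Period mapping. The trivial bundle $E=\mathcal O^n$ on $\widetilde U\smallsetminus\Theta$, with canonical basis $e_1,\dots,e_n$, carries the flat connection $\nabla=d-[d\Lambda(t),F_1^{\mathrm{nd}}(t)]$, the Higgs field $\Phi=-d\Lambda(t)$, the endomorphisms $\Lambda(t)$ and $[\Lambda(t),F_1^{\mathrm{nd}}(t)]+A_1^{\mathrm d}$, and the standard symmetric bilinear form $g(e_i,e_j)=\delta_{ij}$. The vector $\omega_o$ is extended as the $\nabla$-flat vector function $\omega={}^t(\omega_1,\dots,\omega_n)$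 with $\omega(t_o)=\omega_o$ on $\widetilde U$, which is meromorphic along $\Theta$; $\Theta_{\omega_o}$ is a hypersurface away from which no entry $\omega_i$ vanishes. The infinitesimal period mapping associated with $\omega$ is $\varphi_\omega:\xi\mapsto-\Phi_\xi(\omega)$ from the tangent bundle to $E$, that is $\partial_{t_i}\mapsto\omega_ie_i$; it is an isomorphism on $\widetilde U\smallsetminus(\Theta\cup\Theta_{\omega_o})$. The structure it induces on this manifold is obtained by transporting to the tangent bundle, via $\varphi_\omega$, the data above: the metric is the pullback of $g$, i.e. $g(\partial_{t_i},\partial_{t_j})=\delta_{ij}\omega_i^2$; its flat (Levi-Civita) connection is the pullback of $\nabla$; the product, defined by $\varphi_\omega(\xi\star\eta)=-\Phi_\xi(\varphi_\omega(\eta))$, is $\partial_{t_i}\star\partial_{t_j}=\delta_{ij}\partial_{t_i}$, with unit field $\sum_i\partial_{t_i}$; the Euler field is $\sum_it_i\partial_{t_i}$. *)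

(* Defs.v *)
From HB Require Import structures.
From mathcomp Require Import all_boot all_order all_algebra.
From mathcomp Require Import complex.
From mathcomp Require Import all_classical all_reals all_analysis.

Set Implicit Arguments.
Unset Strict Implicit.
Unset Printing Implicit Defensive.

Import Order.TTheory GRing.Theory Num.Theory.
Import numFieldNormedType.Exports.

Local Open Scope classical_set_scope.
Local Open Scope ring_scope.

(* The complex field R[i], packed so that its norm topology is inferred; the base
   space T = C^n is the space of row vectors 'rV[CC R]_n. *)
Definition CC (R : realType) : numClosedFieldType := R[i]%C.

Definition mxcomm (K : pzRingType) (n : nat) (A B : 'M[K]_n) : 'M[K]_n :=
  A *m B - B *m A.

Definition dpart (K : pzRingType) (n : nat) (A : 'M[K]_n) : 'M[K]_n :=
  \matrix_(i, j) (A i j *+ (i == j)).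

Definition ndpart (K : pzRingType) (n : nat) (A : 'M[K]_n) : 'M[K]_n :=
  A - dpart A.

Definition skew_symmetric (K : pzRingType) (n : nat) (A : 'M[K]_n) : Prop :=
  A^T = - A.

Definition eigenvector (K : pzRingType) (n : nat) (A : 'M[K]_n)
    (v : 'cV[K]_n) : Prop :=
  v != 0 /\ exists a : K, A *m v = a *: v.

Section Strata.
Context (R : realType) (n : nat).
Implicit Types (t u : 'rV[CC R]_n) (U : set 'rV[CC R]_n).

Definition diagonals : set 'rV[CC R]_n :=
  [set t | exists i j : 'I_n, i != j /\ t 0 i = t 0 j].

Definition stratum t : set 'rV[CC R]_n :=
  [set u | forall i j, t 0 i = t 0 j <-> u 0 i = u 0 j].

(* rep i is the element r chosen in the class I_r containing i, for the
   partition attached to the stratum of t. *)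
Definition representatives t (rep : 'I_n -> 'I_n) : Prop :=
  (forall i, t 0 (rep i) = t 0 i) /\
  (forall i j, t 0 i = t 0 j -> rep i = rep j).

Definition tau_proj (rep : 'I_n -> 'I_n) t : 'rV[CC R]_n :=
  \row_i t 0 (rep i).

(* Euclidean norm of the tau-coordinates t_i - t_{rep i}; the terms with
   i = rep i vanish. *)
Definition tau_norm (rep : 'I_n -> 'I_n) t : CC R :=
  sqrtC (\sum_i `|t 0 i - t 0 (rep i)| ^+ 2).

Definition star_shaped (rep : 'I_n -> 'I_n) U : Prop :=
  forall t, U t ->
    [set u | closure (stratum t) u /\ tau_proj rep u = tau_proj rep t /\
             tau_norm rep u <= tau_norm rep t] `<=` U.

End Strata.

Section UniversalCovering.
Context (R : realType).

Definition evenly_covered (X Y : topologicalType) (p : X -> Y) (V : set Y) :=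
  exists (I : Type) (sheet : I -> set X),
    [/\ (forall i, open (sheet i)),
        (forall i j, i <> j -> sheet i `&` sheet j = set0),
        p @^-1` V = \bigcup_i sheet i,
        (forall i, set_bij (sheet i) V p) &
        (forall i (W : set X), open W -> W `<=` sheet i -> open (p @` W))].

(* p, seen as a map onto the open subset U of Y, is a covering map *)
Definition covering_map (X Y : topologicalType) (p : X -> Y) (U : set Y) :=
  [/\ continuous p, range p = U &
      forall u, U u -> exists V, [/\ open V, V u, V `<=` U & evenly_covered p V]].

Definition path_connected (X : topologicalType) : Prop :=
  (exists x : X, True) /\
  forall x y : X, exists gamma : R -> X,
    [/\ {within `[0, 1]%classic, continuous gamma},
        gamma 0 = x & gamma 1 = y].

Definition loops_contractible (X : topologicalType) : Prop :=
  forall gamma : R -> X,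
    {within `[0, 1]%classic, continuous gamma} -> gamma 0 = gamma 1 ->
  exists H : R * R -> X,
    [/\ {within `[0, 1]%classic `*` `[0, 1]%classic, continuous H},
        (forall s, 0 <= s <= 1 -> H (s, 0) = gamma s),
        (forall s, 0 <= s <= 1 -> H (s, 1) = gamma 0) &
        (forall r, 0 <= r <= 1 -> H (0, r) = gamma 0 /\ H (1, r) = gamma 0)].

Definition universal_covering (X Y : topologicalType) (p : X -> Y)
    (U : set Y) : Prop :=
  [/\ covering_map p U, path_connected X & loops_contractible X].

End UniversalCovering.

(* Complex analysis on a space X in which p : X -> C^n is a local
   homeomorphism, so that p gives local coordinates t_1, ..., t_n. *)
Section LocalCoordinates.
Context (R : realType) (n : nat) (X : topologicalType) (p : X -> 'rV[CC R]_n).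

(* s is, near p x, a continuous section of p through x; its germ at p x is the
   inverse of the local chart p at x. *)
Definition is_local_inverse (x : X) (s : 'rV[CC R]_n -> X) : Prop :=
  s (p x) = x /\
  \forall t \near p x, p (s t) = t /\ {for t, continuous s}.

Definition local_inverse (x : X) : 'rV[CC R]_n -> X :=
  xget (fun=> x) [set s | is_local_inverse x s].

Definition holomorphic_at (W : normedModType (CC R)) (f : X -> W) (x : X) :=
  \forall t \near p x, differentiable (f \o local_inverse x) t.

Definition holomorphic_on (W : normedModType (CC R)) (A : set X) (f : X -> W) :=
  forall x, A x -> holomorphic_at f x.

(* partial derivative with respect to the k-th coordinate *)
Definition pd (W : normedModType (CC R)) (k : 'I_n) (f : X -> W) (x : X) : W :=
  'D_(delta_mx 0 k) (f \o local_inverse x) (p x).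

Definition hypersurface (Theta : set X) : Prop :=
  closed Theta /\
  forall x, exists h : X -> CC R,
    [/\ holomorphic_at h x,
        (\forall y \near x, Theta y <-> h y = 0) &
        ~ (\forall y \near x, h y = 0)].

Definition meromorphic_along (W : normedModType (CC R)) (Theta : set X)
    (f : X -> W) : Prop :=
  holomorphic_on (~` Theta) f /\
  forall x, exists (h : X -> CC R) (q : X -> W),
    [/\ holomorphic_at h x, holomorphic_at q x &
        \forall y \near x, ~ Theta y -> h y != 0 /\ f y = (h y)^-1 *: q y].

(* Connections on the trivial bundle of rank n over X x C_z whose matrix is
     sum_k (pole_t k / z + reg_t k) dt_k + (pole_z / z + reg_z) dz / z. *)
Record zconnection : Type := ZConnection {
  pole_t : 'I_n -> X -> 'M[CC R]_n;
  reg_t : 'I_n -> X -> 'M[CC R]_n;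
  pole_z : X -> 'M[CC R]_n;
  reg_z : X -> 'M[CC R]_n }.

Definition matrix_t (c : zconnection) (k : 'I_n) (x : X) (z : CC R) :=
  z^-1 *: pole_t c k x + reg_t c k x.

Definition matrix_z (c : zconnection) (x : X) (z : CC R) :=
  z^-1 *: (z^-1 *: pole_z c x + reg_z c x).

(* d Omega + Omega /\ Omega = 0 on A x C^* *)
Definition integrable_on (A : set X) (c : zconnection) : Prop :=
  forall x, A x -> forall z : CC R, z != 0 ->
  (forall k l : 'I_n,
     pd k (fun y => matrix_t c l y z) x - pd l (fun y => matrix_t c k y z) x
     + mxcomm (matrix_t c k x z) (matrix_t c l x z) = 0) /\
  (forall k : 'I_n,
     pd k (fun y => matrix_z c y z) x
     - derive1 (fun s : CC R => matrix_t c k x s) z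
     + mxcomm (matrix_t c k x z) (matrix_z c x z) = 0).

(* Existence near x of P = sum_m P_m z^m, with P_0 invertible and the P_m
   holomorphic on a common neighbourhood, such that dP + Omega P = P Omega',
   where Omega, Omega' are the matrices of c, c'.  The equations are the
   coefficients of z^m in
     z d_k P + (pole_t + z reg_t) P = P (pole_t' + z reg_t')  and
     z^2 d_z P + (pole_z + z reg_z) P = P (pole_z' + z reg_z'). *)
Definition formally_equivalent_at (c c' : zconnection) (x : X) : Prop :=
  exists P : nat -> X -> 'M[CC R]_n,
  \forall y \near x,
    [/\ (forall m, holomorphic_at (P m) y),
        P 0%N y \in unitmx,
        (forall k, pole_t c k y *m P 0%N y = P 0%N y *m pole_t c' k y) /\
        pole_z c y *m P 0%N y = P 0%N y *m pole_z c' y,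
        (forall m k, pd k (P m) y + pole_t c k y *m P m.+1 y
                       + reg_t c k y *m P m y
                     = P m.+1 y *m pole_t c' k y + P m y *m reg_t c' k y) &
        (forall m, P m y *+ m + pole_z c y *m P m.+1 y + reg_z c y *m P m y
                     = P m.+1 y *m pole_z c' y + P m y *m reg_z c' y)].

Definition Lambda (x : X) : 'M[CC R]_n := diag_mx (p x).

(* coefficient of dt_k in d Lambda(t) *)
Definition dLambda (k : 'I_n) : 'M[CC R]_n := delta_mx k k.

(* - d(Lambda / z) + ([Lambda, F] + D) dz / z - [d Lambda, F], using
   - d(Lambda / z) = - d Lambda / z + Lambda dz / z^2 *)
Definition deformed_connection (F : X -> 'M[CC R]_n) (D : 'M[CC R]_n) :=
  ZConnection (fun k _ => - dLambda k)
              (fun k x => - mxcomm (dLambda k) (F x))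
              Lambda
              (fun x => mxcomm (Lambda x) (F x) + D).

(* - d(Lambda / z) + D dz / z *)
Definition formal_model (D : 'M[CC R]_n) :=
  ZConnection (fun k _ => - dLambda k) (fun _ _ => 0) Lambda (fun=> D).

Definition integrable_deformation (xo : X) (A1 : 'M[CC R]_n) (Theta : set X)
    (F : X -> 'M[CC R]_n) : Prop :=
  let c := deformed_connection F (dpart A1) in
  [/\ hypersurface Theta /\ ~ Theta xo,
      meromorphic_along Theta F /\ (forall x i, ~ Theta x -> F x i i = 0),
      integrable_on (~` Theta) c,
      (forall z : CC R, z != 0 ->
         matrix_z c xo z = z^-1 *: (z^-1 *: Lambda xo + A1)) &
      (forall x, ~ Theta x ->
         formally_equivalent_at c (formal_model (dpart A1)) x)].

(* connection matrix of nabla = d - [d Lambda, F] on E = O^n *)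
Definition nablaE (F : X -> 'M[CC R]_n) (k : 'I_n) (x : X) : 'M[CC R]_n :=
  - mxcomm (dLambda k) (F x).

(* Higgs field Phi = - d Lambda *)
Definition Phi (k : 'I_n) : 'M[CC R]_n := - dLambda k.

Definition flat_extension (xo : X) (omega_o : 'cV[CC R]_n) (Theta : set X)
    (F : X -> 'M[CC R]_n) (omega : X -> 'cV[CC R]_n) : Prop :=
  [/\ meromorphic_along Theta omega,
      (forall x k, ~ Theta x -> pd k omega x + nablaE F k x *m omega x = 0) &
      omega xo = omega_o].

(* Frobenius manifold structures.  A vector field is the column of its
   components in the frame d/dt_1, ..., d/dt_n, the metric is its Gram matrix,
   and Gamma k, mu k are the matrices of the connection form and of the product
   in the direction d/dt_k. *)
Section Frobenius.
Context (M : set X) (g : X -> 'M[CC R]_n) (Gamma mu : 'I_n -> X -> 'M[CC R]_n)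
        (e E : X -> 'cV[CC R]_n).
Implicit Types (xi eta : X -> 'cV[CC R]_n).

Definition coord_field (k : 'I_n) : X -> 'cV[CC R]_n := fun=> delta_mx k 0.

Definition deriv_along xi (f : X -> CC R) (x : X) : CC R :=
  \sum_k xi x k 0 * pd k f x.

Definition lie_bracket xi eta (x : X) : 'cV[CC R]_n :=
  \sum_k (xi x k 0 *: pd k eta x - eta x k 0 *: pd k xi x).

Definition covd xi eta (x : X) : 'cV[CC R]_n :=
  \sum_k xi x k 0 *: (pd k eta x + Gamma k x *m eta x).

Definition prod_field xi eta (x : X) : 'cV[CC R]_n :=
  \sum_k xi x k 0 *: (mu k x *m eta x).

Definition pairing xi eta (x : X) : CC R :=
  ((xi x)^T *m g x *m eta x) 0 0.

Local Notation "''d_' k" := (coord_field k) (at level 8, k at level 2).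

(* Every axiom below is tensorial, hence is stated on the coordinate fields
   (whose brackets vanish). *)
Record frobenius_structure : Prop := FrobeniusStructure {
  frob_open : open M;
  frob_holo_metric : holomorphic_on M g;
  frob_holo_conn : forall k, holomorphic_on M (Gamma k);
  frob_holo_prod : forall k, holomorphic_on M (mu k);
  frob_holo_unit : holomorphic_on M e;
  frob_holo_euler : holomorphic_on M E;
  frob_metric_sym : forall x, M x -> (g x)^T = g x;
  frob_metric_nondeg : forall x, M x -> g x \in unitmx;
  frob_torsion_free : forall x k l, M x ->
    covd 'd_k 'd_l x - covd 'd_l 'd_k x = lie_bracket 'd_k 'd_l x;
  frob_metric_compatible : forall x k i j, M x ->
    deriv_along 'd_k (pairing 'd_i 'd_j) x =
    pairing (covd 'd_k 'd_i) 'd_j x + pairing 'd_i (covd 'd_k 'd_j) x;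
  frob_flat : forall x k l m, M x ->
    covd 'd_k (covd 'd_l 'd_m) x = covd 'd_l (covd 'd_k 'd_m) x;
  frob_prod_comm : forall x k l, M x ->
    prod_field 'd_k 'd_l x = prod_field 'd_l 'd_k x;
  frob_prod_assoc : forall x k l m, M x ->
    prod_field (prod_field 'd_k 'd_l) 'd_m x =
    prod_field 'd_k (prod_field 'd_l 'd_m) x;
  frob_unit : forall x k, M x -> prod_field e 'd_k x = 'd_k x;
  frob_metric_prod : forall x k l m, M x ->
    pairing (prod_field 'd_k 'd_l) 'd_m x =
    pairing 'd_k (prod_field 'd_l 'd_m) x;
  frob_unit_flat : forall x k, M x -> covd 'd_k e x = 0;
  (* (nabla_k star)(d_l, d_m) is symmetric in k and l; equivalently, nabla of
     the trilinear form g(xi star eta, zeta) is totally symmetric *)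
  frob_potential : forall x k l m, M x ->
    covd 'd_k (prod_field 'd_l 'd_m) x - prod_field (covd 'd_k 'd_l) 'd_m x
      - prod_field 'd_l (covd 'd_k 'd_m) x =
    covd 'd_l (prod_field 'd_k 'd_m) x - prod_field (covd 'd_l 'd_k) 'd_m x
      - prod_field 'd_k (covd 'd_l 'd_m) x;
  frob_euler_affine : forall x k l, M x ->
    covd 'd_k (covd 'd_l E) x - covd (covd 'd_k 'd_l) E x = 0;
  frob_euler_prod : forall x k l, M x ->
    lie_bracket E (prod_field 'd_k 'd_l) x
      - prod_field (lie_bracket E 'd_k) 'd_l x
      - prod_field 'd_k (lie_bracket E 'd_l) x = prod_field 'd_k 'd_l x;
  frob_euler_metric : exists D : CC R, forall x k l, M x ->
    deriv_along E (pairing 'd_k 'd_l) x - pairing (lie_bracket E 'd_k) 'd_l x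
      - pairing 'd_k (lie_bracket E 'd_l) x = D * pairing 'd_k 'd_l x }.

End Frobenius.

(* Matrix of phi_omega : xi |-> - Phi_xi omega in the frame d/dt_k of the
   tangent bundle and the canonical basis of E. *)
Definition period_map (omega : X -> 'cV[CC R]_n) (x : X) : 'M[CC R]_n :=
  \matrix_(i, k) (- (Phi k *m omega x)) i 0.

Definition period_metric (omega : X -> 'cV[CC R]_n) (x : X) : 'M[CC R]_n :=
  (period_map omega x)^T *m period_map omega x.

Definition period_connection (F : X -> 'M[CC R]_n) (omega : X -> 'cV[CC R]_n)
    (k : 'I_n) (x : X) : 'M[CC R]_n :=
  invmx (period_map omega x) *m
    (pd k (period_map omega) x + nablaE F k x *m period_map omega x).

Definition period_product (omega : X -> 'cV[CC R]_n) (k : 'I_n) (x : X) :=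
  invmx (period_map omega x) *m (- Phi k) *m period_map omega x.

Definition unit_field (x : X) : 'cV[CC R]_n := const_mx 1.

Definition euler_field (x : X) : 'cV[CC R]_n := (p x)^T.

Definition period_map_endows_frobenius (M : set X) (F : X -> 'M[CC R]_n)
    (omega : X -> 'cV[CC R]_n) : Prop :=
  (forall x, M x -> period_map omega x \in unitmx) /\
  frobenius_structure M (period_metric omega) (period_connection F omega)
    (period_product omega) unit_field euler_field.

End LocalCoordinates.

(* Main.v *)
(* Put V = [Lambda, F] + A1^d, the residue of the deformed connection.
   Integrability says that V is horizontal for nabla = d - [dLambda, F], i.e.
   d_k V = [[d_k Lambda, F], V]; written on the entries of F this is a system
   d_k ((t_i - t_j) F_ij) = quadratic in F.  At t_o the skewness of
   A1 - (w/2) Id only says that F_ij = F_ji when t_i <> t_j.  Along rays from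
   t_o the system has a regular singularity at the origin in the remaining
   entries, and a contraction estimate shows that F - F^T vanishes on a
   neighbourhood of t_o.  The eigenvector equation V omega = a omega also
   spreads locally, (V - a) omega being a nabla-flat section vanishing at t_o.
   Both properties are open and closed off Theta, and the complement of the
   hypersurface Theta is connected because the zeros of a one-variable
   holomorphic function do not disconnect the disc.

   The symmetry of F makes nabla metric and makes its pullback by
   diag(omega) torsion free, hence the Levi-Civita connection; the eigenvector
   equation makes the Euler field affine and conformal.  The remaining axioms
   are identities between the entries of F, omega and their derivatives. *)
Require Import Defs.
From HB Require Import structures.
From mathcomp Require Import all_boot all_order all_algebra.
From mathcomp Require Import complex.
From mathcomp Require Import all_classical all_reals all_analysis.
From mathcomp Require Import ring lra.

Set Implicit Arguments.
Unset Strict Implicit.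
Unset Printing Implicit Defensive.

Import Order.TTheory GRing.Theory Num.Theory.
Import numFieldNormedType.Exports.

Local Open Scope classical_set_scope.
Local Open Scope ring_scope.

(** * Goursat's theorem with an exceptional point *)

Section RealSegmentIntegrals.
Context (R : realType).
Implicit Types (g h : R -> R) (a b c : R).

Definition segment_integral g a b : R :=
  \int[lebesgue_measure]_(x in `[a, b]) g x.

Lemma segment_integrable g a b : {within `[a, b], continuous g} ->
  lebesgue_measure.-integrable `[a, b] (EFin \o g).
Proof. by move=> cg; apply: continuous_compact_integrable => //; exact: segment_compact. Qed.

Lemma segment_integral_cat g a b c : a <= b -> b <= c ->
  {within `[a, c], continuous g} ->
  segment_integral g a c = segment_integral g a b + segment_integral g b c.
Proof.
move=> ab bc cg; rewrite addrC; apply/eqP; rewrite -subr_eq; apply/eqP.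
rewrite /segment_integral Rintegral_itvB ?bnd_simp//; last exact: segment_integrable.
rewrite Rintegral_itv_obnd_cbnd//.
apply: integrableS (segment_integrable cg) => //.
by apply: subset_itvr; rewrite bnd_simp.
Qed.

Lemma segment_integralD g h a b :
  {within `[a, b], continuous g} -> {within `[a, b], continuous h} ->
  segment_integral (g \+ h) a b = segment_integral g a b + segment_integral h a b.
Proof. by move=> cg ch; apply: RintegralD => //; exact: segment_integrable. Qed.

Lemma segment_integralB g h a b :
  {within `[a, b], continuous g} -> {within `[a, b], continuous h} ->
  segment_integral (g \- h) a b = segment_integral g a b - segment_integral h a b.
Proof. by move=> cg ch; apply: RintegralB => //; exact: segment_integrable. Qed.

Lemma segment_integral_cst (k : R) a b : a <= b ->
  segment_integral (fun=> k) a b = k * (b - a).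
Proof.
move=> ab; rewrite /segment_integral Rintegral_cst//= lebesgue_measure_itv/= lte_fin.
by move: ab; rewrite le_eqVlt => /predU1P[->|->//]; rewrite ltxx subrr.
Qed.

Lemma eq_segment_integral g h a b : (forall x, a <= x <= b -> g x = h x) ->
  segment_integral g a b = segment_integral h a b.
Proof.
move=> gh; apply: eq_Rintegral => x; rewrite inE/= in_itv/=; exact: gh.
Qed.

Lemma le_segment_integral g h a b :
  {within `[a, b], continuous g} -> {within `[a, b], continuous h} ->
  (forall x, a <= x <= b -> g x <= h x) ->
  segment_integral g a b <= segment_integral h a b.
Proof.
by move=> cg ch gh; apply: le_Rintegral => //; exact: segment_integrable.
Qed.

Lemma segment_integral_bound g a b (k : R) : a <= b ->
  {within `[a, b], continuous g} ->
  (forall x, a <= x <= b -> `|g x| <= k) ->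
  `|segment_integral g a b| <= k * (b - a).
Proof.
move=> ab cg gk.
have ck m : {within `[a, b], continuous (fun=> m : R)} by move=> x; exact: cvg_cst.
rewrite ler_norml -mulNr -!(segment_integral_cst _ ab); apply/andP; split.
  by apply: le_segment_integral => // x /gk; rewrite ler_norml => /andP[].
by apply: le_segment_integral => // x /gk; rewrite ler_norml => /andP[].
Qed.

End RealSegmentIntegrals.

Section Goursat.
Context (R : realType).
Local Open Scope complex_scope.
Local Notation C := R[i].
Local Notation normc := (@ComplexField.Normc.normc R).
Implicit Types (f g : C -> C) (z w : C) (a b c d : R).

Definition cdifferentiable f z := exists l : C, forall e : R, 0 < e ->
  exists2 r : R, 0 < r & forall w, normc (w - z) <= r ->
    normc (f w - f z - l * (w - z)) <= e * normc (w - z).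

Definition ccontinuous f z := forall e : R, 0 < e ->
  exists2 r : R, 0 < r & forall w, normc (w - z) <= r -> normc (f w - f z) <= e.

Lemma normc_ge0 z : 0 <= normc z.
Proof. by case: z => x y; exact: sqrtr_ge0. Qed.

Lemma normcB z w : normc (z - w) = normc (w - z).
Proof. by rewrite -normcN opprB. Qed.

Lemma le_normcB z w : normc (z - w) <= normc z + normc w.
Proof. by rewrite (le_trans (le_normcD _ _))// normcN. Qed.

Lemma normc_lipschitz z w : `|normc z - normc w| <= normc (z - w).
Proof.
rewrite ler_distl lerBlDr; apply/andP; split.
  by rewrite -{1}(subrK z w) (le_trans (le_normcD _ _))// addrC normcB.
by rewrite -{1}(subrK w z) (le_trans (le_normcD _ _))// addrC.
Qed.

Lemma normc_ge_absRe z : `|complex.Re z| <= normc z.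
Proof.
case: z => x y /=; rewrite -sqrtr_sqr ler_wsqrtr//.
by rewrite lerDl sqr_ge0.
Qed.

Lemma normc_ge_absIm z : `|complex.Im z| <= normc z.
Proof.
case: z => x y /=; rewrite -sqrtr_sqr ler_wsqrtr//.
by rewrite lerDr sqr_ge0.
Qed.

Lemma normc_le_ReIm z : normc z <= `|complex.Re z| + `|complex.Im z|.
Proof.
case: z => x y /=.
rewrite -[leRHS]ger0_norm ?addr_ge0// -sqrtr_sqr ler_wsqrtr//.
by rewrite sqrrD !real_normK ?num_real// -addrA lerD2l lerDr mulrn_wge0// mulr_ge0.
Qed.

Lemma normcR (x : R) : normc x%:C = `|x|.
Proof. by rewrite /= expr0n addr0 sqrtr_sqr. Qed.

Lemma cdifferentiable_continuous f z : cdifferentiable f z -> ccontinuous f z.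
Proof.
move=> [l fl] e e0; have [r r0 fr] := fl 1 ltr01.
have k0 : 0 < 1 + normc l by rewrite ltr_wpDr// normc_ge0.
exists (Num.min r (e / (1 + normc l))); first by rewrite lt_min r0 divr_gt0.
move=> w; rewrite le_min => /andP[wr we].
rewrite -[f w - f z](subrK (l * (w - z))) (le_trans (le_normcD _ _))//.
rewrite (le_trans (lerD (fr _ wr) (lexx _)))// ComplexField.Normc.normcM -mulrDl.
by rewrite mulrC -ler_pdivlMr.
Qed.

Lemma ccontinuousD f g z : ccontinuous f z -> ccontinuous g z -> ccontinuous (f \+ g) z.
Proof.
move=> fz gz e e0; have e20 : 0 < e / 2 by rewrite divr_gt0.
have [r r0 rP] := fz _ e20; have [s s0 sP] := gz _ e20.
exists (Num.min r s) => [|w]; first by rewrite lt_min r0.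
rewrite le_min => /andP[/rP wr /sP ws] /=; rewrite opprD addrACA.
by rewrite (le_trans (le_normcD _ _))// [leRHS]splitr lerD.
Qed.

Definition rectangle a b c d : set C :=
  [set z | a <= complex.Re z <= b /\ c <= complex.Im z <= d].

Definition horizontal_integral f a b y : R :=
  segment_integral (fun x => complex.Re (f (x +i* y))) a b.

Definition vertical_integral f c d x : R :=
  segment_integral (fun y => complex.Im (f (x +i* y))) c d.

(* The real part of the integral of [f dz] along the positively oriented
   boundary of [rectangle a b c d]; it suffices for Goursat's lemma, as [f] may
   be multiplied by a constant. *)
Definition boundary_integral f a b c d : R :=
  horizontal_integral f a b c - horizontal_integral f a b d
  - (vertical_integral f c d b - vertical_integral f c d a).

Lemma within_of_ccontinuous f (u : C -> R) (s : R -> C) a b :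
  (forall z w, `|u z - u w| <= normc (z - w)) ->
  (forall x y, normc (s x - s y) <= `|x - y|) ->
  (forall x, a <= x <= b -> ccontinuous f (s x)) ->
  {within `[a, b], continuous (fun x => u (f (s x)))}.
Proof.
move=> u1 s1 fc; apply: continuous_in_subspaceT => x; rewrite inE/= in_itv/= => xab.
apply/cvgrPdist_le => /= e e0; have [r r0 fr] := fc x xab e e0.
by near=> y; rewrite distrC (le_trans (u1 _ _))// fr// (le_trans (s1 _ _)).
Unshelve. all: by end_near. Qed.

Lemma Re_lipschitz z w : `|complex.Re z - complex.Re w| <= normc (z - w).
Proof. by case: z w => ? ? [? ?]; exact: (normc_ge_absRe (Complex _ _)). Qed.

Lemma Im_lipschitz z w : `|complex.Im z - complex.Im w| <= normc (z - w).
Proof. by case: z w => ? ? [? ?]; exact: (normc_ge_absIm (Complex _ _)). Qed.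

Lemma horizontal_isometry c x y : normc (x +i* c - y +i* c) <= `|x - y|.
Proof.
have -> : x +i* c - y +i* c = (x - y)%:C by apply/eqP; rewrite eq_complex/= subrr !eqxx.
by rewrite normcR.
Qed.

Lemma vertical_isometry a x y : normc (a +i* x - a +i* y) <= `|x - y|.
Proof.
have -> : a +i* x - a +i* y = 0 +i* (x - y) by apply/eqP; rewrite eq_complex/= subrr !eqxx.
by rewrite /= expr0n/= add0r sqrtr_sqr.
Qed.

Section Rectangle.
Context (a b c d : R).
Hypothesis ab : a <= b.
Hypothesis cd : c <= d.
Implicit Types (h k : C -> C).

Lemma Re_horizontal_continuous h y :
  (forall x, a <= x <= b -> ccontinuous h (x +i* y)) ->
  {within `[a, b], continuous (fun x => complex.Re (h (x +i* y)))}.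
Proof.
move=> hc; apply: within_of_ccontinuous => //.
- exact: Re_lipschitz.
- exact: horizontal_isometry.
Qed.

Lemma Im_vertical_continuous h x :
  (forall y, c <= y <= d -> ccontinuous h (x +i* y)) ->
  {within `[c, d], continuous (fun y => complex.Im (h (x +i* y)))}.
Proof.
move=> hc; apply: within_of_ccontinuous => //.
- exact: Im_lipschitz.
- exact: vertical_isometry.
Qed.

Definition boundary_continuous h :=
  (forall x, a <= x <= b -> ccontinuous h (x +i* c) /\ ccontinuous h (x +i* d)) /\
  (forall y, c <= y <= d -> ccontinuous h (a +i* y) /\ ccontinuous h (b +i* y)).

Definition boundary_bounded h M :=
  (forall x, a <= x <= b -> normc (h (x +i* c)) <= M /\ normc (h (x +i* d)) <= M) /\
  (forall y, c <= y <= d -> normc (h (a +i* y)) <= M /\ normc (h (b +i* y)) <= M).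

Lemma continuous_boundary h :
  (forall z, rectangle a b c d z -> ccontinuous h z) -> boundary_continuous h.
Proof. by move=> hc; split=> [x|y] ?; split; apply: hc; split; rewrite /= ?lexx ?ab ?cd. Qed.

Lemma bounded_boundary h M :
  (forall z, rectangle a b c d z -> normc (h z) <= M) -> boundary_bounded h M.
Proof. by move=> hc; split=> [x|y] ?; split; apply: hc; split; rewrite /= ?lexx ?ab ?cd. Qed.

Lemma boundary_integralD h k : boundary_continuous h -> boundary_continuous k ->
  boundary_integral (h \+ k) a b c d =
  boundary_integral h a b c d + boundary_integral k a b c d.
Proof.
move=> [hx hy] [kx ky].
have hD y : (y = c) \/ (y = d) -> horizontal_integral (h \+ k) a b y =
    horizontal_integral h a b y + horizontal_integral k a b y.
  move=> ycd; rewrite -segment_integralD; last 2 first.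
  - by apply: Re_horizontal_continuous => x /hx[]; case: ycd => ->.
  - by apply: Re_horizontal_continuous => x /kx[]; case: ycd => ->.
  by apply: eq_segment_integral => x _ /=; case: (h _) (k _) => ? ? [].
have vD x : (x = a) \/ (x = b) -> vertical_integral (h \+ k) c d x =
    vertical_integral h c d x + vertical_integral k c d x.
  move=> xab; rewrite -segment_integralD; last 2 first.
  - by apply: Im_vertical_continuous => y /hy[]; case: xab => ->.
  - by apply: Im_vertical_continuous => y /ky[]; case: xab => ->.
  by apply: eq_segment_integral => y _ /=; case: (h _) (k _) => ? ? [].
rewrite /boundary_integral (hD c) ?(hD d) ?(vD a) ?(vD b); [ring|auto..].
Qed.

Lemma boundary_integral_bound h M : boundary_continuous h -> boundary_bounded h M ->
  `|boundary_integral h a b c d| <= 2 * M * (b - a + (d - c)).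
Proof.
move=> [hx hy] [Mx My].
have hB y : (y = c) \/ (y = d) -> `|horizontal_integral h a b y| <= M * (b - a).
  move=> ycd; apply: segment_integral_bound => //.
    by apply: Re_horizontal_continuous => x /hx[]; case: ycd => ->.
  move=> x xab; rewrite (le_trans (normc_ge_absRe _))//.
  by have [] := Mx x xab; case: ycd => ->.
have vB x : (x = a) \/ (x = b) -> `|vertical_integral h c d x| <= M * (d - c).
  move=> xab; apply: segment_integral_bound => //.
    by apply: Im_vertical_continuous => y /hy[]; case: xab => ->.
  move=> y ycd; rewrite (le_trans (normc_ge_absIm _))//.
  by have [] := My y ycd; case: xab => ->.
rewrite /boundary_integral (le_trans (ler_normB _ _))//.
have -> : 2 * M * (b - a + (d - c)) = M * (b - a) + M * (b - a) + (M * (d - c) + M * (d - c)).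
  by ring.
by apply: lerD; rewrite (le_trans (ler_normB _ _))//; apply: lerD; auto.
Qed.

Lemma boundary_integral_affine (u v : C) :
  boundary_integral (fun z => u + v * z) a b c d = 0.
Proof.
have fc z : ccontinuous (fun z => u + v * z) z.
  move=> e e0; have k0 : 0 < normc v + 1 by rewrite ltr_wpDl ?normc_ge0.
  exists (e / (normc v + 1)); first by rewrite divr_gt0.
  move=> w; rewrite ler_pdivlMr// opprD addrACA subrr add0r -mulrBr.
  rewrite ComplexField.Normc.normcM; apply: le_trans; rewrite mulrC ler_wpM2l ?normc_ge0//.
  by rewrite lerDl.
rewrite /boundary_integral -!segment_integralB; last first.
- by apply: (@Re_horizontal_continuous (fun z => u + v * z) d) => *; exact: fc.
- by apply: (@Re_horizontal_continuous (fun z => u + v * z) c) => *; exact: fc.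
- by apply: (@Im_vertical_continuous (fun z => u + v * z) a) => *; exact: fc.
- by apply: (@Im_vertical_continuous (fun z => u + v * z) b) => *; exact: fc.
case: u v {fc} => u1 u2 [v1 v2].
rewrite (@eq_segment_integral _ _ (fun=> v2 * (d - c)) a b); last first.
  by move=> x _ /=; ring.
rewrite (@eq_segment_integral _ _ (fun=> v2 * (b - a)) c d); last first.
  by move=> x _ /=; ring.
by rewrite !segment_integral_cst//; ring.
Qed.

Lemma boundary_integral_splitx h m : a <= m -> m <= b ->
  (forall z, rectangle a b c d z -> ccontinuous h z) ->
  boundary_integral h a b c d =
  boundary_integral h a m c d + boundary_integral h m b c d.
Proof.
move=> am mb hc; rewrite /boundary_integral /horizontal_integral.
rewrite !(segment_integral_cat am mb); last first.
- by apply: Re_horizontal_continuous => x ?; apply: hc; split; rewrite //= cd lexx.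
- by apply: Re_horizontal_continuous => x ?; apply: hc; split; rewrite //= cd lexx.
by ring.
Qed.

Lemma boundary_integral_splity h m : c <= m -> m <= d ->
  (forall z, rectangle a b c d z -> ccontinuous h z) ->
  boundary_integral h a b c d =
  boundary_integral h a b c m + boundary_integral h a b m d.
Proof.
move=> cm md hc; rewrite /boundary_integral /vertical_integral.
rewrite !(segment_integral_cat cm md); last first.
- by apply: Im_vertical_continuous => x ?; apply: hc; split; rewrite //= ab lexx.
- by apply: Im_vertical_continuous => x ?; apply: hc; split; rewrite //= ab lexx.
by ring.
Qed.

End Rectangle.

Lemma bisection (P : R -> R -> R -> R -> Prop) a b c d :
  a <= b -> c <= d ->
  (forall a' b' c' d', a <= a' -> a' <= b' -> b' <= b ->
     c <= c' -> c' <= d' -> d' <= d ->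
     let m := (a' + b') / 2 in let n := (c' + d') / 2 in
     P a' m c' n -> P m b' c' n -> P a' m n d' -> P m b' n d' -> P a' b' c' d') ->
  (forall z, rectangle a b c d z -> exists2 r : R, 0 < r &
     forall a' b' c' d', a <= a' -> b' <= b -> c <= c' -> d' <= d ->
       rectangle a' b' c' d' z -> b' - a' <= r -> d' - c' <= r -> P a' b' c' d') ->
  P a b c d.
Proof.
move=> ab cd quarter small; apply: contrapT => nP.
pose T := (R * R * (R * R))%type.
pose ok (q : T) := [/\ [/\ a <= q.1.1, q.1.1 <= q.1.2 & q.1.2 <= b],
  [/\ c <= q.2.1, q.2.1 <= q.2.2 & q.2.2 <= d] & ~ P q.1.1 q.1.2 q.2.1 q.2.2].
pose sub (q q' : T) := [/\ q.1.1 <= q'.1.1, q'.1.2 <= q.1.2, q.2.1 <= q'.2.1,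
  q'.2.2 <= q.2.2 &
  q'.1.2 - q'.1.1 = (q.1.2 - q.1.1) / 2 /\ q'.2.2 - q'.2.1 = (q.2.2 - q.2.1) / 2].
have step q : exists q', ok q -> ok q' /\ sub q q'.
  have [|nq] := pselect (ok q); last by exists q.
  case: q => -[a' b'] [c' d'] [/= [aa ab' bb] [cc cd' dd] nP'].
  have := quarter _ _ _ _ aa ab' bb cc cd' dd.
  set m := (a' + b') / 2; set n := (c' + d') / 2 => /= qP.
  have mE : m + m = a' + b' by rewrite /m; lra.
  have nE : n + n = c' + d' by rewrite /n; lra.
  have [am mb] : a' <= m /\ m <= b' by split; lra.
  have [cn nd] : c' <= n /\ n <= d' by split; lra.
  have [mb2 am2] : b' - m = (b' - a') / 2 /\ m - a' = (b' - a') / 2 by split; lra.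
  have [nd2 cn2] : d' - n = (d' - c') / 2 /\ n - c' = (d' - c') / 2 by split; lra.
  have [mB nD] : m <= b /\ n <= d by split; lra.
  have [Am Cn] : a <= m /\ c <= n by split; lra.
  apply: contrapT => H; apply: nP'.
  by apply: qP; apply: contrapT => nQ; apply: H;
    [exists ((a', m), (c', n))|exists ((m, b'), (c', n))|
     exists ((a', m), (n, d'))|exists ((m, b'), (n, d'))] => _; split.
have [nx nxP] := choice step.
pose q k := iter k nx ((a, b), (c, d)) : T.
have okq k : ok (q k).
  elim: k => [|k IH]; first by split => //=.
  by have [] := nxP _ IH.
have subq k : sub (q k) (q k.+1) by have [] := nxP _ (okq k).
have lenx k : (q k).1.2 - (q k).1.1 = (b - a) / 2 ^+ k.
  elim: k => [|k IH]; first by rewrite expr0 divr1.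
  by have [_ _ _ _ [-> _]] := subq k; rewrite IH exprS invfM; ring.
have leny k : (q k).2.2 - (q k).2.1 = (d - c) / 2 ^+ k.
  elim: k => [|k IH]; first by rewrite expr0 divr1.
  by have [_ _ _ _ [_ ->]] := subq k; rewrite IH exprS invfM; ring.
have nested (l u : nat -> R) : (forall k, l k <= l k.+1) -> (forall k, u k.+1 <= u k) ->
    (forall k, l k <= u k) -> exists x, forall k, l k <= x <= u k.
  move=> li ud lu.
  have lmono : {homo l : i j / (i <= j)%N >-> i <= j}.
    by apply: homo_leq => // ? ? ?; exact: le_trans.
  have umono : {homo u : i j / (i <= j)%N >-> j <= i}.
    by apply: homo_leq => // x y z xy yz; exact: le_trans yz xy.
  have lu' i j : l i <= u j.
    rewrite (le_trans (lmono i (maxn i j) _)) ?leq_maxl//.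
    by rewrite (le_trans (lu _))// umono// leq_maxr.
  exists (sup (range l)) => k; apply/andP; split.
    apply: ub_le_sup; last by exists k.
    by exists (u 0%N) => _ [j _ <-].
  by apply: ge_sup; [exists (l 0%N); exists 0%N|move=> _ [j _ <-]].
have [x xP] : exists x, forall k, (q k).1.1 <= x <= (q k).1.2.
  apply: nested => k; first by have [] := subq k.
    by have [] := subq k.
  by have [[]] := okq k.
have [y yP] : exists y, forall k, (q k).2.1 <= y <= (q k).2.2.
  apply: nested => k; first by have [] := subq k.
    by have [] := subq k.
  by have [_ []] := okq k.
have [r r0 rP] := small (x +i* y) (conj (xP 0%N) (yP 0%N)).
have [k kP] : exists k, (b - a + (d - c)) / 2 ^+ k <= r.
  have := @cvg_geometric R (b - a + (d - c)) (2^-1).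
  rewrite ger0_norm// => /(_ ltac:(lra)) /cvgrPdist_le /(_ r r0) [k _ /(_ k (leqnn k))] /= H.
  exists k; move: H; rewrite sub0r normrN exprVn; apply: le_trans; exact: ler_norm.
have pk : 0 < 2 ^+ k :> R by rewrite exprn_gt0.
have : (b - a) / 2 ^+ k <= (b - a + (d - c)) / 2 ^+ k by rewrite ler_pM2r ?invr_gt0//; lra.
have : (d - c) / 2 ^+ k <= (b - a + (d - c)) / 2 ^+ k by rewrite ler_pM2r ?invr_gt0//; lra.
move=> H1 H2; have [[ka _ kb] [kc _ kd] nPk] := okq k; apply: nPk.
apply: rP => //.
  by rewrite lenx (le_trans H2).
by rewrite leny (le_trans H1).
Qed.

End Goursat.

Section GoursatTheorem.
Context (R : realType).
Local Open Scope complex_scope.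
Local Notation C := R[i].
Local Notation normc := (@ComplexField.Normc.normc R).
Implicit Types (f g : C -> C) (z w : C) (a b c d : R).
Lemma goursat f a b c d : a <= b -> c <= d ->
  (forall z, rectangle a b c d z -> cdifferentiable f z) ->
  boundary_integral f a b c d = 0.
Proof.
move=> ab cd fd.
have fc z : rectangle a b c d z -> ccontinuous f z.
  by move=> /fd; exact: cdifferentiable_continuous.
apply/eqP; rewrite -normr_eq0; apply/eqP/le_anti; rewrite normr_ge0 andbT.
apply/ler_addgt0Pr => e e0; rewrite add0r.
pose s := (b - a + (d - c)) ^+ 2 + 1.
have s0 : 0 < s by rewrite ltr_wpDl// sqr_ge0.
pose e' := e / s.
have e'0 : 0 < e' by rewrite divr_gt0.
pose P a b c d := `|boundary_integral f a b c d| <= e' * (b - a + (d - c)) ^+ 2.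
suff : P a b c d.
  move=> /le_trans; apply; rewrite /e' mulrAC ler_pdivrMr// ler_pM2l//.
  by rewrite /s lerDl.
apply: (bisection (P := P)) => //.
- move=> a' b' c' d' aa ab' bb cc cd' dd m n.
  have [am mb] := midf_le ab'; have [cn nd] := midf_le cd'.
  have mE1 : b' - m = m - a' by rewrite /m {aa bb cc dd am mb cn nd}; lra.
  have nE1 : d' - n = n - c' by rewrite /n {aa bb cc dd am mb cn nd mE1}; lra.
  rewrite /P => P1 P2 P3 P4.
  have fc' a1 b1 c1 d1 : a' <= a1 -> b1 <= b' -> c' <= c1 -> d1 <= d' ->
      forall z, rectangle a1 b1 c1 d1 z -> ccontinuous f z.
    move=> h1 h2 h3 h4 z [/andP[h5 h6] /andP[h7 h8]]; apply: fc; split; apply/andP; split.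
    - exact: le_trans aa (le_trans h1 h5).
    - exact: le_trans h6 (le_trans h2 bb).
    - exact: le_trans cc (le_trans h3 h7).
    - exact: le_trans h8 (le_trans h4 dd).
  rewrite (@boundary_integral_splitx _ a' b' c' d' _ _ m)//; last exact: fc'.
  rewrite (@boundary_integral_splity _ a' m c' d' _ _ n)//; last exact: fc'.
  rewrite (@boundary_integral_splity _ m b' c' d' _ _ n)//; last exact: fc'.
  set i1 := boundary_integral f a' m c' n in P1 *.
  set i2 := boundary_integral f m b' c' n in P2 *.
  set i3 := boundary_integral f a' m n d' in P3 *.
  set i4 := boundary_integral f m b' n d' in P4 *.
  have t1 := ler_normD (i1 + i3) (i2 + i4).
  have t2 := ler_normD i1 i3; have t3 := ler_normD i2 i4.
  rewrite mE1 in P2 P4; rewrite nE1 in P3 P4.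
  have -> : b' - a' + (d' - c') = 2 * (m - a' + (n - c')).
    by rewrite -[b'](subrK m) mE1 -[d'](subrK n) nE1; ring.
  rewrite exprMn mulrCA.
  by move: (e' * _) P1 P2 P3 P4 {mE1 nE1} => k P1 P2 P3 P4; rewrite -natrX; lra.
- move=> z zQ; have [l fl] := fd z zQ.
  have [r r0 rP] := fl (e' / 2) ltac:(by rewrite divr_gt0).
  exists (r / 2); first by rewrite divr_gt0.
  move=> a' b' c' d' aa bb cc dd zQ' rx ry.
  have [/andP[z1 z2] /andP[z3 z4]] := zQ'.
  pose h w := f w - f z - l * (w - z).
  have inQ w : rectangle a' b' c' d' w -> rectangle a b c d w.
    move=> [/andP[h1 h2] /andP[h3 h4]]; split; apply/andP; split.
    - exact: le_trans aa h1.
    - exact: le_trans h2 bb.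
    - exact: le_trans cc h3.
    - exact: le_trans h4 dd.
  have dist w : rectangle a' b' c' d' w -> normc (w - z) <= b' - a' + (d' - c').
    move=> [/andP[w1 w2] /andP[w3 w4]]; rewrite (le_trans (normc_le_ReIm _))//.
    have -> : complex.Re (w - z) = complex.Re w - complex.Re z by case: (w) (z) => ? ? [].
    have -> : complex.Im (w - z) = complex.Im w - complex.Im z by case: (w) (z) => ? ? [].
    by apply: lerD; rewrite ler_norml opprB !lerB.
  pose g w := f z - l * z + l * w.
  have gc w : ccontinuous g w.
    apply: cdifferentiable_continuous; exists l => e1 e10; exists 1 => // w' _.
    have -> : g w' - g w - l * (w' - w) = 0 by rewrite /g; ring.
    by rewrite ComplexField.Normc.normc0 mulr_ge0// ?normc_ge0// ltW.
  have hc w : rectangle a' b' c' d' w -> ccontinuous h w.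
    move=> /inQ/fc fcw; have -> : h = f \+ (fun w => l * z - f z - l * w).
      by apply/funext => w'; rewrite /h /=; ring.
    apply: ccontinuousD fcw _; apply: cdifferentiable_continuous; exists (- l) => e1 e10.
    exists 1 => // w' _; have -> : l * z - f z - l * w' - (l * z - f z - l * w) - - l * (w' - w) = 0.
      by ring.
    by rewrite ComplexField.Normc.normc0 mulr_ge0// ?normc_ge0// ltW.
  have ab' : a' <= b' by lra.
  have cd' : c' <= d' by lra.
  have fE : f = h \+ g by apply/funext => w; rewrite /h /g /=; ring.
  rewrite /P [in boundary_integral f]fE boundary_integralD;
    [|exact: continuous_boundary..].
  rewrite boundary_integral_affine// addr0.
  have hM w : rectangle a' b' c' d' w -> normc (h w) <= e' / 2 * (b' - a' + (d' - c')).
    move=> wQ; have dw := dist _ wQ.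
    rewrite (le_trans (rP _ _))//; first by rewrite (le_trans dw)//; lra.
    by rewrite ler_pM2l// divr_gt0.
  have := boundary_integral_bound ab' cd' (continuous_boundary ab' cd' hc)
    (bounded_boundary ab' cd' hM).
  by move=> /le_trans; apply; rewrite expr2; lra.
Qed.

Lemma goursat_except f p a b c d :
  a < complex.Re p < b -> c < complex.Im p < d ->
  (forall z, rectangle a b c d z -> ccontinuous f z) ->
  (forall z, rectangle a b c d z -> z != p -> cdifferentiable f z) ->
  boundary_integral f a b c d = 0.
Proof.
case: p => x0 y0 /= /andP[ax xb] /andP[cy yd] fc fd.
apply/eqP; rewrite -normr_eq0; apply/eqP/le_anti; rewrite normr_ge0 andbT.
apply/ler_addgt0Pr => e e0; rewrite add0r.
have inQ : rectangle a b c d (x0 +i* y0) by split; apply/andP; split; exact: ltW.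
have [r r0 rP] := fc _ inQ 1 ltr01.
pose M := normc (f (x0 +i* y0)) + 1.
have M0 : 0 < M by rewrite ltr_wpDl// normc_ge0.
pose t := Num.min (Num.min (x0 - a) (b - x0)) (Num.min (y0 - c) (d - y0)).
pose D := Num.min t (Num.min (r / 2) (e / (8 * M))).
have D0 : 0 < D by rewrite !lt_min !subr_gt0 ax xb cy yd !divr_gt0// mulr_gt0.
have : D <= D by [].
rewrite {2}/D !le_min => /andP[/andP[/andP[D1 D2] /andP[D3 D4]] /andP[D5 D6]].
have h1 : a <= x0 - D by rewrite lerBrDr -lerBrDl.
have h2 : x0 + D <= b by rewrite -lerBrDl.
have h3 : c <= y0 - D by rewrite lerBrDr -lerBrDl.
have h4 : y0 + D <= d by rewrite -lerBrDl.
have h5 : x0 - D < x0 by rewrite ltrBlDr ltrDl.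
have h6 : x0 < x0 + D by rewrite ltrDl.
have h7 : y0 - D < y0 by rewrite ltrBlDr ltrDl.
have h8 : y0 < y0 + D by rewrite ltrDl.
have h56 := lt_trans h5 h6; have h78 := lt_trans h7 h8.
have sub a' b' c' d' z : a <= a' -> b' <= b -> c <= c' -> d' <= d ->
    rectangle a' b' c' d' z -> rectangle a b c d z.
  move=> ? ? ? ? [/andP[z1 z2] /andP[z3 z4]].
  by split; apply/andP; split; [exact: le_trans z1|exact: le_trans z2 _|
    exact: le_trans z3|exact: le_trans z4 _].
have sub_fc a' b' c' d' z : a <= a' -> b' <= b -> c <= c' -> d' <= d ->
    rectangle a' b' c' d' z -> ccontinuous f z.
  by move=> ? ? ? ? zQ; apply: fc; exact: sub zQ.
have zero a' b' c' d' : a <= a' -> b' <= b -> c <= c' -> d' <= d ->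
    a' <= b' -> c' <= d' -> ~ rectangle a' b' c' d' (x0 +i* y0) ->
    boundary_integral f a' b' c' d' = 0.
  move=> ? ? ? ? ? ? np; apply: goursat => // z zQ; apply: fd; first exact: sub zQ.
  by apply/eqP => zp; apply: np; rewrite -zp.
have ab := lt_trans ax xb; have cd := lt_trans cy yd.
have mb : x0 - D <= b := le_trans (ltW h5) (ltW xb).
have ma : a <= x0 + D := le_trans (ltW ax) (ltW h6).
have nd : y0 - D <= d := le_trans (ltW h7) (ltW yd).
have nc : c <= y0 + D := le_trans (ltW cy) (ltW h8).
rewrite (boundary_integral_splitx (ltW cd) h1 mb fc) zero// ?add0r ?(ltW cd)//; last first.
  by move=> [/= /andP[_]]; rewrite leNgt h5.
rewrite (boundary_integral_splitx (ltW cd) (ltW h56) h2); last first.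
  by move=> z; apply: sub_fc.
rewrite [X in _ + X]zero// ?addr0 ?(ltW cd)//; last first.
  by move=> [/= /andP[]]; rewrite leNgt h6.
rewrite (boundary_integral_splity (ltW h56) h3 nd); last by move=> z; apply: sub_fc.
rewrite zero// ?add0r ?(ltW h56)//; last first.
  by move=> [/= _ /andP[_]]; rewrite leNgt h7.
rewrite (boundary_integral_splity (ltW h56) (ltW h78) h4); last by move=> z; apply: sub_fc.
rewrite [X in _ + X]zero// ?addr0 ?(ltW h56)//; last first.
  by move=> [/= _ /andP[]]; rewrite leNgt h8.
have fM z : rectangle (x0 - D) (x0 + D) (y0 - D) (y0 + D) z -> normc (f z) <= M.
  case: z => x y [/= xQ yQ]; rewrite -[f _](subrK (f (x0 +i* y0))) (le_trans (le_normcD _ _))//.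
  rewrite addrC lerD2l rP// (le_trans (normc_le_ReIm _))// [leRHS]splitr /=.
  by apply: lerD; apply: le_trans D5; rewrite ler_distl.
have fc' z : rectangle (x0 - D) (x0 + D) (y0 - D) (y0 + D) z -> ccontinuous f z.
  by move=> zQ; apply: fc; exact: sub zQ.
have := boundary_integral_bound (ltW h56) (ltW h78)
  (continuous_boundary (ltW h56) (ltW h78) fc') (bounded_boundary (ltW h56) (ltW h78) fM).
move=> /le_trans; apply.
have -> : 2 * M * (x0 + D - (x0 - D) + (y0 + D - (y0 - D))) = D * (8 * M) by ring.
by rewrite -ler_pdivlMr// mulr_gt0.
Qed.

End GoursatTheorem.

(** * The identity principle on a disc *)

Section ComplexTopology.
Context (R : realType).
Local Open Scope complex_scope.
Local Notation C := (CC R).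
Local Notation normc := (@ComplexField.Normc.normc R).

Lemma norm_normc (z : C) : `|z| = (normc z)%:C :> C.
Proof. by rewrite normc_def; case: z. Qed.

Lemma normc_gt0 (z : C) : (0 < normc z) = (z != 0).
Proof.
rewrite lt_neqAle normc_ge0 andbT eq_sym; apply/idP/idP; last first.
  by apply: contra_neq => /ComplexField.Normc.eq0_normc.
by apply: contra_neq => ->; exact: ComplexField.Normc.normc0.
Qed.

Lemma ltcR0 (e : C) : 0 < e -> exists2 r : R, 0 < r & e = r%:C.
Proof.
case: e => x y; rewrite ltcE /= => /andP[/eqP -> x0]; exists x => //.
Qed.

Lemma nbhs_normc (z : C) (P : set C) :
  (\forall w \near z, P w) <-> exists2 r : R, 0 < r & forall w, normc (w - z) <= r -> P w.
Proof.
split.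
  move=> /nbhs_normP[e /ltcR0[r r0 ->]] rP; exists (r / 2); first by rewrite divr_gt0.
  move=> w wr; apply: rP; rewrite /= norm_normc ltcR normcB.
  by apply: le_lt_trans wr _; lra.
move=> [r r0 rP]; apply/nbhs_normP; exists r%:C => /=; first by rewrite ltcR.
by move=> w /=; rewrite norm_normc ltcR normcB => /ltW; exact: rP.
Qed.

Lemma cvg_normcP (T : Type) (F : set_system T) (FF : Filter F) (f : T -> C) (l : C) :
  f x @[x --> F] --> l <-> forall e : R, 0 < e -> \forall x \near F, normc (l - f x) <= e.
Proof.
split=> [/(cvgrPdist_le (FF := FF)) fl e e0|fl].
  have /fl : 0 < e%:C :> C by rewrite ltcR.
  by apply: filterS => x; rewrite norm_normc lecR.
apply/(cvgrPdist_le (FF := FF)) => e /ltcR0[r r0 ->].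
by have := fl r r0; apply: filterS => x; rewrite norm_normc lecR.
Qed.

Lemma derivative_normcP (f : C -> C) (z l : C) :
  (h^-1 *: (f (h *: 1 + z) - f z) @[h --> 0^'] --> l) <->
  forall e : R, 0 < e -> exists2 r : R, 0 < r & forall w, normc (w - z) <= r ->
    normc (f w - f z - l * (w - z)) <= e * normc (w - z).
Proof.
split.
  move=> /(cvg_normcP (dnbhs_filter _)) fl e e0.
  have /nbhs_normc[r r0 rP] := fl _ e0.
  exists r => // w wr; have [->|wz] := eqVneq w z.
    by rewrite !subrr mulr0 subrr ComplexField.Normc.normc0 mulr0.
  have wz0 : w - z != 0 by rewrite subr_eq0.
  have := rP (w - z); rewrite subr0 => /(_ wr wz0).
  rewrite /GRing.scale /= mulr1 subrK => H.
  rewrite -ler_pdivrMr ?normc_gt0//.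
  apply: le_trans H; rewrite -ComplexField.Normc.normcV -ComplexField.Normc.normcM.
  by rewrite normcB mulrBl mulfK// mulrC.
move=> fl; apply/(cvg_normcP (dnbhs_filter _)) => e e0.
have [s s0 sP] := fl e e0; apply/nbhs_normc; exists s => // w; rewrite subr0 => ws w0.
have := sP (w + z); rewrite addrK => /(_ ws).
rewrite /GRing.scale /= mulr1 => H.
have nw0 : 0 < normc w by rewrite normc_gt0.
have -> : l - w^-1 * (f (w + z) - f z) = w^-1 * (l * w - (f (w + z) - f z)).
  by rewrite [RHS]mulrBr mulrCA mulVf// mulr1.
rewrite ComplexField.Normc.normcM ComplexField.Normc.normcV normcB.
by rewrite mulrC ler_pdivrMr.
Qed.

Lemma cdifferentiableP (f : C -> C) z : derivable f z 1 <-> cdifferentiable f z.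
Proof.
split; first by move=> /cvg_ex[/= l /derivative_normcP fl]; exists l.
by move=> [l fl]; apply/cvg_ex; exists l; apply/derivative_normcP.
Qed.

End ComplexTopology.

Section CauchyEstimate.
Context (R : realType).
Local Open Scope complex_scope.
Local Notation C := (CC R).
Local Notation normc := (@ComplexField.Normc.normc R).

Lemma mulcE (a b c d : R) :
  (a +i* b) * (c +i* d) = (a * c - b * d) +i* (a * d + b * c) :> C.
Proof. by []. Qed.

Definition cauchy_kernel (c p z : C) : C := c * (z - p)^-1.

Lemma derivable_cauchy_kernel (c p z : C) : z != p -> derivable (cauchy_kernel c p) z 1.
Proof.
move=> zp; apply: derivableM; first exact: derivable_cst.
apply: derivableV; first by rewrite subr_eq0.
by apply: derivableB; [exact: derivable_id|exact: derivable_cst].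
Qed.

Lemma cauchy_kernel_lower_bound (k : R) : 0 <= k ->
  let G := cauchy_kernel (0 -i* k) 1 in
  boundary_continuous (-2) 2 (-2) 2 G /\ k <= boundary_integral G (-2) 2 (-2) 2.
Proof.
move=> k0; set H := cauchy_kernel _ _.
have HE x y : H (x +i* y) = (k * - y / ((x - 1) ^+ 2 + y ^+ 2))
       +i* (k * (1 - x) / ((x - 1) ^+ 2 + y ^+ 2)).
  have -> : H (x +i* y) = (0 -i* k) * ((x - 1) +i* (y - 0))^-1 by [].
  rewrite subr0.
  have -> : ((x - 1) +i* y : C)^-1 = ((x - 1) / ((x - 1) ^+ 2 + y ^+ 2))
       -i* (y / ((x - 1) ^+ 2 + y ^+ 2)) by [].
  by rewrite [LHS]mulcE; congr (_ +i* _); ring.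
have Hc (z : C) : z != 1 -> ccontinuous H z.
  by move=> z1; apply/cdifferentiable_continuous/cdifferentiableP/derivable_cauchy_kernel.
have bc : boundary_continuous (-2) 2 (-2) 2 H.
  by split=> x _; split; apply: Hc; rewrite eq_complex /= negb_and; apply/orP;
    (try by right; lra); left; lra.
split=> //.
have [hx hy] := bc.
have low (g : R -> R) : {within `[-2, 2], continuous g} ->
    (forall x, -2 <= x <= 2 -> k / 13 <= g x) -> k / 13 * 4 <= segment_integral g (-2) 2.
  move=> gc gk; have -> : (4 : R) = 2 - -2 by ring.
  rewrite -segment_integral_cst; last by lra.
  by apply: le_segment_integral => // x; exact: cvg_cst.
have lowN (g : R -> R) : {within `[-2, 2], continuous g} ->
    (forall x, -2 <= x <= 2 -> g x <= - (k / 13)) -> segment_integral g (-2) 2 <= - (k / 13) * 4.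
  move=> gc gk; have -> : (4 : R) = 2 - -2 by ring.
  rewrite -segment_integral_cst; last by lra.
  by apply: le_segment_integral => // x; exact: cvg_cst.
have num (m N : R) : 0 < N -> N <= 13 -> 1 <= m -> k / 13 <= k * m / N.
  move=> N0 N13 m1; rewrite ler_pdivlMr// mulrAC ler_pdivrMr// -!mulrA ler_wpM2l//.
  by nra.
have i1 : k / 13 * 4 <= horizontal_integral H (-2) 2 (-2).
  apply: low; first by apply: Re_horizontal_continuous => x /hx[].
  by move=> x /andP[? ?]; rewrite HE /= opprK; apply: num; nra.
have i2 : horizontal_integral H (-2) 2 2 <= - (k / 13) * 4.
  apply: lowN; first by apply: Re_horizontal_continuous => x /hx[].
  move=> x /andP[? ?]; rewrite HE /= mulrN mulNr lerN2; apply: num; nra.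
have i3 : k / 13 * 4 <= vertical_integral H (-2) 2 (-2).
  apply: low; first by apply: Im_vertical_continuous => x /hy[].
  by move=> x /andP[? ?]; rewrite HE /=; apply: num; nra.
have i4 : vertical_integral H (-2) 2 2 <= - (k / 13) * 4.
  apply: lowN; first by apply: Im_vertical_continuous => x /hy[].
  move=> x /andP[? ?]; rewrite HE /= -opprB mulrN mulNr lerN2; apply: num; nra.
rewrite /boundary_integral; lra.
Qed.

Definition scaled_quotient (f : C -> C) (u p z : C) : C := u * ((f z - f p) / (z - p)).

Lemma derivable_scaled_quotient (f : C -> C) (u p z : C) : z != p ->
  derivable f z 1 -> derivable (scaled_quotient f u p) z 1.
Proof.
move=> zp fz; apply: derivableM; first exact: derivable_cst.
apply: derivableM; first by apply: derivableB; [exact: fz|exact: derivable_cst].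
apply: derivableV; first by rewrite subr_eq0.
by apply: derivableB; [exact: derivable_id|exact: derivable_cst].
Qed.

Lemma cauchy_estimate (f : C -> C) M :
  (forall z, rectangle (-2) 2 (-2) 2 z -> cdifferentiable f z) ->
  boundary_bounded (-2) 2 (-2) 2 f M -> normc (f 1) <= 16 * M.
Proof.
move=> fd [Mx My].
have fd' (z : C) : rectangle (-2) 2 (-2) 2 z -> derivable f z 1 by move=> /fd/cdifferentiableP.
have in1 : rectangle (-2) 2 (-2) 2 (1 : C) by split; rewrite /=; lra.
have /cvg_ex[/= l fl] := fd' _ in1.
have [u uE] : exists u : C, u = (f 1)^* * (0 -i* 1) by eexists.
pose g (z : C) : C := if z == 1 then u * l else scaled_quotient f u 1 z.
have gd (z : C) : rectangle (-2) 2 (-2) 2 z -> z != 1 -> cdifferentiable g z.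
  move=> zQ z1; apply/cdifferentiableP.
  have := derivable_scaled_quotient (u := u) z1 (fd' _ zQ).
  apply: near_eq_derivable.
  have zn : 0 < normc (z - 1) by rewrite normc_gt0 subr_eq0.
  apply/nbhs_normc; exists (normc (z - 1) / 2); first by rewrite divr_gt0.
  move=> w wz; rewrite /g; case: eqP => // w1; move: wz; rewrite w1 normcB.
  by rewrite ler_pdivlMr// mulr2n mulrDr mulr1 gerDl leNgt zn.
have gc (z : C) : rectangle (-2) 2 (-2) 2 z -> ccontinuous g z.
  move=> zQ; have [->|z1] := eqVneq z 1; last exact: cdifferentiable_continuous (gd z zQ z1).
  move=> e e0; have u0 : 0 < normc u + 1 by rewrite ltr_wpDl// normc_ge0.
  have [|r r0 rP] := (derivative_normcP f 1 l).1 fl (e / (normc u + 1)).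
    by rewrite divr_gt0.
  exists r => // w /rP; rewrite /g eqxx; case: eqP => [-> _|/eqP w1].
    by rewrite subrr ComplexField.Normc.normc0 ltW.
  have n0 : 0 < normc (w - 1) by rewrite normc_gt0 subr_eq0.
  have -> : f w - f 1 - l * (w - 1) = ((f w - f 1) / (w - 1) - l) * (w - 1).
    by rewrite [RHS]mulrBl mulfVK// subr_eq0.
  rewrite -mulrBr !ComplexField.Normc.normcM ler_pM2r// ler_pdivlMr// => /(le_trans _); apply.
  by rewrite mulrC ler_wpM2l ?normc_ge0// lerDl.
have g0 : boundary_integral g (-2) 2 (-2) 2 = 0.
  by apply: (@goursat_except R g 1) => //=; lra.
pose k := normc (f 1) ^+ 2.
have [bG kG] := @cauchy_kernel_lower_bound k (sqr_ge0 _).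
move: kG bG; set G := cauchy_kernel _ _ => kG bG.
have le22 : (-2 : R) <= 2 by lra.
have bg := continuous_boundary le22 le22 gc.
have bF : boundary_continuous (-2) 2 (-2) 2 (g \+ G).
  by split=> t tP; split; apply: ccontinuousD; by [have [] := bg.1 _ tP|have [] := bG.1 _ tP|have [] := bg.2 _ tP|have [] := bG.2 _ tP].
have gGE (z : C) : 1 <= normc (z - 1) -> normc (f z) <= M ->
    normc ((g \+ G) z) <= normc (f 1) * M.
  move=> z1 zM; have zn1 : z != 1.
    by apply: contraTneq z1 => ->; rewrite subrr ComplexField.Normc.normc0 -ltNge.
  have -> : (g \+ G) z = u * f z / (z - 1).
    rewrite /= /g (negPf zn1) /G /cauchy_kernel /scaled_quotient.
    have -> : 0 -i* k = k%:C * (0 -i* 1) :> C.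
      by rewrite mulcE; congr (_ +i* _); ring.
    have -> : k%:C = (f 1)^* * f 1 :> C.
      by rewrite mulrC -sqr_normc norm_normc /k rmorphXn.
    by rewrite uE; ring.
  rewrite uE !ComplexField.Normc.normcM ComplexField.Normc.normcV.
  have -> : normc (0 -i* 1) = 1 :> R by rewrite /= expr0n add0r sqrrN expr1n sqrtr1.
  have -> : normc (f 1)^* = normc (f 1) by case: (f 1) => x y /=; rewrite sqrrN.
  rewrite mulr1 ler_pdivrMr ?(lt_le_trans ltr01)// -mulrA ler_wpM2l ?normc_ge0//.
  by rewrite (le_trans zM)// ler_peMr// (le_trans _ zM)// normc_ge0.
have far x y : 1 <= `|x - 1| \/ 1 <= `|y| -> 1 <= normc (x +i* y - 1 : C).
  have -> : (x +i* y - 1 : C) = (x - 1) +i* y by apply/eqP; rewrite eq_complex /= subr0 !eqxx.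
  case=> /le_trans; apply; first exact: (normc_ge_absRe (Complex _ _)).
  exact: (normc_ge_absIm (Complex _ _)).
have n2 : 1 <= `|2 : R| by rewrite ger0_norm//; lra.
have bM : boundary_bounded (-2) 2 (-2) 2 (g \+ G) (normc (f 1) * M).
  split=> t tP; split; apply: gGE.
  - by apply: far; right; rewrite normrN.
  - by have [] := Mx _ tP.
  - by apply: far; right.
  - by have [] := Mx _ tP.
  - by apply: far; left; rewrite ler0_norm; lra.
  - by have [] := My _ tP.
  - by apply: far; left; rewrite ger0_norm; lra.
  - by have [] := My _ tP.
have := boundary_integral_bound le22 le22 bF bM.
rewrite boundary_integralD// g0 add0r => kM.
have {}kM : k <= normc (f 1) * (16 * M).
  by apply: le_trans kG _; apply: le_trans (ler_norm _) _; apply: le_trans kM _; lra.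
move: kM; rewrite /k expr2; have [->|n0] := eqVneq (normc (f 1)) 0.
  move=> _; have [|] := Mx 0; first by lra.
  by move=> /(le_trans (normc_ge0 _)) M0 _; lra.
by rewrite ler_pM2l// lt_neqAle eq_sym n0 normc_ge0.
Qed.

(* The Cauchy estimate applied to [phi z / z ^ N], for all [N]. *)
Lemma vanish_near_0_vanish_at_1 (phi : C -> C) :
  (forall z, normc z <= 3 -> cdifferentiable phi z) ->
  (\forall z \near (0 : C), phi z = 0) -> phi 1 = 0.
Proof.
move=> phid /nbhs_normc[r r0 rP].
have phi_bd : exists M, boundary_bounded (-2) 2 (-2) 2 phi M.
  have bd (s : R -> C) : (forall x y, normc (s x - s y) <= `|x - y|) ->
      (forall x, -2 <= x <= 2 -> normc (s x) <= 3) ->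
      exists M, forall x, -2 <= x <= 2 -> normc (phi (s x)) <= M.
    move=> s1 s3; have cs (u : C -> R) : (forall z w, `|u z - u w| <= normc (z - w)) ->
        {within `[-2, 2], continuous (fun x => u (phi (s x)))}.
      move=> u1; apply: (@within_of_ccontinuous _ phi u s) => // x /s3/phid.
      exact: cdifferentiable_continuous.
    have cu : {within `[-2, 2], continuous (fun x => normc (phi (s x)))}.
      by apply: cs; exact: normc_lipschitz.
    have [c _ cP] := EVT_max (ltac:(lra) : (-2 : R) <= 2) cu.
    by exists (normc (phi (s c))) => x xP; apply: cP; rewrite in_itv.
  have n3 x y : `|x| <= 2 -> `|y| <= 2 -> normc (x +i* y : C) <= 3.
    move=> x2 y2; rewrite -[leRHS]ger0_norm// -sqrtr_sqr ler_wsqrtr//.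
    have := sqr_ge0 x; have := sqr_ge0 y; move: x2 y2; rewrite !ler_norml; nra.
  have t2 : `|2 : R| <= 2 by rewrite ger0_norm.
  have tN2 : `|-2 : R| <= 2 by rewrite normrN.
  have [M1 P1] := bd (fun x => x +i* -2) (horizontal_isometry _)
     (fun x x2 => n3 _ _ (ltac:(rewrite ler_norml; exact: x2)) tN2).
  have [M2 P2] := bd (fun x => x +i* 2) (horizontal_isometry _)
     (fun x x2 => n3 _ _ (ltac:(rewrite ler_norml; exact: x2)) t2).
  have [M3 P3] := bd (fun x => -2 +i* x) (vertical_isometry _)
     (fun x x2 => n3 _ _ tN2 (ltac:(rewrite ler_norml; exact: x2))).
  have [M4 P4] := bd (fun x => 2 +i* x) (vertical_isometry _)
     (fun x x2 => n3 _ _ t2 (ltac:(rewrite ler_norml; exact: x2))).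
  exists (Num.max (Num.max M1 M2) (Num.max M3 M4)).
  by split=> t tP; split; rewrite !le_max ?P1 ?P2 ?P3 ?P4 ?orbT.
have [M [Mx My]] := phi_bd.
have key N : normc (phi 1) <= 16 * M / 2 ^+ N.
  pose f (z : C) := phi z * z ^- N.
  have -> : phi 1 = f 1 by rewrite /f expr1n invr1 mulr1.
  have fd (z : C) : rectangle (-2) 2 (-2) 2 z -> cdifferentiable f z.
    move=> [/andP[z1 z2] /andP[z3 z4]].
    have z3' : normc z <= 3.
      case: z z1 z2 z3 z4 => x y /= x1 x2 y1 y2.
      by rewrite -[leRHS]ger0_norm// -sqrtr_sqr ler_wsqrtr//; nra.
    have [->|zn0] := eqVneq z 0.
      have f0 w : normc (w - 0) <= r -> f w = 0 by move=> wr; rewrite /f rP// mul0r.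
      exists 0 => e e0; exists r => // w wr.
      rewrite (f0 w wr) f0 ?subrr ?ComplexField.Normc.normc0 ?(ltW r0)//.
      by rewrite mul0r subr0 ComplexField.Normc.normc0; apply: mulr_ge0; [exact: ltW|exact: normc_ge0].
    apply/cdifferentiableP/derivableM; first exact/cdifferentiableP/phid.
    apply: derivableV; first by rewrite expf_neq0.
    exact: exprn_derivable.
  rewrite -mulrA; apply: cauchy_estimate fd _.
  have fM (z : C) : 2 <= normc z -> normc (phi z) <= M -> normc (f z) <= M / 2 ^+ N.
    move=> z2 zM; have nX (w : C) : normc (w ^+ N) = normc w ^+ N.
      elim: N {f} => [|N IH]; first by rewrite !expr0 ComplexField.Normc.normc1.
      by rewrite !exprS ComplexField.Normc.normcM IH.
    rewrite /f ComplexField.Normc.normcM ComplexField.Normc.normcV nX.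
    have M0 : 0 <= M by apply: le_trans zM; exact: normc_ge0.
    apply: ler_pM => //; rewrite ?invr_ge0 ?exprn_ge0 ?normc_ge0//.
    by rewrite lef_pV2 ?posrE ?exprn_gt0// ?(lt_le_trans _ z2)// lerXn2r ?nnegrE ?normc_ge0.
  have t2 : 2 <= `|2 : R| by exact: ler_norm.
  split=> t tP; split; apply: fM; try by [have [] := Mx _ tP|have [] := My _ tP].
  - by apply: le_trans (normc_ge_absIm _); rewrite /= normrN.
  - by apply: le_trans (normc_ge_absIm _).
  - by apply: le_trans (normc_ge_absRe _); rewrite /= normrN.
  - by apply: le_trans (normc_ge_absRe _).
apply: ComplexField.Normc.eq0_normc; apply/le_anti; rewrite normc_ge0 andbT.
apply/ler_addgt0Pr => e e0; rewrite add0r.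
have := @cvg_geometric R (16 * M) (2^-1).
rewrite ger0_norm// => /(_ ltac:(lra)) /cvgrPdist_le /(_ e e0) [N _ /(_ N (leqnn N))] /= H.
apply: le_trans (key N) _; move: H; rewrite sub0r normrN exprVn; apply: le_trans; exact: ler_norm.
Qed.

End CauchyEstimate.

(** * Calculus in the local coordinates *)

Lemma near_eq_differentiable (K : numFieldType) (V W : normedModType K) (f g : V -> W) (a : V) :
  (\forall t \near a, f t = g t) -> differentiable f a -> differentiable g a.
Proof.
move=> fg fa; have ga := nbhs_singleton fg.
pose r := (fun t => g t - f t); suff ra : differentiable r a.
  have -> : g = f + r by apply/funext => t; rewrite /r -[RHS]/(f t + (g t - f t)) addrC subrK.
  exact: differentiableD.
have r_a : r a = 0 by rewrite /r ga subrr.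
have cE : cst (r a) + (\0 : V -> W) = cst 0.
  by apply/funext => t; rewrite -[LHS]/(r a + 0) r_a addr0.
have rE : r \o shift a = cst (r a) + (\0 : V -> W) +o_ 0 id.
  apply/eqaddoP; rewrite cE => _/posnumP[e]; near=> h.
  have h_r : r (h + a) = 0.
    near: h; have : \forall t \near (0 : V) + a, r t = 0.
      by rewrite add0r; apply: filterS fg => t; rewrite /r => ->; rewrite subrr.
    by rewrite (near_shift 0) /= addrC addKr.
  by rewrite -[X in `|X|]/(r (h + a) - 0) h_r subrr normr0 mulr_ge0.
apply/diff_locallyP; rewrite (diff_unique _ rE); last exact: cst_continuous.
by split; [exact: cst_continuous|exact: rE].
Unshelve. all: by end_near. Qed.

Lemma derive_entry (K : numFieldType) (V : normedModType K) a b (f : V -> 'M[K]_(a, b))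
    (t v : V) i j : derivable f t v ->
  'D_v (fun u => f u i j) t = ('D_v f t) i j.
Proof.
move=> ft; apply/cvg_lim; first exact: norm_hausdorff.
have := cvg_comp (fun h => h^-1 *: (f (h *: v + t) - f t)) (fun M : 'M[K]_(a, b) => M i j)
  ft (@coord_continuous K a b i j ('D_v f t)).
apply: cvg_trans; apply: near_eq_cvg; near=> h.
by rewrite /= !mxE.
Unshelve. all: by end_near. Qed.

Section LocalChart.
Context (R : realType) (n : nat) (X : topologicalType) (p : X -> 'rV[CC R]_n).

Definition local_homeomorphism : Prop :=
  continuous p /\ forall x, exists A : set X,
    [/\ open A, A x, {in A &, injective p} &
        forall W, open W -> W `<=` A -> open (p @` W)].

Lemma covering_map_local_homeomorphism (U : set 'rV[CC R]_n) :
  covering_map p U -> local_homeomorphism.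
Proof.
move=> [pc pU cov]; split=> // x.
have [|V [_ Vx _ [I [sheet [so _ pV bij sopen]]]]] := cov (p x).
  by rewrite -pU; exists x.
have : (p @^-1` V) x by [].
rewrite pV => -[i _ ix]; exists (sheet i); split => //.
  by have [_ inj _] := bij i.
exact: sopen.
Qed.

Hypothesis p_lh : local_homeomorphism.

Lemma local_inverseP x : is_local_inverse p x (local_inverse p x).
Proof.
rewrite /local_inverse; apply: xgetPex.
have [A [Ao Ax Ainj Aopen]] := p_lh.2 x.
pose s t := xget x [set y | A y /\ p y = t].
have pAo : open (p @` A) by exact: Aopen.
have sP t : (p @` A) t -> A (s t) /\ p (s t) = t.
  by move=> [y Ay yt]; apply: (@xgetPex _ x [set y | A y /\ p y = t]); exists y.
have sE y : A y -> s (p y) = y.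
  move=> Ay; have [As ps] : A (s (p y)) /\ p (s (p y)) = p y by apply: sP; exists y.
  by apply: Ainj => //; rewrite inE.
exists s; split; first exact: sE.
have : \forall t \near p x, (p @` A) t by apply: open_nbhs_nbhs; split=> //; exists x.
apply: filterS => t tA; split; first by have [] := sP t tA.
have [As ps] := sP t tA.
move=> B /=; rewrite nbhsE => -[W [Wo Ws] WB].
have : \forall u \near t, (p @` (W `&` A)) u.
  apply: open_nbhs_nbhs; split; last by exists (s t).
  by apply: Aopen; [exact: openI|exact: subIsetr].
by apply: filterS => u [y [Wy Ay] <-] /=; apply: WB; rewrite sE.
Qed.

Lemma local_inverse_center x : local_inverse p x (p x) = x.
Proof. by have [] := local_inverseP x. Qed.

Lemma local_inverseK x : \forall t \near p x, p (local_inverse p x t) = t.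
Proof. by have [_] := local_inverseP x; apply: filterS => t []. Qed.

Lemma local_inverse_continuous x : {for p x, continuous (local_inverse p x)}.
Proof. by have [_ /nbhs_singleton[]] := local_inverseP x. Qed.

Lemma near_chart x (P : set X) :
  (\forall y \near x, P y) -> \forall t \near p x, P (local_inverse p x t).
Proof.
by move=> xP; apply: (local_inverse_continuous (x := x)); rewrite local_inverse_center.
Qed.

Lemma near_proj x (P : set 'rV[CC R]_n) :
  (\forall t \near p x, P t) -> \forall y \near x, P (p y).
Proof. exact: p_lh.1. Qed.

Lemma local_inverse_proj x : \forall y \near x, local_inverse p x (p y) = y.
Proof.
have [A [Ao Ax Ainj _]] := p_lh.2 x.
have Anear : \forall y \near x, A y by exact: open_nbhs_nbhs.
have key : \forall t \near p x, A (local_inverse p x t) /\ p (local_inverse p x t) = t.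
  near=> t; split; last by near: t; exact: local_inverseK.
  by near: t; apply: near_chart.
have := near_proj key; apply: filterS2 Anear => y Ay [As ps].
by apply: Ainj => //; rewrite inE.
Unshelve. all: by end_near. Qed.

Lemma near_unchart x (P : set X) :
  (\forall t \near p x, P (local_inverse p x t)) -> \forall y \near x, P y.
Proof.
by move=> /near_proj; apply: filterS2 (local_inverse_proj x) => y ->.
Qed.

Lemma local_inverse_germ x :
  \forall y \near x, \forall u \near p y, local_inverse p x u = local_inverse p y u.
Proof.
have := near_join (local_inverse_proj x); apply: filterS => y /near_chart yP.
near=> u; have {1}<- : p (local_inverse p y u) = u by near: u; exact: local_inverseK.
by near: u.
Unshelve. all: by end_near. Qed.

Section Germs.
Context (W : normedModType (CC R)).
Implicit Types f g : X -> W.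

Definition diff_at f x := differentiable (f \o local_inverse p x) (p x).

Lemma eq_diff_at f g x : (\forall y \near x, f y = g y) -> diff_at f x -> diff_at g x.
Proof. by move=> /near_chart; exact: near_eq_differentiable. Qed.

Lemma eq_pd k f g x : (\forall y \near x, f y = g y) -> pd p k f x = pd p k g x.
Proof. by move=> /near_chart fg; exact: near_eq_derive. Qed.

Lemma diff_at_chart f x : \forall y \near x,
  diff_at f y <-> differentiable (f \o local_inverse p x) (p y).
Proof.
have := local_inverse_germ x; apply: filterS => y xy.
by split; apply: near_eq_differentiable; apply: filterS xy => u /= ->.
Qed.

Lemma pd_chart k f x : \forall y \near x,
  pd p k f y = 'D_(delta_mx 0 k) (f \o local_inverse p x) (p y).
Proof.
have := local_inverse_germ x; apply: filterS => y xy.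
by apply: near_eq_derive; apply: filterS xy => u /= ->.
Qed.

Lemma holomorphic_atP f x : holomorphic_at p f x <-> \forall y \near x, diff_at f y.
Proof.
split=> [/near_proj|]; first by apply: filterS2 (diff_at_chart f x) => y [].
move=> fx; have : \forall y \near x, differentiable (f \o local_inverse p x) (p y).
  by apply: filterS2 (diff_at_chart f x) fx => y [].
by move=> /near_chart; apply: filterS2 (local_inverseK x) => t ->.
Qed.

Lemma holomorphic_diff_at f x : holomorphic_at p f x -> diff_at f x.
Proof. by move=> /holomorphic_atP/nbhs_singleton. Qed.

Lemma diff_at_continuous f x : diff_at f x -> {for x, continuous f}.
Proof.
move=> /differentiable_continuous fc B /=.
rewrite -{1}(local_inverse_center x) => /fc /near_proj.
by apply: filterS2 (local_inverse_proj x) => y /= ->.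
Qed.

Lemma diff_at_cst (c : W) x : diff_at (fun=> c) x.
Proof. exact: differentiable_cst. Qed.

Lemma pd_cst k (c : W) x : pd p k (fun=> c) x = 0.
Proof. exact: derive_cst. Qed.

Lemma diff_atD f g x : diff_at f x -> diff_at g x -> diff_at (fun y => f y + g y) x.
Proof. by move=> fx gx; exact: (differentiableD fx gx). Qed.

Lemma diff_atN f x : diff_at f x -> diff_at (fun y => - f y) x.
Proof. by move=> fx; exact: (differentiableN fx). Qed.

Lemma diff_atB f g x : diff_at f x -> diff_at g x -> diff_at (fun y => f y - g y) x.
Proof. by move=> fx gx; exact: (differentiableB fx gx). Qed.

Lemma diff_at_derivable f x v : diff_at f x ->
  derivable (f \o local_inverse p x) (p x) v.
Proof. by move=> fx; exact: diff_derivable. Qed.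

Lemma pdD k f g x : diff_at f x -> diff_at g x ->
  pd p k (fun y => f y + g y) x = pd p k f x + pd p k g x.
Proof.
by move=> fx gx; rewrite /pd -(deriveD (diff_at_derivable (v := delta_mx 0 k) fx)
  (diff_at_derivable (v := delta_mx 0 k) gx)).
Qed.

Lemma pdN k f x : diff_at f x -> pd p k (fun y => - f y) x = - pd p k f x.
Proof. by move=> fx; rewrite /pd -(deriveN (diff_at_derivable (v := delta_mx 0 k) fx)). Qed.

Lemma pdB k f g x : diff_at f x -> diff_at g x ->
  pd p k (fun y => f y - g y) x = pd p k f x - pd p k g x.
Proof.
by move=> fx gx; rewrite /pd -(deriveB (diff_at_derivable (v := delta_mx 0 k) fx)
  (diff_at_derivable (v := delta_mx 0 k) gx)).
Qed.

Lemma diff_at_sum m (f : 'I_m -> X -> W) x : (forall i, diff_at (f i) x) ->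
  diff_at (fun y => \sum_(i < m) f i y) x.
Proof.
move=> fx; rewrite /diff_at (_ : _ \o _ = \sum_(i < m) (f i \o local_inverse p x)).
  exact: differentiable_sum.
by apply/funext => t; rewrite fct_sumE.
Qed.

Lemma pd_sum k m (f : 'I_m -> X -> W) x : (forall i, diff_at (f i) x) ->
  pd p k (fun y => \sum_(i < m) f i y) x = \sum_(i < m) pd p k (f i) x.
Proof.
move=> fx; rewrite /pd (_ : _ \o _ = \sum_(i < m) (f i \o local_inverse p x)).
  by rewrite derive_sum// => i; exact: diff_at_derivable.
by apply/funext => t; rewrite fct_sumE.
Qed.

End Germs.

Section ScalarGerms.
Local Notation C := (CC R).
Implicit Types f g : X -> C.

Lemma diff_atM f g x : diff_at f x -> diff_at g x -> diff_at (fun y => f y * g y) x.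
Proof. by move=> fx gx; exact: (differentiableM fx gx). Qed.

Lemma pdM k f g x : diff_at f x -> diff_at g x ->
  pd p k (fun y => f y * g y) x = pd p k f x * g x + f x * pd p k g x.
Proof.
move=> fx gx.
have := deriveM (diff_at_derivable (v := delta_mx 0 k) fx) (diff_at_derivable (v := delta_mx 0 k) gx).
rewrite /pd => ->; rewrite /= local_inverse_center /GRing.scale /=.
by rewrite addrC [g x * _]mulrC.
Qed.

Lemma diff_atV f x : f x != 0 -> diff_at f x -> diff_at (fun y => (f y)^-1) x.
Proof.
move=> f0 fx; apply: (differentiableV fx).
by rewrite /= local_inverse_center.
Qed.

Lemma diff_at_coord i x : diff_at (fun y => p y 0 i) x.
Proof.
have : differentiable (fun t : 'rV[C]_n => t 0 i) (p x) by exact: differentiable_coord.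
apply: near_eq_differentiable.
by have := local_inverseK x; apply: filterS => t /= ->.
Qed.

Lemma pd_coord k i x : pd p k (fun y => p y 0 i) x = (k == i)%:R.
Proof.
have -> : pd p k (fun y => p y 0 i) x = 'D_(delta_mx 0 k) (fun t : 'rV[C]_n => t 0 i) (p x).
  by apply: near_eq_derive; have := local_inverseK x; apply: filterS => t /= ->.
have := @derive_entry C _ 1 n id (p x) (delta_mx 0 k) 0 i.
by rewrite derive_id mxE eqxx eq_sym => ->; last exact: derivable_id.
Qed.

End ScalarGerms.

Section MatrixGerms.
Local Notation C := (CC R).
Context (a b : nat).
Implicit Types f g : X -> 'M[C]_(a, b).

Lemma diff_at_entry f x i j : diff_at f x -> diff_at (fun y => f y i j) x.
Proof.
move=> fx; apply: (@differentiable_comp _ _ _ _ (f \o local_inverse p x)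
  (fun M : 'M[C]_(a, b) => M i j)) => //.
exact: differentiable_coord.
Qed.

Lemma diff_at_mx f x : (forall i j, diff_at (fun y => f y i j) x) -> diff_at f x.
Proof.
move=> fx.
have -> : f = (fun y => \sum_(i < a) \sum_(j < b) f y i j *: delta_mx i j).
  by apply/funext => y; exact: matrix_sum_delta.
apply: diff_at_sum => i; apply: diff_at_sum => j.
exact: (differentiableZl _ (fx i j)).
Qed.

Lemma pd_entry k f x i j : diff_at f x ->
  pd p k f x i j = pd p k (fun y => f y i j) x.
Proof.
by move=> fx; rewrite /pd -derive_entry//; exact: diff_derivable.
Qed.

End MatrixGerms.

End LocalChart.

(** * Connectedness of the complement of a hypersurface *)

Section IdentityPrinciple.
Context (R : realType).
Local Open Scope complex_scope.
Local Notation C := (CC R).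
Local Notation normc := (@ComplexField.Normc.normc R).

(* If [A] separated two points of the complement of the zeros of [psi], then
   [psi ^ 2] on [A], extended by zero, would be differentiable and vanish near 0
   but not at 1. *)
Lemma zeros_do_not_disconnect (psi : C -> C) (A : set C) :
  (forall z : C, normc z <= 3 -> cdifferentiable psi z) ->
  (forall z : C, normc z <= 3 -> psi z != 0 -> A z -> \forall w \near z, A w) ->
  (forall z : C, normc z <= 3 -> psi z != 0 -> ~ A z -> \forall w \near z, ~ A w) ->
  psi 0 != 0 -> ~ A 0 -> psi 1 != 0 -> ~ A 1.
Proof.
move=> psid Aopen nAopen psi0 nA0 psi1 A1.
pose phi (z : C) : C := if `[< A z >] then psi z * psi z else 0.
have phi_cdiff (z : C) : normc z <= 3 -> cdifferentiable phi z.
  move=> z3; have [pz0|pz0] := eqVneq (psi z) 0.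
    have [l lP] := psid z z3; exists 0 => e e0.
    have [r r0 rP] := lP 1 ltr01.
    have k0 : 0 < normc l + 1 by rewrite ltr_wpDl// normc_ge0.
    exists (Num.min r (e / (normc l + 1) ^+ 2)) => [|w].
      by rewrite lt_min r0 divr_gt0// exprn_gt0.
    rewrite le_min => /andP[/rP wr we].
    have -> : phi z = 0 by rewrite /phi pz0 mul0r if_same.
    rewrite mul0r !subr0.
    have psiw : normc (psi w) <= (normc l + 1) * normc (w - z).
      rewrite -[psi w](subrK (l * (w - z))) (le_trans (le_normcD _ _))//.
      rewrite mulrDl addrC ComplexField.Normc.normcM lerD2l.
      by move: wr; rewrite pz0 subr0.
    apply: (@le_trans _ _ (normc (psi w) * normc (psi w))).
      rewrite /phi; case: ifP => _; first by rewrite ComplexField.Normc.normcM.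
      by rewrite ComplexField.Normc.normc0 mulr_ge0 ?normc_ge0.
    apply: (@le_trans _ _ (((normc l + 1) * normc (w - z)) * ((normc l + 1) * normc (w - z)))).
      by rewrite ler_pM ?normc_ge0.
    rewrite mulrACA mulrA ler_wpM2r ?normc_ge0//.
    by move: we; rewrite ler_pdivlMr ?exprn_gt0// mulrC.
  apply/cdifferentiableP.
  have [Az|Az] := pselect (A z).
    have psiz : derivable psi z 1 by apply/cdifferentiableP/psid.
    apply: near_eq_derivable (derivableM psiz psiz).
    apply: filterS (Aopen z z3 pz0 Az) => w Aw; rewrite /phi asboolT//.
  apply: near_eq_derivable (derivable_cst 0 z 1).
  by apply: filterS (nAopen z z3 pz0 Az) => w Aw; rewrite /phi asboolF.
suff : phi 1 = 0 by rewrite /phi asboolT// => /eqP; rewrite mulf_eq0 (negPf psi1).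
apply: vanish_near_0_vanish_at_1 => //.
have n03 : normc 0 <= 3 by rewrite ComplexField.Normc.normc0.
by apply: filterS (nAopen 0 n03 psi0 nA0) => w Aw; rewrite /phi asboolF.
Qed.

End IdentityPrinciple.

Section HypersurfaceComplement.
Context (R : realType) (n : nat) (X : topologicalType) (p : X -> 'rV[CC R]_n).
Hypothesis p_lh : local_homeomorphism p.
Local Open Scope complex_scope.
Local Notation C := (CC R).
Local Notation normc := (@ComplexField.Normc.normc R).
Context (Theta A : set X).
Hypothesis Theta_hyp : hypersurface p Theta.
Hypothesis A_open : open A.
Hypothesis A_co_open : open [set x | ~ Theta x /\ ~ A x].

Lemma hypersurface_locally_connected (x : X) :
  (\forall y \near x, ~ Theta y -> A y) \/ (\forall y \near x, ~ Theta y -> ~ A y).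
Proof.
have [h [hx Theta_h _]] := Theta_hyp.2 x.
pose s := local_inverse p x.
apply: contrapT => /not_orP[notA notN].
have good : \forall t \near p x, [/\ differentiable (h \o s) t,
    Theta (s t) <-> h (s t) = 0 & {for t, continuous s}].
  have s_cont : \forall t \near p x, {for t, continuous s}.
    by have [_] := local_inverseP p_lh x; apply: filterS => t [].
  have hT := near_chart p_lh Theta_h.
  near=> t; split; [near: t; exact: hx|by near: t|by near: t].
have /nbhs_normP[e /= e0 eP] := good.
have e8 : 0 < e / 8 by rewrite divr_gt0.
have exist_pt (P : set X) : ~ (\forall y \near x, P y) ->
    exists2 t, `|p x - t| < e / 8 & ~ P (s t).
  move=> nP; apply: contrapT => H; apply: nP; apply: (near_unchart p_lh).
  apply/nbhs_normP; exists (e / 8) => // t /= te; apply: contrapT => nPt.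
  by apply: H; exists t.
have [t2 t2e /not_implyP[T2 nA2]] := exist_pt _ notA.
have [t1 t1e /not_implyP[T1 /contrapT A1]] := exist_pt _ notN.
pose q (z : C) : 'rV[C]_n := t2 + z *: (t1 - t2).
have q_in (z : C) : normc z <= 3 -> `|p x - q z| < e.
  move=> z3; have z3' : `|z| <= 3 :> C by rewrite norm_normc -(rmorph_nat (real_complex R)) lecR.
  have -> : p x - q z = (p x - t2) + z *: ((p x - t1) - (p x - t2)).
    by rewrite /q opprD addrA; congr (_ + _); rewrite -scalerN; congr (_ *: _); rewrite !opprB [RHS]addrC addrA subrK.
  apply: (@le_lt_trans _ _ (`|p x - t2| + 3 * (`|p x - t1| + `|p x - t2|))).
    rewrite (le_trans (ler_normD _ _))// lerD2l normrZ.
    by apply: ler_pM => //; exact: ler_normB.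
  apply: (@lt_le_trans _ _ (e / 8 + 3 * (e / 8 + e / 8))).
    by rewrite ltrD// ltr_pM2l// ltrD.
  have -> : e / 8 + 3 * (e / 8 + e / 8) = e * (7 / 8) by field.
  by rewrite ler_piMr ?(ltW e0)// ler_pdivrMr// mul1r ler_nat.
have q_diff (z : C) : differentiable q z.
  by apply: differentiableD; [exact: differentiable_cst|exact: differentiableZl].
pose psi : C -> C := (h \o s) \o q.
have psi0 (z : C) : normc z <= 3 -> psi z != 0 <-> ~ Theta (s (q z)).
  move=> /q_in/eP[_ -> _]; rewrite -/(psi z); split; first by move/eqP.
  by move=> ?; apply/eqP.
have q_cont (z : C) (B : set X) : normc z <= 3 -> open B -> B (s (q z)) ->
    \forall w \near z, B (s (q w)).
  move=> /q_in/eP[_ _ sc] Bo Bz.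
  have qc : {for z, continuous q} by apply: differentiable_continuous; exact: q_diff.
  have nB : \forall t \near q z, B (s t) by apply: sc; exact: open_nbhs_nbhs.
  exact: (qc _ nB).
have q0 : q 0 = t2 by rewrite /q scale0r addr0.
have q1 : q 1 = t1 by rewrite /q scale1r addrC subrK.
have n0 : normc 0 <= 3 by rewrite ComplexField.Normc.normc0.
have n1 : normc 1 <= 3 by rewrite ComplexField.Normc.normc1 ler1n.
apply: (@zeros_do_not_disconnect R psi [set z | A (s (q z))]).
- move=> z /q_in/eP[hsd _ _]; apply/cdifferentiableP/diff_derivable.
  exact: differentiable_comp.
- by move=> z z3 _ Az; exact: (q_cont z A).
- move=> z z3 /(psi0 z z3) Tz nAz.
  by have := q_cont z _ z3 A_co_open (conj Tz nAz); apply: filterS => w [].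
- by apply/psi0 => //; rewrite q0.
- by rewrite /= q0.
- by apply/psi0 => //; rewrite q1.
- by rewrite /= q1.
Unshelve. all: by end_near. Qed.

Lemma hypersurface_complement_connected a b : path_connected R X ->
  A a -> ~ Theta b -> A b.
Proof.
move=> [_ pathX] Aa Tb.
pose Z1 := [set x : X | \forall y \near x, ~ Theta y -> A y].
pose Z2 := [set x : X | \forall y \near x, ~ Theta y -> ~ A y].
have open_near (P : set X) : open [set x | \forall y \near x, P y].
  by rewrite openE => x; exact: near_join.
have Z12 x : Z2 x <-> ~ Z1 x.
  split; last by move=> nZ1; have [] := hypersurface_locally_connected x.
  move=> z2 z1; have [h [_ Th nh]] := Theta_hyp.2 x; apply: nh.
  near=> y; apply/(near Th y) => //; apply: contrapT => nT.
  by apply: (near z2 y _ nT) => //; apply: (near z1 y _ nT).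
have [gamma [gc g0 g1]] := pathX a b.
have conn : connected (gamma @` `[0, 1]).
  by apply: connected_continuous_connected gc; exact: segment_connected.
have : gamma @` `[0, 1] `&` Z1 = gamma @` `[0, 1].
  apply: conn.
  - exists a; split; first by exists 0 => //; rewrite /= in_itv /= lexx ler01.
    by have : \forall y \near a, A y by [exact: open_nbhs_nbhs]; apply: filterS.
  - by exists Z1 => //; exact: open_near.
  - exists Z1 => //; rewrite -[Z1]setCK; apply: open_closedC.
    rewrite (_ : ~` Z1 = Z2); first exact: open_near.
    by apply/seteqP; split => x /Z12.
move=> H; have [_ Zb] : (gamma @` `[0, 1] `&` Z1) b.
  by rewrite H; exists 1 => //; rewrite /= in_itv /= lexx ler01.
exact: (nbhs_singleton Zb).
Unshelve. all: by end_near. Qed.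

End HypersurfaceComplement.

(** * Vanishing of solutions of differential systems *)

Section MeanValue.
Context (R : realType).
Local Open Scope complex_scope.
Local Notation C := (CC R).
Local Notation normc := (@ComplexField.Normc.normc R).

Definition has_derivative (F : C -> C) (z l : C) :=
  h^-1 *: (F (h *: 1 + z) - F z) @[h --> 0^'] --> l.

Lemma is_derive_real_part (F : C -> C) (r : R) (l : C) (u : C -> R) :
  {morph u : z w / z - w} -> (forall (t : R) z, u (t%:C * z) = t * u z) ->
  (forall z, `|u z| <= normc z) ->
  has_derivative F r%:C l ->
  is_derive r 1 (fun t : R => u (F t%:C)) (u l).
Proof.
move=> uB uZ u1 /derivative_normcP Fl.
have lim : (h^-1 *: (u (F (h *: 1 + r)%:C) - u (F r%:C)) @[h --> 0^'] --> u l).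
  apply/cvgrPdist_le => e e0; have [s s0 sP] := Fl e e0.
  near=> h; have h0 : h != 0 by near: h; exact: nbhs_dnbhs_neq.
  have hs : `|h| <= s by near: h; exact: dnbhs0_le.
  have := sP (h *: 1 + r)%:C.
  have -> : (h *: 1 + r)%:C - r%:C = h%:C by rewrite /GRing.scale /= mulr1 -rmorphB addrK.
  rewrite normcR => /(_ hs) H.
  have hp : 0 < `|h| by rewrite normr_gt0.
  rewrite /= distrC -(ler_pM2r hp) -normrM mulrBl.
  have -> : h^-1 *: (u (F (h *: 1 + r)%:C) - u (F r%:C)) * h - u l * h =
      u (F (h *: 1 + r)%:C - F r%:C - l * h%:C).
    by rewrite !uB [l * _]mulrC uZ [h * _]mulrC /GRing.scale /= [h^-1 * _]mulrC mulfVK.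
  exact: le_trans (u1 _) H.
split; first by apply/cvg_ex; exists (u l).
by apply/cvg_lim => //; exact: norm_hausdorff.
Unshelve. all: by end_near. Qed.

Lemma mean_value_inequality (F : C -> C) (dF : R -> C) (r M : R) : 0 < r ->
  (forall t, 0 <= t <= r -> has_derivative F t%:C (dF t)) ->
  (forall t, 0 < t < r -> normc (dF t) <= M) ->
  normc (F r%:C - F 0) <= 2 * M * r.
Proof.
move=> r0 FdF dFM.
have part (u : C -> R) : {morph u : z w / z - w} -> (forall (t : R) z, u (t%:C * z) = t * u z) ->
    (forall z, `|u z| <= normc z) -> `|u (F r%:C - F 0)| <= M * r.
  move=> uB uZ u1; have du t : 0 <= t <= r -> is_derive t 1 (fun t : R => u (F t%:C)) (u (dF t)).
    by move=> tr; exact: (@is_derive_real_part F t (dF t) u uB uZ u1 (FdF t tr)).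
  have uc : {within `[0, r], continuous (fun t : R => u (F t%:C))}.
    apply: continuous_in_subspaceT => t; rewrite inE/= in_itv/= => /du[dut _].
    by apply: differentiable_continuous; apply/derivable1_diffP.
  have du' t : t \in `]0, r[ -> is_derive t 1 (fun t : R => u (F t%:C)) (u (dF t)).
    by rewrite in_itv/= => /andP[t0 tr]; apply: du; rewrite !ltW.
  have [t] := MVT r0 du' uc.
  rewrite in_itv/= => tr; rewrite subr0 uB => ->.
  rewrite normrM (ger0_norm (ltW r0)) ler_wpM2r ?(ltW r0)//.
  exact: le_trans (u1 _) (dFM t tr).
rewrite (le_trans (normc_le_ReIm _))//.
have -> : 2 * M * r = M * r + M * r by ring.
apply: lerD; apply: part.
- by case=> ? ? [].
- by move=> t [a b] /=; rewrite mul0r subr0.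
- exact: normc_ge_absRe.
- by case=> ? ? [].
- by move=> t [a b] /=; rewrite mul0r addr0.
- exact: normc_ge_absIm.
Qed.

Lemma contraction_vanish (I : Type) (P : I -> Prop) (S : I -> C) (M : R) :
  (forall i, P i -> normc (S i) <= M) ->
  (forall N, 0 <= N -> (forall i, P i -> normc (S i) <= N) ->
     forall i, P i -> normc (S i) <= N / 2) ->
  forall i, P i -> S i = 0.
Proof.
move=> SM half i Pi; have M0 : 0 <= M := le_trans (normc_ge0 _) (SM i Pi).
have key k : forall i, P i -> normc (S i) <= M / 2 ^+ k.
  elim: k => [|k IH]; first by rewrite expr0 divr1.
  by rewrite exprSr invfM mulrA; apply: half => //; rewrite divr_ge0// exprn_ge0.
apply: ComplexField.Normc.eq0_normc; apply/le_anti; rewrite normc_ge0 andbT.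
apply/ler_addgt0Pr => e e0; rewrite add0r.
have := @cvg_geometric R M (2^-1).
rewrite ger0_norm// => /(_ ltac:(lra)) /cvgrPdist_le /(_ e e0) [k _ /(_ k (leqnn k))] /= H.
apply: le_trans (key k i Pi) _; move: H; rewrite sub0r normrN exprVn; apply: le_trans.
exact: ler_norm.
Qed.

End MeanValue.

Section DifferentialSystems.
Context (R : realType) (n : nat).
Local Open Scope complex_scope.
Local Notation C := (CC R).
Local Notation V := 'rV[CC R]_n.
Local Notation normc := (@ComplexField.Normc.normc R).
Implicit Types (t u v : V).

Lemma nbhs_box t (P : set V) :
  (\forall u \near t, P u) <->
  exists2 r : R, 0 < r & forall u, (forall k, normc (u 0 k - t 0 k) <= r) -> P u.
Proof.
split.
  move=> /nbhs_ballP[e /= /ltcR0[r r0 ->] eP]; exists (r / 2); first by rewrite divr_gt0.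
  move=> u ur; apply: eP; rewrite /ball /=; split=> [|i j]; first by rewrite ltcR.
  rewrite ord1.
  rewrite /ball /= norm_normc ltcR normcB (le_lt_trans (ur j))//.
  by rewrite ltr_pdivrMr// mulr_natr mulr2n ltrDl.
move=> [r r0 rP]; apply/nbhs_ballP; exists r%:C => /=; first by rewrite ltcR.
move=> u [_ tu]; apply: rP => k; have := tu 0 k.
by rewrite /ball /= norm_normc ltcR normcB => /ltW.
Qed.

Definition line t v (z : C) : V := t + z *: v.

Lemma lineE t v z k : line t v z 0 k = t 0 k + z * v 0 k.
Proof. by rewrite !mxE. Qed.

Lemma line_has_derivative (f : V -> C) t v z : differentiable f (line t v z) ->
  has_derivative (f \o line t v) z ('D_v f (line t v z)).
Proof.
move=> fd; have := diff_derivable (v := v) fd.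
rewrite /derivable /has_derivative => /cvg_ex[/= l fl].
have -> : 'D_v f (line t v z) = l by apply/cvg_lim => //; exact: norm_hausdorff.
move: fl; apply: cvg_trans; apply: near_eq_cvg; near=> h => /=.
congr (_ *: (f _ - _)); rewrite /line; set w := (X in (X + z) *: v).
have -> : w = h by exact: mulr1.
by rewrite scalerDl addrCA.
Unshelve. all: by end_near. Qed.

Lemma derive_coordinates (f : V -> C) t v : differentiable f t ->
  'D_v f t = \sum_k v 0 k * 'D_(delta_mx 0 k) f t.
Proof.
move=> fd; rewrite deriveE// {1}(row_sum_delta v) linear_sum; apply: eq_bigr => k _.
by rewrite linearZ /= deriveE.
Qed.

Lemma normc_sum (I : Type) (s : seq I) (P : pred I) (f : I -> C) :
  normc (\sum_(i <- s | P i) f i) <= \sum_(i <- s | P i) normc (f i).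
Proof.
elim/big_rec2: _ => [|i y z _ H]; first by rewrite ComplexField.Normc.normc0.
by rewrite (le_trans (le_normcD _ _))// lerD2l.
Qed.

Lemma normc_sum_le m (f : 'I_m -> C) (M : R) : (forall i, normc (f i) <= M) ->
  normc (\sum_(i < m) f i) <= m%:R * M.
Proof.
move=> fM; rewrite (le_trans (normc_sum _ _ _))//.
by rewrite (le_trans (ler_sum _ (fun i _ => fM i)))// sumr_const card_ord mulr_natl.
Qed.

Lemma near_normc_bound (f : V -> C) t : {for t, continuous f} ->
  \forall u \near t, normc (f u) <= normc (f t) + 1.
Proof.
move=> /(cvg_normcP (nbhs_filter t)) /(_ 1 ltr01); apply: filterS => u fu.
rewrite -{1}(subrK (f t) (f u)) addrC (le_trans (le_normcD _ _))// lerD2l.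
by rewrite normcB.
Qed.

Lemma linear_system_vanish m (psi : 'I_m -> V -> C) (K : R) t :
  (forall i, psi i t = 0) ->
  (\forall u \near t, forall i, differentiable (psi i) u /\
     forall k, normc ('D_(delta_mx 0 k) (psi i) u) <= K * \sum_j normc (psi j u)) ->
  \forall u \near t, forall i, psi i u = 0.
Proof.
move=> psi0 near_psi.
have : \forall u \near t, forall i, normc (psi i u) <= 1.
  apply: (@filter_forall V 'I_m (fun i u => normc (psi i u) <= 1) _ (nbhs_filter t)) => i.
  have [dt _] := nbhs_singleton near_psi i.
  by have := near_normc_bound (differentiable_continuous dt); rewrite psi0 ComplexField.Normc.normc0 add0r.
move=> /(filterI near_psi)/nbhs_box[r r0 rP].
pose K' := `|K| + 1; have K'0 : 0 < K' by rewrite ltr_wpDl.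
pose N : R := n%:R * m%:R * K' * 4 + 1.
have N0 : 0 < N by rewrite ltr_wpDl// !mulr_ge0// ltW.
apply/nbhs_box; exists (Num.min r N^-1); first by rewrite lt_min r0 invr_gt0.
move=> u ur i; pose v := u - t.
have vr k : normc (v 0 k) <= r by rewrite !mxE (le_trans (ur k))// ge_min lexx.
have vN k : normc (v 0 k) <= N^-1 by rewrite !mxE (le_trans (ur k))// ge_min lexx orbT.
have in_box (z : R) : 0 <= z <= 1 -> forall k, normc (line t v z%:C 0 k - t 0 k) <= r.
  move=> /andP[z0 z1] k; rewrite lineE addrC addKr ComplexField.Normc.normcM normcR ger0_norm//.
  by rewrite -[leRHS]mul1r; apply: ler_pM => //; exact: normc_ge0.
suff : psi i (line t v 1%:C) = 0 by rewrite /line scale1r addrC subrK.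
pose S (q : 'I_m * R) := psi q.1 (line t v q.2%:C).
apply: (@contraction_vanish R _ (fun q : 'I_m * R => 0 <= q.2 <= 1) S 1 _ _ (i, 1)).
- by move=> [j z] /in_box/rP[_ H]; exact: H.
- move=> M M0 SM [j z] /= /andP[z0 z1].
  have [->|zn0] := eqVneq z 0.
    by rewrite /S /line scale0r addr0 psi0 ComplexField.Normc.normc0 divr_ge0.
  have zp : 0 < z by rewrite lt_neqAle eq_sym zn0.
  have -> : S (j, z) = (psi j \o line t v) z%:C - (psi j \o line t v) 0.
    by rewrite /S /= /line scale0r addr0 psi0 subr0.
  have dF (y : R) : 0 <= y <= z -> has_derivative (psi j \o line t v) y%:C
      ('D_v (psi j) (line t v y%:C)).
    move=> /andP[y0 yz]; apply: line_has_derivative.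
    have y01 : 0 <= y <= 1 by rewrite y0 (le_trans yz).
    by have [/(_ j)[]] := rP _ (in_box y y01).
  have bound (y : R) : 0 < y < z -> normc ('D_v (psi j) (line t v y%:C)) <= M / 4.
    move=> /andP[y0 yz]; have y01 : 0 <= y <= 1 by rewrite ltW//= ltW// (lt_le_trans yz).
    have [/(_ j)[dy Dy] _] := rP _ (in_box y y01).
    rewrite derive_coordinates//.
    apply: (@le_trans _ _ (n%:R * (N^-1 * (K' * (m%:R * M))))).
      apply: normc_sum_le => k; rewrite ComplexField.Normc.normcM.
      apply: ler_pM; rewrite ?normc_ge0//.
      apply: le_trans (Dy k) _; apply: (@le_trans _ _ (K' * \sum_j normc (psi j (line t v y%:C)))).
        apply: ler_wpM2r; first by apply: sumr_ge0 => ? _; exact: normc_ge0.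
        by rewrite (le_trans (ler_norm K))// lerDl.
      rewrite ler_wpM2l ?(ltW K'0)//.
      rewrite (le_trans (ler_sum _ (fun j _ => SM (j, y) y01)))//.
      by rewrite sumr_const card_ord mulr_natl.
    have -> : n%:R * (N^-1 * (K' * (m%:R * M))) = M * (n%:R * m%:R * K') / N by ring.
    by rewrite ler_pdivrMr// -[leRHS]mulrA ler_wpM2l// /N; lra.
  apply: le_trans (mean_value_inequality zp dF bound) _.
  rewrite -[leRHS]mulr1; apply: ler_pM => //; [by rewrite mulr_ge0// divr_ge0|lra].
- by rewrite /= ler01 lexx.
Qed.

End DifferentialSystems.

(** * Symmetry of solutions with symmetric initial value *)

Section SymmetricSolutions.
Context (R : realType) (n : nat).
Local Open Scope complex_scope.
Local Notation C := (CC R).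
Local Notation V := 'rV[CC R]_n.
Local Notation normc := (@ComplexField.Normc.normc R).
Implicit Types (t u v w : V).

Lemma sum_mul_delta v (i : 'I_n) : \sum_k v 0 k * (k == i)%:R = v 0 i.
Proof.
rewrite (bigD1 i)//= eqxx mulr1 big1 ?addr0// => k /negPf ->.
by rewrite mulr0.
Qed.

Context (F : 'I_n -> 'I_n -> V -> C).

Definition bracket_coef (v t : V) (i m j : 'I_n) : C :=
  (v 0 i - v 0 m) * (t 0 m - t 0 j) - (t 0 i - t 0 m) * (v 0 m - v 0 j).

(* [u |-> [Lambda u, F u]] *)
Definition bracket i j u : C := (u 0 i - u 0 j) * F i j u.

Definition bracket_system (u : V) := forall i j, differentiable (F i j) u /\
  forall k, 'D_(delta_mx 0 k) (bracket i j) u =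
    \sum_m bracket_coef (delta_mx 0 k) u i m j * (F i m u * F m j u).

Lemma differentiable_bracket i j u : bracket_system u -> differentiable (bracket i j) u.
Proof.
move=> /(_ i j)[Fd _]; apply: differentiableM; last exact: Fd.
by apply: differentiableB; exact: differentiable_coord.
Qed.

Lemma derive_bracket i j u v : bracket_system u ->
  'D_v (bracket i j) u = \sum_m bracket_coef v u i m j * (F i m u * F m j u).
Proof.
move=> gu; rewrite derive_coordinates; last exact: differentiable_bracket.
under eq_bigr => k _ do rewrite (gu i j).2 mulr_sumr.
rewrite exchange_big /=; apply: eq_bigr => m _.
under eq_bigr => k _ do rewrite mulrA.
rewrite -mulr_suml; congr (_ * _).
rewrite (eq_bigr (fun k => (v 0 k * (k == i)%:R) * (u 0 m - u 0 j)
   - (v 0 k * (k == m)%:R) * (u 0 m - u 0 j)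
   - ((v 0 k * (k == m)%:R) * (u 0 i - u 0 m) - (v 0 k * (k == j)%:R) * (u 0 i - u 0 m)))).
  by rewrite !sumrB -!mulr_suml !sum_mul_delta /bracket_coef; ring.
by move=> k _; rewrite /bracket_coef !mxE !eqxx /= ![_ == k]eq_sym; ring.
Qed.

Definition skew_entry i j u : C := F i j u - F j i u.

Lemma derive_bracket_sym i j u v : bracket_system u ->
  'D_v (bracket i j + bracket j i) u =
  \sum_m bracket_coef v u i m j * (skew_entry i m u * F m j u + F m i u * skew_entry m j u).
Proof.
move=> gu; rewrite deriveD; [|exact/diff_derivable/differentiable_bracket..].
rewrite !derive_bracket// -big_split /=; apply: eq_bigr => m _.
by rewrite /bracket_coef /skew_entry; ring.
Qed.

Lemma coef_line v t z i m j : bracket_coef v (line t v z) i m j = bracket_coef v t i m j.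
Proof. by rewrite /bracket_coef !lineE; ring. Qed.

(* Along a ray from [t] the coefficients are constant; when [t_i = t_j] they are
   divisible by [v_i - v_j], which compensates the factor [t_i - t_j] of
   [skew_entry i j]. *)
Lemma symmetric_near t :
  (forall i j, t 0 i != t 0 j -> F i j t = F j i t) ->
  (\forall u \near t, bracket_system u) ->
  \forall u \near t, ~ diagonals u -> forall i j, F i j u = F j i u.
Proof.
move=> Ft near_good.
pose T : R := \sum_i \sum_j normc (t 0 i - t 0 j).
pose L : R := \sum_i \sum_j (normc (t 0 i - t 0 j))^-1.
pose K : R := \sum_i \sum_j (normc (F i j t) + 1).
have le_double (f : 'I_n -> 'I_n -> R) i j : (forall i j, 0 <= f i j) ->
    f i j <= \sum_i \sum_j f i j.
  move=> f0; rewrite (bigD1 i)//= (bigD1 j)//= -addrA lerDl addr_ge0 ?sumr_ge0// => a _.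
  by rewrite sumr_ge0.
have tauT i j : normc (t 0 i - t 0 j) <= T.
  by apply: (le_double (fun i j => normc (t 0 i - t 0 j))) => *; exact: normc_ge0.
have tauL i j : (normc (t 0 i - t 0 j))^-1 <= L.
  by apply: (le_double (fun i j => (normc (t 0 i - t 0 j))^-1)) => *;
    rewrite invr_ge0 normc_ge0.
have FK i j : normc (F i j t) + 1 <= K.
  by apply: (le_double (fun i j => normc (F i j t) + 1)) => *; rewrite addr_ge0 ?normc_ge0.
have T0 : 0 <= T by do 2![apply: sumr_ge0 => ? _]; exact: normc_ge0.
have L0 : 0 <= L by do 2![apply: sumr_ge0 => ? _]; rewrite invr_ge0 normc_ge0.
have K0 : 0 <= K by do 2![apply: sumr_ge0 => ? _]; rewrite addr_ge0// normc_ge0.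
pose G : R := n%:R * T * K.
have G0 : 0 <= G by rewrite !mulr_ge0.
pose d : R := (8 * G + 2)^-1.
have d0 : 0 < d by rewrite invr_gt0; lra.
have d2 : d <= 1 / 2.
  by rewrite /d -[X in _ <= X]invrK lef_pV2 ?posrE; lra.
have Gd : 4 * G * d <= 1 / 2 by rewrite /d ler_pdivrMr; lra.
pose e : R := d / (32 * G * L + 4 * L + 1).
have den0 : 0 < 32 * G * L + 4 * L + 1.
  by rewrite ltr_wpDl// addr_ge0// !mulr_ge0.
have e0 : 0 < e by rewrite divr_gt0.
have eGL : 32 * G * L * e <= d.
  rewrite mulrC /e mulrAC ler_pdivrMr// ler_wpM2l// ?(ltW d0)//; lra.
have e4L : 4 * L * e <= 1.
  rewrite mulrC /e mulrAC ler_pdivrMr// mul1r.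
  have : d * (4 * L) <= 1 * (4 * L) by rewrite ler_wpM2r//; lra.
  have : 0 <= 32 * G * L by rewrite !mulr_ge0.
  lra.
move: e e0 eGL e4L {den0} => e e0 eGL e4L; move: d d0 d2 Gd eGL => d d0 d2 Gd eGL.
have near_K : \forall u \near t, forall ij : 'I_n * 'I_n, normc (F ij.1 ij.2 u) <= K.
  apply: (@filter_forall V ('I_n * 'I_n)%type (fun ij u => normc (F ij.1 ij.2 u) <= K) _
    (nbhs_filter t)) => -[i j].
  have [Fd _] := nbhs_singleton near_good i j.
  have := near_normc_bound (differentiable_continuous Fd).
  by apply: filterS => u /le_trans; apply.
have : \forall u \near t, bracket_system u /\ forall ij : 'I_n * 'I_n, normc (F ij.1 ij.2 u) <= K.
  exact: filterI near_good near_K.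
move=> /nbhs_box[r r0 rP].
apply/nbhs_box; exists (Num.min r e); first by rewrite lt_min r0.
move=> u ue nDu i j; pose v := u - t.
have vr k : normc (v 0 k) <= r by rewrite !mxE (le_trans (ue k))// ge_min lexx.
have ve k : normc (v 0 k) <= e by rewrite !mxE (le_trans (ue k))// ge_min lexx orbT.
have vve k l : normc (v 0 k - v 0 l) <= 2 * e.
  by rewrite (le_trans (le_normcB _ _))// mulr2n mulrDl mul1r lerD.
have in_box (z : R) : 0 <= z <= 1 -> forall k, normc (line t v z%:C 0 k - t 0 k) <= r.
  move=> /andP[z0 z1] k; rewrite lineE addrC addKr ComplexField.Normc.normcM normcR ger0_norm//.
  by rewrite -[leRHS]mul1r; apply: ler_pM => //; exact: normc_ge0.
have good_line (z : R) : 0 <= z <= 1 -> bracket_system (line t v z%:C) by move=> /in_box/rP[].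
have K_line (z : R) k l : 0 <= z <= 1 -> normc (F k l (line t v z%:C)) <= K.
  by move=> /in_box/rP[_ /(_ (k, l))].
pose Sl (q : 'I_n * 'I_n * R) := skew_entry q.1.1 q.1.2 (line t v q.2%:C).
suff : Sl ((i, j), 1) = 0.
  move=> /eqP; rewrite subr_eq0 => /eqP.
  by rewrite (_ : line t v _ = u)// /line scale1r addrC subrK.
apply: (@contraction_vanish R _ (fun q : 'I_n * 'I_n * R => 0 < q.2 <= 1) Sl (2 * K)) => /=.
- move=> [[k l] z] /= /andP[z0 z1].
  have z01 : 0 <= z <= 1 by rewrite ltW.
  by rewrite (le_trans (le_normcB _ _))// mulr2n mulrDl mul1r lerD ?K_line.
- move=> M M0 SM.
  have SM' k l (y : R) : 0 < y <= 1 -> normc (skew_entry k l (line t v y%:C)) <= M.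
    by move=> y01; exact: (SM ((k, l), y)).
  have Y0 k l : (bracket k l + bracket l k) (line t v 0) = 0.
    rewrite -[LHS]/(bracket k l (line t v 0) + bracket l k (line t v 0)) /bracket /line scale0r addr0.
    have [->|/Ft ->] := eqVneq (t 0 k) (t 0 l); first by rewrite subrr !mul0r addr0.
    by rewrite -mulrDl [X in X * _]addrC addrA subrK subrr mul0r.
  have YE k l z : (bracket k l + bracket l k) (line t v z) =
      (line t v z 0 k - line t v z 0 l) * skew_entry k l (line t v z).
    by rewrite -[LHS]/(bracket k l (line t v z) + bracket l k (line t v z)) /bracket /skew_entry; ring.
  have Ybound k l (z B : R) : 0 < z <= 1 ->
      (forall y, 0 < y <= 1 -> normc ('D_v (bracket k l + bracket l k) (line t v y%:C)) <= B) ->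
      normc ((line t v z%:C 0 k - line t v z%:C 0 l) * skew_entry k l (line t v z%:C)) <= 2 * B * z.
    move=> /andP[z0 z1] DB; rewrite -YE -[X in normc X]subr0 -(Y0 k l).
    apply: (mean_value_inequality (F := (bracket k l + bracket l k) \o line t v)
      (dF := fun y => 'D_v (bracket k l + bracket l k) (line t v y%:C))) => //.
      move=> y /andP[y0 yz]; apply: line_has_derivative.
      have gy : bracket_system (line t v y%:C) by apply: good_line; rewrite y0 (le_trans yz).
      by apply: differentiableD; exact: differentiable_bracket.
    by move=> y /andP[y0 yz]; apply: DB; rewrite y0 ltW// (lt_le_trans yz).
  have far k l (z : R) : t 0 k != t 0 l -> 0 < z <= 1 ->
      normc (skew_entry k l (line t v z%:C)) <= d * M.
    move=> tkl z01; have /andP[z0 z1] := z01.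
    have tau0 : 0 < normc (t 0 k - t 0 l) by rewrite normc_gt0 subr_eq0.
    have DB (y : R) : 0 < y <= 1 ->
        normc ('D_v (bracket k l + bracket l k) (line t v y%:C)) <= 8 * e * G * M.
      move=> y01; have y01' : 0 <= y <= 1 by have /andP[? ->] := y01; rewrite andbT ltW.
      rewrite derive_bracket_sym; last exact: good_line.
      have -> : 8 * e * G * M = n%:R * ((2 * e * T + T * (2 * e)) * (M * K + K * M)).
        by rewrite /G; ring.
      apply: normc_sum_le => m; rewrite coef_line ComplexField.Normc.normcM.
      apply: ler_pM; rewrite ?normc_ge0//.
        rewrite (le_trans (le_normcB _ _))// !ComplexField.Normc.normcM.
        by apply: lerD; apply: ler_pM; rewrite ?normc_ge0.
      rewrite (le_trans (le_normcD _ _))// !ComplexField.Normc.normcM.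
      by apply: lerD; apply: ler_pM; rewrite ?normc_ge0//; [exact: SM'|exact: K_line|
        exact: K_line|exact: SM'].
    have := Ybound k l z _ z01 DB; rewrite ComplexField.Normc.normcM => H.
    have half : normc (t 0 k - t 0 l) / 2 <= normc (line t v z%:C 0 k - line t v z%:C 0 l).
      have : normc (t 0 k - t 0 l) <= normc (line t v z%:C 0 k - line t v z%:C 0 l) +
          normc (z%:C * (v 0 k - v 0 l)).
        apply: le_trans (le_normcB _ _); rewrite !lineE.
        by rewrite le_eqVlt; apply/orP; left; apply/eqP; congr normc; ring.
      have : normc (z%:C * (v 0 k - v 0 l)) <= 2 * e.
        rewrite ComplexField.Normc.normcM normcR ger0_norm ?(ltW z0)//.
        by rewrite -[leRHS]mul1r; apply: ler_pM; rewrite ?normc_ge0// ltW.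
      have : 2 * e <= normc (t 0 k - t 0 l) / 2.
        have := tauL k l; rewrite -(ler_pM2r tau0) mulVf ?gt_eqF// => Lt.
        have : 4 * e * 1 <= 4 * e * (L * normc (t 0 k - t 0 l)).
          by rewrite ler_wpM2l// mulr_ge0// ltW.
        have -> : 4 * e * (L * normc (t 0 k - t 0 l)) = 4 * L * e * normc (t 0 k - t 0 l).
          by ring.
        have : 4 * L * e * normc (t 0 k - t 0 l) <= 1 * normc (t 0 k - t 0 l).
          by rewrite ler_wpM2r// ltW.
        move: (normc _) (4 * L * e * _) => a b; lra.
      move: (normc (t 0 k - t 0 l)) (normc (z%:C * _)) (normc (line _ _ _ _ _ - _)) => a b c'.
      lra.
    have : normc (t 0 k - t 0 l) / 2 * normc (skew_entry k l (line t v z%:C)) <= 2 * (8 * e * G * M) * 1.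
      apply: le_trans (_ : _ <= 2 * (8 * e * G * M) * z) _; last first.
        by rewrite ler_wpM2l// !mulr_ge0// ltW.
      by apply: le_trans H; rewrite ler_wpM2r// normc_ge0.
    rewrite mulr1 => H2.
    have H3 : normc (skew_entry k l (line t v z%:C)) <= 32 * e * G * M * (normc (t 0 k - t 0 l))^-1.
      rewrite ler_pdivlMr//.
      by move: H2; move: (normc (t 0 k - _)) (normc (skew_entry _ _ _)) (e * G * M) => a b c'; lra.
    apply: le_trans H3 _; apply: (@le_trans _ _ (32 * e * G * M * L)).
      by rewrite ler_wpM2l// !mulr_ge0// ltW.
    have -> : 32 * e * G * M * L = (32 * G * L * e) * M by ring.
    by rewrite ler_wpM2r.
  move=> [[k l] z] /= z01; have /andP[z0 z1] := z01; rewrite /Sl /=.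
  have dM : d * M <= M / 2.
    by rewrite mulrC ler_wpM2l//; move: d2; rewrite div1r.
  have [tkl|] := eqVneq (t 0 k) (t 0 l); last first.
    by move=> /far/(_ z01)/le_trans; apply.
  have [->|kl] := eqVneq k l.
    by rewrite /skew_entry subrr ComplexField.Normc.normc0 divr_ge0.
  have vkl : v 0 k - v 0 l != 0.
    rewrite !mxE tkl opprB addrA subrK subr_eq0; apply/eqP => ukl; apply: nDu.
    by exists k, l; rewrite kl.
  have DB (y : R) : 0 < y <= 1 ->
      normc ('D_v (bracket k l + bracket l k) (line t v y%:C)) <= normc (v 0 k - v 0 l) * (2 * G * d * M).
    move=> y01; have y01' : 0 <= y <= 1 by have /andP[? ->] := y01; rewrite andbT ltW.
    rewrite derive_bracket_sym; last exact: good_line.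
    rewrite (eq_bigr (fun m => (v 0 k - v 0 l) * ((t 0 m - t 0 l) *
       (skew_entry k m (line t v y%:C) * F m l (line t v y%:C) +
        F m k (line t v y%:C) * skew_entry m l (line t v y%:C))))); last first.
      by move=> m _; rewrite coef_line /bracket_coef tkl; ring.
    rewrite -mulr_sumr ComplexField.Normc.normcM ler_wpM2l ?normc_ge0//.
    have -> : 2 * G * d * M = n%:R * (T * (d * M * K + K * (d * M))) by rewrite /G; ring.
    apply: normc_sum_le => m; rewrite ComplexField.Normc.normcM.
    have [tml|tml] := eqVneq (t 0 m) (t 0 l).
      rewrite tml subrr ComplexField.Normc.normc0 mul0r.
      by rewrite mulr_ge0// addr_ge0// !mulr_ge0// ltW.
    apply: ler_pM; rewrite ?normc_ge0//.
    rewrite (le_trans (le_normcD _ _))// !ComplexField.Normc.normcM.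
    apply: lerD; apply: ler_pM; rewrite ?normc_ge0//; try exact: K_line.
      by apply: far => //; rewrite tkl eq_sym.
    exact: far.
  have := Ybound k l z _ z01 DB; rewrite !lineE tkl.
  have -> : t 0 l + z%:C * v 0 k - (t 0 l + z%:C * v 0 l) = z%:C * (v 0 k - v 0 l).
    by ring.
  rewrite !ComplexField.Normc.normcM normcR (ger0_norm (ltW z0)).
  have nv0 : 0 < normc (v 0 k - v 0 l) by rewrite normc_gt0.
  have -> : 2 * (normc (v 0 k - v 0 l) * (2 * G * d * M)) * z =
      z * normc (v 0 k - v 0 l) * (4 * G * d * M) by ring.
  rewrite ler_pM2l ?mulr_gt0// => /le_trans; apply.
  by rewrite mulrC ler_wpM2l//; move: Gd; rewrite div1r.
- by rewrite ltr01 lexx.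
Qed.

End SymmetricSolutions.

(** * The deformed connection *)

Section MatrixCalculus.
Context (R : realType) (n : nat) (X : topologicalType) (p : X -> 'rV[CC R]_n).
Hypothesis p_lh : local_homeomorphism p.
Local Notation C := (CC R).
Local Notation pd := (pd p).
Local Notation diff_at := (diff_at p).

Lemma diff_at_mulmx a b c (f : X -> 'M[C]_(a, b)) (g : X -> 'M[C]_(b, c)) x :
  diff_at f x -> diff_at g x -> diff_at (fun y => f y *m g y) x.
Proof.
move=> fx gx; apply: diff_at_mx => i j.
apply: (@eq_diff_at _ _ _ p p_lh _ (fun y => \sum_(k < b) f y i k * g y k j)).
  by apply: filterE => y; rewrite mxE.
by apply: diff_at_sum => k; apply: diff_atM; apply: diff_at_entry.
Qed.

Lemma pd_mulmx a b c k (f : X -> 'M[C]_(a, b)) (g : X -> 'M[C]_(b, c)) x :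
  diff_at f x -> diff_at g x ->
  pd k (fun y => f y *m g y) x = pd k f x *m g x + f x *m pd k g x.
Proof.
move=> fx gx; apply/matrixP => i j; rewrite pd_entry//; last exact: diff_at_mulmx.
have fe i' j' := diff_at_entry i' j' fx; have ge i' j' := diff_at_entry i' j' gx.
rewrite (@eq_pd _ _ _ p p_lh _ _ _ (fun y => \sum_(l < b) f y i l * g y l j)); last first.
  by apply: filterE => y; rewrite mxE.
rewrite pd_sum; last by move=> l; exact: (diff_atM (fe _ _) (ge _ _)).
rewrite !mxE -big_split /=; apply: eq_bigr => l _.
by rewrite (pdM p_lh k (fe _ _) (ge _ _)) (pd_entry k _ _ fx) (pd_entry k _ _ gx).
Qed.

Lemma diff_at_Lambda x : diff_at (Lambda p) x.
Proof.
apply: diff_at_mx => i j.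
apply: (@eq_diff_at _ _ _ p p_lh _ (fun y => p y 0 i * (i == j)%:R)).
  by apply: filterE => y; rewrite /Lambda !mxE mulr_natr.
by apply: diff_atM; [exact: diff_at_coord|exact: diff_at_cst].
Qed.

Lemma pd_Lambda k x : pd k (Lambda p) x = dLambda R k.
Proof.
apply/matrixP => i j; rewrite pd_entry; last exact: diff_at_Lambda.
rewrite (@eq_pd _ _ _ p p_lh _ _ _ (fun y => p y 0 i * (i == j)%:R)); last first.
  by apply: filterE => y; rewrite /Lambda !mxE mulr_natr.
rewrite (pdM p_lh); [|exact: diff_at_coord|exact: diff_at_cst].
rewrite pd_coord// pd_cst mulr0 addr0 !mxE -natrM mulnb.
by rewrite ![_ == k]eq_sym; case: (k =P i) => [->|].
Qed.

End MatrixCalculus.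

Section Commutators.
Context (R : realType) (n : nat).
Local Notation C := (CC R).
Implicit Types (A B D : 'M[C]_n).

Lemma mxcomm_dLambda k A i j :
  mxcomm (dLambda R k) A i j = ((k == i)%:R - (k == j)%:R) * A i j.
Proof.
rewrite /mxcomm /dLambda !mxE (bigD1 k)//= big1 ?addr0; last first.
  by move=> l /negPf lk; rewrite !mxE lk andbF mul0r.
rewrite (bigD1 k)//= [in X in _ - X]big1 ?addr0; last first.
  by move=> l /negPf lk; rewrite !mxE lk mulr0.
rewrite !mxE !eqxx andbT /= ![_ == k]eq_sym mulrBl [A i k * _]mulrC.
by congr (_ - _); [case: eqP => [->|]|case: eqP => [->|]]; rewrite ?mul0r.
Qed.

Lemma mxcomm_diag (d : 'rV[C]_n) A i j :
  mxcomm (diag_mx d) A i j = (d 0 i - d 0 j) * A i j.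
Proof. by rewrite /mxcomm mul_diag_mx mul_mx_diag !mxE mulrBl [A i j * _]mulrC. Qed.

Lemma mxcommDl A B D : mxcomm (A + B) D = mxcomm A D + mxcomm B D.
Proof. by rewrite /mxcomm mulmxDl mulmxDr opprD addrACA. Qed.

Lemma mxcommDr A B D : mxcomm D (A + B) = mxcomm D A + mxcomm D B.
Proof. by rewrite /mxcomm mulmxDl mulmxDr opprD addrACA. Qed.

Lemma mxcommNl A B : mxcomm (- A) B = - mxcomm A B.
Proof. by rewrite /mxcomm mulNmx mulmxN -opprD. Qed.

Lemma mxcommNr A B : mxcomm A (- B) = - mxcomm A B.
Proof. by rewrite /mxcomm mulNmx mulmxN -opprD. Qed.

Lemma mxcomm_scalar A (c : C) : mxcomm A c%:M = 0.
Proof. by rewrite /mxcomm scalar_mxC subrr. Qed.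

Lemma mxcommC A B : mxcomm A B = - mxcomm B A.
Proof. by rewrite /mxcomm opprB. Qed.

Lemma dLambda_comm k l : mxcomm (dLambda R k) (dLambda R l) = 0 :> 'M[C]_n.
Proof.
apply/matrixP => i j; rewrite mxcomm_dLambda /dLambda !mxE.
case: (i =P l) => [->|]; last by rewrite mulr0.
by case: (j =P l) => [->|]; rewrite ?subrr ?mul0r ?mulr0.
Qed.

Lemma mxcomm_swap A B D : mxcomm A B = 0 ->
  mxcomm A (mxcomm B D) = mxcomm B (mxcomm A D).
Proof.
move=> /subr0_eq AB; rewrite /mxcomm !mulmxBr !mulmxBl !mulmxA AB.
rewrite -[D *m B *m A]mulmxA -AB mulmxA !opprB.
by rewrite addrACA [in RHS]addrACA; congr (_ + _); rewrite addrC.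
Qed.

Lemma mxcomm_poles_t A B D : mxcomm A B = 0 ->
  mxcomm (- A + - mxcomm A D) (- B + - mxcomm B D) =
  mxcomm (- mxcomm A D) (- mxcomm B D).
Proof.
move=> AB; have := mxcomm_swap D AB; move: (mxcomm A D) (mxcomm B D) => AD BD swap.
rewrite mxcommDl [mxcomm (- A) _]mxcommDr [mxcomm (- AD) (_ + _)]mxcommDr.
rewrite [mxcomm (- A) (- B)]mxcommNl [mxcomm A (- B)]mxcommNr AB !oppr0 add0r addrA.
rewrite [mxcomm (- A) _]mxcommNl [mxcomm A (- BD)]mxcommNr opprK.
rewrite [mxcomm (- AD) (- B)]mxcommNl [mxcomm AD (- B)]mxcommNr opprK.
rewrite [mxcomm AD B]mxcommC swap.
by move: (mxcomm B AD) => Z; move: (mxcomm _ _) => W; rewrite subrr add0r.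
Qed.

Lemma mxcomm_poles_z A B D (c : C) : mxcomm A B = 0 ->
  mxcomm (- A + - mxcomm A D) (B + (mxcomm B D + c%:M)) =
  mxcomm (- mxcomm A D) (mxcomm B D + c%:M).
Proof.
move=> AB; have := mxcomm_swap D AB; move: (mxcomm A D) (mxcomm B D) => AD BD swap.
rewrite mxcommDl [mxcomm (- A) _]mxcommDr [mxcomm (- AD) (B + _)]mxcommDr.
rewrite [mxcomm (- A) B]mxcommNl AB oppr0 add0r addrA.
rewrite [mxcomm (- A) _]mxcommDr mxcomm_scalar addr0 [mxcomm (- A) BD]mxcommNl.
rewrite [mxcomm (- AD) B]mxcommNl [mxcomm AD B]mxcommC swap.
by move: (mxcomm B AD) => Z; move: (mxcomm _ _) => W; rewrite opprK addNr add0r.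
Qed.

Lemma dLambda_diag_comm k (d : 'rV[C]_n) : mxcomm (dLambda R k) (diag_mx d) = 0.
Proof.
apply/matrixP => i j; rewrite mxcomm_dLambda !mxE.
by case: (i =P j) => [->|_]; rewrite ?subrr ?mul0r// mulr0n mulr0.
Qed.

Lemma derive1_pole (A B : 'M[C]_n) :
  derive1 (fun s : C => s^-1 *: - A + B) (1 : C) = A.
Proof.
have dA : differentiable (fun s : C => s^-1 *: - A + B) (1 : C).
  apply: differentiableD; last exact: differentiable_cst.
  apply: (@differentiableZl _ _ _ (fun s : C => s^-1)).
  by apply: differentiable_Rinv; rewrite oner_neq0.
rewrite derive1E; apply/matrixP => i j; rewrite -derive_entry; last exact: diff_derivable.
have -> : (fun u : C => (u^-1 *: - A + B) i j) =
    ((fun u : C => u^-1) * cst (- A i j)) + cst (B i j).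
  by apply/funext => u; rewrite !mxE.
have dV : derivable (fun u : C => u^-1) (1 : C) 1.
  by apply: derivableV; [rewrite oner_neq0|exact: derivable_id].
have dc (c : C) : derivable (cst c : C -> C) (1 : C) 1 by exact: derivable_cst.
rewrite (deriveD (derivableM dV (dc _)) (dc _)) derive_cst addr0.
rewrite (deriveM dV (dc _)) derive_cst scaler0 add0r.
have did : derivable (id : C -> C) (1 : C) 1 by exact: derivable_id.
have := @deriveV C C id 1 1; rewrite oner_neq0 => /(_ isT did) ->.
rewrite derive_id expr1n invr1 /GRing.scale /= mulr1 mulrN1; exact: opprK.
Qed.

End Commutators.

Section Diagonals.
Context (R : realType) (n : nat).
Local Notation C := (CC R).
Local Notation normc := (@ComplexField.Normc.normc R).

Lemma near_punctured_neq (a : C) : \forall z \near (0 : C)^', z != a.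
Proof.
have [->|a0] := eqVneq a 0; first exact: nbhs_dnbhs_neq.
apply: nbhs_dnbhs; apply/nbhs_normc; exists (normc a / 2) => [|z].
  by rewrite divr_gt0 ?normc_gt0.
by rewrite subr0 => za; apply: contraTneq za => ->; rewrite -ltNge ltr_pdivrMr// mulr2n mulrDr mulr1 ltrDl normc_gt0.
Qed.

Lemma not_near_diagonals (t : 'rV[C]_n) : ~ (\forall u \near t, diagonals u).
Proof.
move=> nearD; pose v : 'rV[C]_n := \row_k (k%:R : C).
have h1 : \forall z \near (0 : C)^', diagonals (line t v z).
  have lc : {for (0 : C), continuous (line t v)}.
    apply: differentiable_continuous; apply: differentiableD; first exact: differentiable_cst.
    exact: differentiableZl.
  apply: nbhs_dnbhs; apply: lc; rewrite /line scale0r addr0; exact: nearD.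
have h2 : \forall z \near (0 : C)^', forall ij : 'I_n * 'I_n,
    z != - (t 0 ij.1 - t 0 ij.2) / (ij.1%:R - ij.2%:R).
  apply: (@filter_forall C ('I_n * 'I_n)%type (fun ij z => z != - (t 0 ij.1 - t 0 ij.2) / (ij.1%:R - ij.2%:R)) _
    (dnbhs_filter (0 : C))) => ij.
  exact: near_punctured_neq.
have [z [[i [j [ij +]]] +]] := filter_ex (filterI h1 h2).
move=> tij /(_ (i, j))/eqP; apply; move: tij; rewrite !lineE !mxE /= => tij.
have ij0 : (i%:R - j%:R : C) != 0 by rewrite subr_eq0 eqr_nat.
apply: (mulIf ij0); rewrite mulfVK// mulrBr.
apply/eqP; rewrite -subr_eq0 opprK; apply/eqP.
have -> : z * i%:R - z * j%:R + (t 0 i - t 0 j) = (t 0 i + z * i%:R) - (t 0 j + z * j%:R).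
  by ring.
by rewrite tij subrr.
Qed.

End Diagonals.

Section Deformation.
Context (R : realType) (n : nat) (X : topologicalType) (p : X -> 'rV[CC R]_n).
Hypothesis p_lh : local_homeomorphism p.
Local Notation C := (CC R).
Local Notation normc := (@ComplexField.Normc.normc R).
Local Notation diff_at := (diff_at p).
Context (Theta : set X) (F : X -> 'M[C]_n) (c : C).
Hypothesis Theta_closed : closed Theta.
Hypothesis F_holo : holomorphic_on p (~` Theta) F.
Hypothesis integrable : integrable_on p (~` Theta) (deformed_connection p F c%:M).

Definition residue (x : X) : 'M[C]_n := mxcomm (Lambda p x) (F x) + c%:M.

Lemma F_diff x : ~ Theta x -> diff_at F x.
Proof. by move=> Tx; apply: (holomorphic_diff_at p_lh); exact: F_holo. Qed.

Lemma nablaE_diff k x : ~ Theta x -> diff_at (nablaE F k) x.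
Proof.
move=> /F_diff Fx; apply: diff_atN; apply: diff_atB; apply: (diff_at_mulmx p_lh) => //;
  exact: diff_at_cst.
Qed.

Lemma residue_diff x : ~ Theta x -> diff_at residue x.
Proof.
move=> /F_diff Fx; apply: diff_atD; last exact: diff_at_cst.
apply: diff_atB; apply: (diff_at_mulmx p_lh) => //; exact: (diff_at_Lambda p_lh).
Qed.

Lemma nablaE_entry k x i j :
  nablaE F k x i j = - (((k == i)%:R - (k == j)%:R) * F x i j).
Proof. by rewrite /nablaE mxE mxcomm_dLambda. Qed.

Lemma nablaE_flat k l x : ~ Theta x ->
  pd p k (nablaE F l) x - pd p l (nablaE F k) x
    + mxcomm (nablaE F k x) (nablaE F l x) = 0.
Proof.
move=> Tx; have [H _] := integrable Tx (oner_neq0 _); move: (H k l) => {H}.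
have mE m y : matrix_t (deformed_connection p F c%:M) m y 1 = - dLambda R m + nablaE F m y.
  by rewrite /matrix_t /= invr1 scale1r.
have pdE m r : pd p m (fun y => matrix_t (deformed_connection p F c%:M) r y 1) x =
    pd p m (nablaE F r) x.
  rewrite (eq_pd p_lh _ (g := fun y => - dLambda R r + nablaE F r y)); last first.
    by apply: filterE => y; rewrite mE.
  by rewrite pdD; [rewrite pd_cst add0r|exact: diff_at_cst|exact: nablaE_diff].
rewrite (pdE k l) (pdE l k) (mE k x) (mE l x) => H.
have E : mxcomm (- dLambda R k + nablaE F k x) (- dLambda R l + nablaE F l x) =
    mxcomm (nablaE F k x) (nablaE F l x) by exact/mxcomm_poles_t/dLambda_comm.
by rewrite E in H.
Qed.

Lemma residue_flat k x : ~ Theta x ->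
  pd p k residue x + mxcomm (nablaE F k x) (residue x) = 0.
Proof.
move=> Tx; have [_ H] := integrable Tx (oner_neq0 _); move: (H k) => {H}.
rewrite (eq_pd p_lh _ (g := fun y => Lambda p y + residue y)); last first.
  by apply: filterE => y; rewrite /matrix_z /= invr1 !scale1r.
rewrite pdD; [|exact: (diff_at_Lambda p_lh)|exact: residue_diff].
rewrite (pd_Lambda p_lh k x).
have -> : matrix_z (deformed_connection p F c%:M) x 1 = Lambda p x + residue x.
  by rewrite /matrix_z /= invr1 !scale1r.
have -> : matrix_t (deformed_connection p F c%:M) k x 1 = - dLambda R k + nablaE F k x.
  by rewrite /matrix_t /= invr1 scale1r.
have -> : derive1 (fun s : C => matrix_t (deformed_connection p F c%:M) k x s) 1 = dLambda R k.
  exact: derive1_pole.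
have -> : mxcomm (- dLambda R k + nablaE F k x) (Lambda p x + residue x) =
    mxcomm (nablaE F k x) (residue x) by exact/mxcomm_poles_z/dLambda_diag_comm.
by move: (pd _ _ _ _) => Z; move: (mxcomm _ _) => W; rewrite [dLambda R k + Z]addrC addrK.
Qed.

Lemma pd_bracket k i j x : ~ Theta x ->
  pd p k (fun y => (p y 0 i - p y 0 j) * F y i j) x =
  \sum_m bracket_coef (delta_mx 0 k) (p x) i m j * (F x i m * F x m j).
Proof.
move=> Tx.
have -> : pd p k (fun y => (p y 0 i - p y 0 j) * F y i j) x = pd p k residue x i j.
  rewrite pd_entry; last exact: residue_diff.
  have dU : diff_at (fun y => (p y 0 i - p y 0 j) * F y i j) x.
    apply: diff_atM; last exact/diff_at_entry/F_diff.
    by apply: diff_atB; exact: diff_at_coord.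
  rewrite (eq_pd p_lh _ (f := fun y => residue y i j)
    (g := fun y => (p y 0 i - p y 0 j) * F y i j + (c *+ (i == j)))); last first.
    by apply: filterE => y; rewrite /residue [LHS]mxE mxcomm_diag [c%:M i j]mxE.
  by rewrite pdD//; [rewrite pd_cst addr0|exact: diff_at_cst].
have /eqP := residue_flat k Tx; rewrite addr_eq0 => /eqP ->.
rewrite /residue mxcommDr mxcomm_scalar addr0 /mxcomm !mxE -sumrB -sumrN.
apply: eq_bigr => m _; rewrite !nablaE_entry !mxcomm_diag /bracket_coef !mxE !eqxx /=.
by rewrite ![k == _]eq_sym; ring.
Qed.

Lemma symmetric_locally x : ~ Theta x ->
  (forall i j, p x 0 i != p x 0 j -> F x i j = F x j i) ->
  \forall y \near x, (F y)^T = F y.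
Proof.
move=> Tx Fx; pose s := local_inverse p x.
pose f i j t := F (s t) i j.
have nearT : \forall y \near x, ~ Theta y.
  by apply: open_nbhs_nbhs; split=> //; exact: closed_openC.
have near_sys : \forall t \near p x, bracket_system f t.
  have h1 := near_chart p_lh nearT.
  have h2 : \forall y \near x, forall k i j,
     pd p k (fun y => (p y 0 i - p y 0 j) * F y i j) y =
     'D_(delta_mx 0 k) ((fun y => (p y 0 i - p y 0 j) * F y i j) \o s) (p y).
    by apply: filter_forall => k; apply: filter_forall => i; apply: filter_forall => j;
      exact: pd_chart.
  have h3 := near_chart p_lh h2.
  have h4 := near_join (local_inverseK p_lh x).
  have h5 : \forall y \near x, forall i j, differentiable ((fun y => F y i j) \o s) (p y).
    apply: filter_forall => i; apply: filter_forall => j.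
    apply: filterS2 nearT (diff_at_chart p_lh (fun y => F y i j) x) => y Ty [+ _].
    by apply; exact/diff_at_entry/F_diff.
  have h6 := near_chart p_lh h5.
  near=> t.
  have Tt : ~ Theta (s t) by near: t; exact: h1.
  have pst : \forall u \near t, p (s u) = u by near: t; exact: h4.
  have pt := nbhs_singleton pst.
  have Dt : forall k i j, pd p k (fun y => (p y 0 i - p y 0 j) * F y i j) (s t) =
     'D_(delta_mx 0 k) ((fun y => (p y 0 i - p y 0 j) * F y i j) \o s) (p (s t)).
    by near: t; exact: h3.
  have Ft : forall i j, differentiable ((fun y => F y i j) \o s) (p (s t)).
    by near: t; exact: h6.
  move=> i j; split; first by have := Ft i j; rewrite pt.
  move=> k; have <- : 'D_(delta_mx 0 k) ((fun y => (p y 0 i - p y 0 j) * F y i j) \o s) (p (s t)) =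
      'D_(delta_mx 0 k) (bracket f i j) t.
    rewrite pt; apply: near_eq_derive; apply: filterS pst => u pu.
    by rewrite /bracket /f /= pu.
  by rewrite -(Dt k i j) (pd_bracket k i j Tt) pt.
have sys_x : forall i j, p x 0 i != p x 0 j -> f i j (p x) = f j i (p x).
  by move=> i j /Fx; rewrite /f /s local_inverse_center.
have near_sym := near_join (symmetric_near sys_x near_sys).
apply: (near_unchart p_lh); apply: filterS2 near_sys near_sym => t sys_t sym_t.
apply/matrixP => i j; rewrite mxE; apply: contrapT => /eqP; rewrite -subr_eq0 => neq.
apply: (@not_near_diagonals R n t).
have g_cont : {for t, continuous (fun u => f j i u - f i j u)}.
  apply: differentiable_continuous; apply: differentiableB; [exact: (sys_t j i).1|exact: (sys_t i j).1].
have nz : 0 < normc (f j i t - f i j t) by rewrite normc_gt0.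
have := (cvg_normcP (nbhs_filter t) _ _).1 g_cont _ (divr_gt0 nz (ltr0Sn _ 1)).
apply: filterS2 sym_t => u sym_u; apply: contraPP => nDu.
rewrite (sym_u nDu i j) subrr subr0; apply/negP; rewrite -ltNge.
by rewrite ltr_pdivrMr// mulr2n mulrDr mulr1 ltrDl.
Unshelve. all: by end_near. Qed.

Context (omega : X -> 'cV[C]_n) (a : C).
Hypothesis omega_holo : holomorphic_on p (~` Theta) omega.
Hypothesis omega_flat : forall x k, ~ Theta x ->
  pd p k omega x + nablaE F k x *m omega x = 0.

Definition eigen_defect (x : X) : 'cV[C]_n := (residue x - a%:M) *m omega x.

Lemma omega_diff x : ~ Theta x -> diff_at omega x.
Proof. by move=> Tx; apply: (holomorphic_diff_at p_lh); exact: omega_holo. Qed.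

Lemma pd_omega k x : ~ Theta x -> pd p k omega x = - (nablaE F k x *m omega x).
Proof. by move=> /(omega_flat k)/eqP; rewrite addr_eq0 => /eqP. Qed.

Lemma pd_residue k x : ~ Theta x -> pd p k residue x = - mxcomm (nablaE F k x) (residue x).
Proof. by move=> /(residue_flat k)/eqP; rewrite addr_eq0 => /eqP. Qed.

Lemma residue_shift_diff x : ~ Theta x -> diff_at (fun y => residue y - a%:M) x.
Proof. by move=> Tx; apply: diff_atB; [exact: residue_diff|exact: diff_at_cst]. Qed.

Lemma eigen_defect_diff x : ~ Theta x -> diff_at eigen_defect x.
Proof.
by move=> Tx; apply: (diff_at_mulmx p_lh); [exact: residue_shift_diff|exact: omega_diff].
Qed.

Lemma pd_eigen_defect k x : ~ Theta x ->
  pd p k eigen_defect x = - (nablaE F k x *m eigen_defect x).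
Proof.
move=> Tx; rewrite /eigen_defect.
rewrite (pd_mulmx p_lh k (residue_shift_diff Tx) (omega_diff Tx)).
rewrite (pdB k (residue_diff Tx) (diff_at_cst _ _ _)) pd_cst subr0.
rewrite pd_omega// pd_residue//.
move: (nablaE F k x) (residue x) (omega x) => N V w.
rewrite /mxcomm mulNmx mulmxN -opprD; congr (- _).
have -> : (N *m V - V *m N) *m w = N *m (V *m w) - V *m (N *m w) by rewrite mulmxBl !mulmxA.
have -> : (V - a%:M) *m (N *m w) = V *m (N *m w) - a *: (N *m w).
  by rewrite mulmxBl mul_scalar_mx.
have -> : N *m ((V - a%:M) *m w) = N *m (V *m w) - a *: (N *m w).
  by rewrite mulmxBl mulmxBr mul_scalar_mx -scalemxAr.
by rewrite addrA subrK.
Qed.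

Lemma eigen_defect_locally x : ~ Theta x -> eigen_defect x = 0 ->
  \forall y \near x, eigen_defect y = 0.
Proof.
move=> Tx ex; pose s := local_inverse p x.
have nearT : \forall y \near x, ~ Theta y.
  by apply: open_nbhs_nbhs; split=> //; exact: closed_openC.
pose psi (i : 'I_n) (t : 'rV[C]_n) : C := eigen_defect (s t) i 0.
have psi0 i : psi i (p x) = 0 by rewrite /psi /s local_inverse_center// ex mxE.
pose K : R := \sum_i \sum_j (normc (F x i j) + 1).
have near_K : \forall y \near x, forall i j, normc (F y i j) <= K.
  apply: filter_forall => i; apply: filter_forall => j.
  have : {for x, continuous (fun y => F y i j)}.
    exact/(diff_at_continuous p_lh)/diff_at_entry/F_diff.
  move=> /(cvg_normcP (nbhs_filter x)) /(_ 1 ltr01); apply: filterS => y Fy.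
  have le1 : normc (F y i j) <= normc (F x i j) + 1.
    rewrite -{1}(subrK (F x i j) (F y i j)) addrC (le_trans (le_normcD _ _))// lerD2l.
    by rewrite normcB.
  apply: le_trans le1 _; rewrite /K (bigD1 i)//= (bigD1 j)//= -addrA lerDl addr_ge0//.
    by apply: sumr_ge0 => ? _; rewrite addr_ge0 ?normc_ge0.
  by apply: sumr_ge0 => ? _; apply: sumr_ge0 => ? _; rewrite addr_ge0 ?normc_ge0.
have near_bound : \forall y \near x, forall i,
    differentiable ((fun y => eigen_defect y i 0) \o s) (p y) /\
    forall k, normc ('D_(delta_mx 0 k) ((fun y => eigen_defect y i 0) \o s) (p y))
      <= 2 * K * \sum_j normc (eigen_defect y j 0).
  have h1 : \forall y \near x, forall i,
     diff_at (fun y => eigen_defect y i 0) y <->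
     differentiable ((fun y => eigen_defect y i 0) \o s) (p y).
    by apply: filter_forall => i; exact: diff_at_chart.
  have h2 : \forall y \near x, forall i k,
     pd p k (fun y => eigen_defect y i 0) y =
     'D_(delta_mx 0 k) ((fun y => eigen_defect y i 0) \o s) (p y).
    by apply: filter_forall => i; apply: filter_forall => k; exact: pd_chart.
  near=> y; have Ty : ~ Theta y by near: y.
  have dy := eigen_defect_diff Ty.
  have h1y : forall i, diff_at (fun y => eigen_defect y i 0) y <->
     differentiable ((fun y => eigen_defect y i 0) \o s) (p y) by near: y; exact: h1.
  have h2y : forall i k, pd p k (fun y => eigen_defect y i 0) y =
     'D_(delta_mx 0 k) ((fun y => eigen_defect y i 0) \o s) (p y) by near: y; exact: h2.
  have Ky : forall i j, normc (F y i j) <= K by near: y; exact: near_K.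
  move=> i; split; first exact: ((h1y i).1 (diff_at_entry i 0 dy)).
  move=> k; rewrite -(h2y i k) -(pd_entry k i 0 dy) pd_eigen_defect//.
  rewrite mxE normcN mxE (le_trans (normc_sum _ _ _))// mulr_sumr.
  apply: ler_sum => j _; rewrite ComplexField.Normc.normcM ler_wpM2r ?normc_ge0//.
  rewrite nablaE_entry normcN ComplexField.Normc.normcM.
  apply: ler_pM; rewrite ?normc_ge0//.
  rewrite (le_trans (le_normcB _ _))//.
  have nb (b : bool) : normc (b%:R : C) <= 1.
    by case: b; rewrite ?ComplexField.Normc.normc1// ComplexField.Normc.normc0.
  by rewrite (_ : 2 = 1 + 1)// lerD.
have near_sys : \forall t \near p x, forall i, differentiable (psi i) t /\
    forall k, normc ('D_(delta_mx 0 k) (psi i) t) <= 2 * K * \sum_j normc (psi j t).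
  apply: filterS2 (local_inverseK p_lh x) (near_chart p_lh near_bound) => t pt.
  by rewrite -/s in pt *; rewrite pt.
apply: (near_unchart p_lh); have := linear_system_vanish psi0 near_sys.
apply: filterS => t pt; apply/colP => i; rewrite [RHS]mxE; exact: pt.
Unshelve. all: by end_near. Qed.

Lemma symmetric_eigen_everywhere xo : hypersurface p Theta -> path_connected R X ->
  ~ Theta xo -> (forall i j, p xo 0 i != p xo 0 j -> F xo i j = F xo j i) ->
  eigen_defect xo = 0 ->
  forall x, ~ Theta x -> (F x)^T = F x /\ eigen_defect x = 0.
Proof.
move=> Thyp pathX Txo Fxo exo.
pose A := [set x | ~ Theta x /\ (F x)^T = F x /\ eigen_defect x = 0].
have nearT x : ~ Theta x -> \forall y \near x, ~ Theta y.
  by move=> Tx; apply: open_nbhs_nbhs; split=> //; exact: closed_openC.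
have near_neq0 (f : X -> C) x : diff_at f x -> f x != 0 -> \forall y \near x, f y != 0.
  move=> /(diff_at_continuous p_lh)/(cvg_normcP (nbhs_filter x)) fc fx.
  have nz : 0 < normc (f x) by rewrite normc_gt0.
  have := fc _ (divr_gt0 nz (ltr0Sn _ 1)).
  apply: filterS => y; apply: contraTneq => ->; rewrite subr0 -ltNge.
  by rewrite ltr_pdivrMr// mulr2n mulrDr mulr1 ltrDl.
have A_near x : A x -> \forall y \near x, A y.
  move=> [Tx [Fx ex]].
  have h1 : \forall y \near x, (F y)^T = F y.
    by apply: symmetric_locally => // i j _; rewrite -[in LHS]Fx mxE.
  have h2 := eigen_defect_locally Tx ex; have h3 := nearT x Tx.
  by near=> y; split; [near: y|split; near: y].
have Ao : open A by rewrite openE => x /A_near.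
have Aco : open [set x | ~ Theta x /\ ~ A x].
  rewrite openE => x [Tx nA].
  have {}nA : ~ ((F x)^T = F x /\ eigen_defect x = 0) by move=> ?; apply: nA.
  have [Fx|Fx] := pselect ((F x)^T = F x).
    have /existsNP[i /eqP ei] : ~ forall i, eigen_defect x i 0 = 0.
      by move=> e0; apply: nA; split=> //; apply/colP => i; rewrite e0 mxE.
    have := near_neq0 _ x (diff_at_entry i 0 (eigen_defect_diff Tx)) ei.
    apply: filterS2 (nearT x Tx) => y Ty ey; split=> // -[_ [_ e0]].
    by move: ey; rewrite e0 mxE eqxx.
  have /existsNP[i /existsNP[j /eqP Fij]] : ~ forall i j, F x j i = F x i j.
    by move=> F0; apply: Fx; apply/matrixP => i j; rewrite mxE.
  rewrite -subr_eq0 in Fij.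
  have := near_neq0 _ x (diff_atB (diff_at_entry j i (F_diff Tx)) (diff_at_entry i j (F_diff Tx))) Fij.
  apply: filterS2 (nearT x Tx) => y Ty Fy; split=> // -[_ [F0 _]].
  by move: Fy; rewrite -{1}F0 mxE subrr eqxx.
have Axo : A xo.
  split=> //; split=> //.
  by apply: (nbhs_singleton (symmetric_locally Txo _)) => i j; exact: Fxo.
by move=> x /(hypersurface_complement_connected p_lh Thyp Ao Aco pathX Axo)[].
Unshelve. all: by end_near. Qed.

End Deformation.

(** * The Frobenius structure *)

Lemma potential_identity (K : comPzRingType) (I : eqType) (i k l m : I) (A : K) (f : I -> K) :
  k != l ->
  (l == m)%:R * (A *+ (k == i) *+ (i == l) - f k *+ (i == l) - f l *+ (k == i) + f l *+ (k == l))
  - (i == m)%:R * (A *+ (k == i) *+ (i == l) - f k *+ (i == l) - f l *+ (k == i) + f l *+ (k == l))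
  - (i == l)%:R * (A *+ (k == i) *+ (i == m) - f k *+ (i == m) - f m *+ (k == i) + f m *+ (k == m)) =
  (k == m)%:R * (A *+ (l == i) *+ (i == k) - f l *+ (i == k) - f k *+ (l == i) + f k *+ (l == k))
  - (i == m)%:R * (A *+ (l == i) *+ (i == k) - f l *+ (i == k) - f k *+ (l == i) + f k *+ (l == k))
  - (i == k)%:R * (A *+ (l == i) *+ (i == m) - f l *+ (i == m) - f m *+ (l == i) + f m *+ (l == m)).
Proof.
move=> kl; rewrite [l == k]eq_sym (negPf kl).
have [->|ik] := eqVneq i k.
  rewrite ?eqxx ?(negPf kl) /=.
  have [<-|km] := eqVneq k m; rewrite ?eqxx ?[l == k]eq_sym ?(negPf kl) /= ?mulr1n ?mulr0n; first by ring.
  by have [<-|lm] := eqVneq l m; rewrite /= ?mulr1n ?mulr0n; ring.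
have [->|il] := eqVneq i l.
  rewrite ?eqxx ?[l == k]eq_sym ?(negPf kl) /=.
  have [<-|lm] := eqVneq l m; rewrite ?eqxx ?(negPf kl) /= ?mulr1n ?mulr0n; first by ring.
  by have [<-|km] := eqVneq k m; rewrite /= ?mulr1n ?mulr0n; ring.
by rewrite /= !mulr0n; ring.
Qed.
Lemma potential_symmetry (K : idomainType) (I : eqType) (i : I) (w A : K) (f : I -> K)
    (G : I -> I -> K) : w != 0 ->
  (forall k l, w * G k l =
    A *+ (k == i) *+ (i == l) - f k *+ (i == l) - f l *+ (k == i) + f l *+ (k == l)) ->
  forall k l m,
  (l == m)%:R * G k l - G k l * (i == m)%:R - (i == l)%:R * G k m =
  (k == m)%:R * G l k - G l k * (i == m)%:R - (i == k)%:R * G l m.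
Proof.
move=> w0 wG k l m; have [->//|kl] := eqVneq k l.
apply: (mulfI w0); rewrite !mulrBr ![w * (_%:R * _)]mulrCA ![w * (G _ _ * _)]mulrA.
by rewrite !wG ![_ * (i == m)%:R]mulrC; exact: potential_identity.
Qed.

Lemma euler_key (C : comPzRingType) (n : nat) (q gk dq N u : 'M[C]_n) (h dh v : 'cV[C]_n) (c : C) :
    dq *m h + q *m dh = (N *m u - u *m N) *m (q *m v) + (c%:M - u) *m (dq *m v) ->
    q *m gk = dq + N *m q -> q *m h = (c%:M - u) *m (q *m v) ->
    q *m (dh + gk *m h) = (c%:M - u) *m (q *m (gk *m v)).
Proof.
move=> H1 H2 H3.
have -> : q *m (gk *m v) = dq *m v + N *m (q *m v) by rewrite mulmxA H2 mulmxDl mulmxA.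
have -> : q *m (dh + gk *m h) = (dq *m h + q *m dh) + N *m (q *m h).
  by rewrite mulmxDr [q *m (_ *m _)]mulmxA H2 mulmxDl -mulmxA addrA [q *m dh + _]addrC.
rewrite H1 H3 mulmxDr [RHS]addrC addrAC; congr (_ + _).
rewrite !mulmxA -mulmxDl; congr (_ *m _); rewrite -mulmxDl; congr (_ *m _).
by rewrite mulmxBr mulmxBl scalar_mxC addrC addrA subrK.
Qed.

Section PeriodMap.
Context (R : realType) (n : nat) (X : topologicalType) (p : X -> 'rV[CC R]_n).
Hypothesis p_lh : local_homeomorphism p.
Local Notation C := (CC R).
Local Notation diff_at := (diff_at p).
Context (M : set X) (F : X -> 'M[C]_n) (omega : X -> 'cV[C]_n) (b : C).
Hypothesis M_open : open M.
Hypothesis F_diff : forall x, M x -> diff_at F x.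
Hypothesis omega_diff : forall x, M x -> diff_at omega x.
Hypothesis omega_neq0 : forall x i, M x -> omega x i 0 != 0.
Hypothesis F_sym : forall x, M x -> (F x)^T = F x.
Hypothesis nablaE_flat : forall x k l, M x ->
  pd p k (nablaE F l) x - pd p l (nablaE F k) x
    + mxcomm (nablaE F k x) (nablaE F l x) = 0.
Hypothesis pd_omega : forall x k, M x -> pd p k omega x = - (nablaE F k x *m omega x).
Local Notation U := (fun y => mxcomm (Lambda p y) (F y)).
Hypothesis pd_U : forall x k, M x -> pd p k U x = - mxcomm (nablaE F k x) (U x).
Hypothesis U_omega : forall x, M x -> U x *m omega x = b *: omega x.

Local Notation Q := (period_map omega).
Local Notation Gamma := (period_connection p F omega).
Local Notation mu := (period_product omega).
Local Notation g := (period_metric omega).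
Local Notation "''d_' k" := (@coord_field R n X k) (at level 8, k at level 2).

Definition diag_of (v : 'cV[C]_n) : 'M[C]_n := diag_mx v^T.

Lemma diag_ofE v i j : diag_of v i j = v i 0 *+ (i == j).
Proof. by rewrite !mxE; case: (i =P j) => [->|]; rewrite ?mulr0n. Qed.

Lemma period_mapE x : Q x = diag_of (omega x).
Proof.
apply/matrixP => i k; rewrite diag_ofE mxE /Phi mulNmx opprK mxE.
rewrite /dLambda (bigD1 k)//= big1 ?addr0; last first.
  by move=> l /negPf lk; rewrite mxE lk andbF mul0r.
rewrite mxE eqxx andbT.
by case: (i =P k) => [->|]; rewrite ?mul1r// mul0r.
Qed.

Lemma near_M x : M x -> \forall y \near x, M y.
Proof. by move=> Mx; exact: open_nbhs_nbhs. Qed.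

Lemma holomorphic_on_M (W : normedModType C) (f : X -> W) :
  (forall x, M x -> diff_at f x) -> holomorphic_on p M f.
Proof.
move=> fM x Mx; apply/(holomorphic_atP p_lh).
by apply: filterS (near_M Mx) => y; exact: fM.
Qed.

Lemma eq_on_pd (W : normedModType C) k (f h : X -> W) x : M x ->
  (forall y, M y -> f y = h y) -> pd p k f x = pd p k h x.
Proof. by move=> Mx fh; apply: (eq_pd p_lh); apply: filterS (near_M Mx) => y /fh. Qed.

Lemma eq_on_diff_at (W : normedModType C) (f h : X -> W) x : M x ->
  (forall y, M y -> f y = h y) -> diff_at f x -> diff_at h x.
Proof. by move=> Mx fh; apply: (eq_diff_at p_lh); apply: filterS (near_M Mx) => y /fh. Qed.

Lemma diff_at_diag_of (f : X -> 'cV[C]_n) x :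
  diff_at f x -> diff_at (fun y => diag_of (f y)) x.
Proof.
move=> fx; apply: diff_at_mx => i j.
apply: (eq_diff_at p_lh (f := fun y => f y i 0 * (i == j)%:R)).
  by apply: filterE => y; rewrite diag_ofE mulr_natr.
by apply: diff_atM; [exact: diff_at_entry|exact: diff_at_cst].
Qed.

Lemma pd_diag_of k (f : X -> 'cV[C]_n) x : diff_at f x ->
  pd p k (fun y => diag_of (f y)) x = diag_of (pd p k f x).
Proof.
move=> fx; apply/matrixP => i j; rewrite (pd_entry _ _ _ (diff_at_diag_of fx)).
rewrite (eq_pd p_lh _ (g := fun y => f y i 0 * (i == j)%:R)); last first.
  by apply: filterE => y; rewrite diag_ofE mulr_natr.
rewrite (pdM p_lh _ (diff_at_entry i 0 fx) (diff_at_cst _ _ _)) pd_cst mulr0 addr0.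
by rewrite diag_ofE (pd_entry _ _ _ fx) mulr_natr.
Qed.

Lemma period_map_unit x : M x -> Q x \in unitmx.
Proof.
move=> Mx; rewrite period_mapE unitmxE det_diag unitfE.
by apply/prodf_neq0 => i _; rewrite mxE omega_neq0.
Qed.

Lemma period_map_diff x : M x -> diff_at Q x.
Proof.
move=> Mx; apply: (eq_on_diff_at Mx (fun y _ => esym (period_mapE y))).
by apply: diff_at_diag_of; exact: omega_diff.
Qed.

Lemma pd_period_map k x : M x -> pd p k Q x = diag_of (pd p k omega x).
Proof.
move=> Mx; rewrite (eq_on_pd _ Mx (fun y _ => period_mapE y)).
by apply: pd_diag_of; exact: omega_diff.
Qed.

Lemma nablaE_diff_on k x : M x -> diff_at (nablaE F k) x.
Proof.
move=> /F_diff Fx; apply: diff_atN; apply: diff_atB; apply: (diff_at_mulmx p_lh) => //;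
  exact: diff_at_cst.
Qed.

Lemma nablaE_omega_diff k x : M x -> diff_at (fun y => nablaE F k y *m omega y) x.
Proof.
by move=> Mx; apply: (diff_at_mulmx p_lh); [exact: nablaE_diff_on|exact: omega_diff].
Qed.

Lemma pd_period_map_diff k x : M x -> diff_at (pd p k Q) x.
Proof.
move=> Mx; have e y : M y -> diag_of (- (nablaE F k y *m omega y)) = pd p k Q y.
  by move=> My; rewrite pd_period_map// pd_omega.
apply: (eq_on_diff_at Mx e); apply: diff_at_diag_of; apply: diff_atN.
exact: nablaE_omega_diff.
Qed.

Lemma pd_pd_period_map k l x : M x -> pd p k (pd p l Q) x =
  diag_of (nablaE F l x *m (nablaE F k x *m omega x) - pd p k (nablaE F l) x *m omega x).
Proof.
move=> Mx; have e y : M y -> pd p l Q y = diag_of (- (nablaE F l y *m omega y)).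
  by move=> My; rewrite pd_period_map// pd_omega.
rewrite (eq_on_pd _ Mx e) pd_diag_of; last by apply: diff_atN; exact: nablaE_omega_diff.
rewrite pdN; last exact: nablaE_omega_diff.
rewrite (pd_mulmx p_lh k (nablaE_diff_on l Mx) (omega_diff Mx)) pd_omega//.
have key (A L : 'M[C]_n) (u v : 'cV[C]_n) : - (A *m u + L *m (- v)) = L *m v - A *m u.
  by rewrite mulmxN opprB.
by congr diag_of; exact: key.
Qed.

Lemma pd_period_map_sym k l x : M x -> pd p k (pd p l Q) x = pd p l (pd p k Q) x.
Proof.
move=> Mx; rewrite (pd_pd_period_map k l Mx) (pd_pd_period_map l k Mx).
have key (A B N L : 'M[C]_n) (w : 'cV[C]_n) : A - B + (N *m L - L *m N) = 0 ->
    L *m (N *m w) - A *m w = N *m (L *m w) - B *m w.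
  move=> H; apply/eqP; rewrite -subr_eq0 !mulmxA -!mulmxBl.
  rewrite (_ : L *m N - A - (N *m L - B) = - (A - B + (N *m L - L *m N))).
    by rewrite H oppr0 mul0mx.
  move: (L *m N) (N *m L) => Z W; rewrite opprB opprD !opprB.
  by rewrite addrACA [RHS]addrACA [B + _]addrC.
exact: (congr1 diag_of (key _ _ _ _ (omega x) (nablaE_flat k l Mx))).
Qed.

Lemma period_connectionE k x : M x ->
  Q x *m Gamma k x = pd p k Q x + nablaE F k x *m Q x.
Proof. by move=> Mx; rewrite /period_connection mulKVmx// period_map_unit. Qed.

Lemma period_connection_entry k x i j : M x -> omega x i 0 * Gamma k x i j =
  (pd p k omega x i 0) *+ (i == j) + nablaE F k x i j * omega x j 0.
Proof.
move=> Mx; have := period_connectionE k Mx; rewrite period_mapE pd_period_map//.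
move: (Gamma k x) => G; move: (nablaE F k x) => N; move: (pd p k omega x) => w.
by move=> /matrixP/(_ i j); rewrite mul_diag_mx mul_mx_diag !mxE => ->; case: (i =P j) => [->|].
Qed.

Lemma pd_omega_entry k x i : M x -> pd p k omega x i 0 =
  (\sum_m F x i m * omega x m 0) *+ (k == i) - F x i k * omega x k 0.
Proof.
move=> Mx; rewrite pd_omega// mxE mxE -sumrN.
rewrite (eq_bigr (fun m => F x i m * omega x m 0 *+ (k == i)
    - F x i m * omega x m 0 *+ (k == m))); last first.
  move=> m _; rewrite nablaE_entry mulNr opprK mulrBl mulrBl -!mulrA !mulr_natl.
  by [].
rewrite sumrB sumrMnl; congr (_ - _).
rewrite (bigD1 k)//= eqxx big1 ?addr0// => m /negPf mk.
by rewrite eq_sym mk.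
Qed.

Lemma connection_formula k x i l : M x -> omega x i 0 * Gamma k x i l =
  (\sum_m F x i m * omega x m 0) *+ (k == i) *+ (i == l)
    - F x i k * omega x k 0 *+ (i == l)
    - F x i l * omega x l 0 *+ (k == i) + F x i l * omega x l 0 *+ (k == l).
Proof.
move=> Mx; rewrite period_connection_entry// pd_omega_entry// mulrnBl.
have -> : nablaE F k x i l * omega x l 0 =
    - (F x i l * omega x l 0 *+ (k == i)) + F x i l * omega x l 0 *+ (k == l).
  by rewrite nablaE_entry mulNr mulrBl mulrBl -!mulrA !mulr_natl opprB addrC.
by rewrite addrA.
Qed.

Lemma connection_sym k l x i : M x -> Gamma k x i l = Gamma l x i k.
Proof.
move=> Mx; apply: (mulfI (omega_neq0 i Mx)); rewrite !connection_formula//.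
have [->//|_] := eqVneq k l.
rewrite [l == i]eq_sym [i == k]eq_sym /= !mulr0n !addr0 mulrnAC.
by rewrite [RHS]addrAC.
Qed.

Lemma covd_coord k (eta : X -> 'cV[C]_n) x :
  covd p Gamma 'd_k eta x = pd p k eta x + Gamma k x *m eta x.
Proof.
rewrite /covd (bigD1 k)//= big1 ?addr0; last first.
  by move=> l /negPf lk; rewrite mxE lk scale0r.
by rewrite mxE !eqxx scale1r.
Qed.

Lemma mul_delta_col (A : 'M[C]_n) l i : (A *m delta_mx l (0 : 'I_1)) i 0 = A i l.
Proof.
rewrite mxE (bigD1 l)//= big1 ?addr0; last first.
  by move=> m /negPf ml; rewrite mxE ml mulr0.
by rewrite mxE !eqxx mulr1.
Qed.

Lemma covd_coord_coord k l x i : covd p Gamma 'd_k 'd_l x i 0 = Gamma k x i l.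
Proof.
rewrite covd_coord pd_cst add0r; exact: mul_delta_col.
Qed.

Lemma covd_sum xi (eta : X -> 'cV[C]_n) x :
  covd p Gamma xi eta x = \sum_k xi x k 0 *: covd p Gamma 'd_k eta x.
Proof. by rewrite {1}/covd; apply: eq_bigr => k _; rewrite covd_coord. Qed.

Lemma period_productE k x : M x -> mu k x = dLambda R k.
Proof.
move=> Mx; have EQ : dLambda R k *m Q x = Q x *m dLambda R k.
  by rewrite period_mapE; exact: subr0_eq (dLambda_diag_comm k (omega x)^T).
by rewrite /period_product /Phi opprK -mulmxA EQ mulKmx// period_map_unit.
Qed.

Lemma prod_fieldE xi (eta : X -> 'cV[C]_n) x i : M x ->
  prod_field mu xi eta x i 0 = xi x i 0 * eta x i 0.
Proof.
move=> Mx; rewrite /prod_field summxE (bigD1 i)//= big1 ?addr0.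
  rewrite mxE period_productE// /dLambda mxE (bigD1 i)//= big1 ?addr0; last first.
    by move=> l /negPf li; rewrite mxE li andbF mul0r.
  by rewrite mxE !eqxx mul1r.
move=> k /negPf ki; rewrite mxE period_productE// /dLambda mxE big1 ?mulr0// => l _.
by rewrite mxE eq_sym ki mul0r.
Qed.

Lemma period_metric_entry x i j : g x i j = (omega x i 0 * omega x i 0) *+ (i == j).
Proof.
rewrite /period_metric period_mapE /diag_of tr_diag_mx mul_diag_mx !mxE.
by rewrite mulrnAr; case: (i =P j) => [->|].
Qed.

Lemma pairingE xi eta x :
  pairing g xi eta x = \sum_i omega x i 0 * omega x i 0 * (xi x i 0 * eta x i 0).
Proof.
rewrite /pairing mxE; apply: eq_bigr => i _.
rewrite mxE (bigD1 i)//= big1 ?addr0; last first.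
  by move=> j /negPf ji; rewrite period_metric_entry ji mulr0n mulr0.
by rewrite period_metric_entry eqxx mulr1n mxE [xi x i 0 * (_ * _)]mulrC [RHS]mulrA.
Qed.

Lemma coordE k x i : 'd_k x i 0 = (i == k)%:R.
Proof. by rewrite /coord_field mxE andbT. Qed.

Lemma pairing_coordl k eta x :
  pairing g 'd_k eta x = omega x k 0 * omega x k 0 * eta x k 0.
Proof.
rewrite pairingE (bigD1 k)//= big1 ?addr0; last first.
  by move=> j /negPf jk; rewrite coordE jk mul0r mulr0.
by rewrite coordE eqxx mul1r.
Qed.

Lemma pairing_sym xi eta x : pairing g xi eta x = pairing g eta xi x.
Proof. by rewrite !pairingE; apply: eq_bigr => i _; rewrite [xi x i 0 * _]mulrC. Qed.

Lemma deriv_along_coord k f x : deriv_along p 'd_k f x = pd p k f x.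
Proof.
rewrite /deriv_along (bigD1 k)//= big1 ?addr0; last first.
  by move=> j /negPf jk; rewrite coordE jk mul0r.
by rewrite coordE eqxx mul1r.
Qed.

Lemma pd_pairing_coord k i j x : M x ->
  pd p k (pairing g 'd_i 'd_j) x = (2 * (omega x i 0 * pd p k omega x i 0)) *+ (i == j).
Proof.
move=> Mx; rewrite (eq_on_pd _ Mx (h := fun y => omega y i 0 * omega y i 0 * (i == j)%:R)).
  have wi := diff_at_entry i 0 (omega_diff Mx).
  rewrite (pdM p_lh _ (diff_atM wi wi) (diff_at_cst _ _ _)) pd_cst mulr0 addr0.
  rewrite (pdM p_lh _ wi wi) (pd_entry _ _ _ (omega_diff Mx)) mulr_natr.
  by congr (_ *+ _); ring.
by move=> y _; rewrite pairing_coordl coordE.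
Qed.

Lemma connection_diff k x : M x -> diff_at (Gamma k) x.
Proof.
move=> Mx; apply: diff_at_mx => i j.
have e y : M y -> (omega y i 0)^-1 * (- (nablaE F k y *m omega y) i 0 * (i == j)%:R
    + nablaE F k y i j * omega y j 0) = Gamma k y i j.
  move=> My; apply: (mulfI (omega_neq0 i My)); rewrite mulVKf ?omega_neq0//.
  by rewrite period_connection_entry// pd_omega// [(- (_ *m _)) i 0]mxE mulr_natr.
apply: (eq_on_diff_at Mx e).
have we a := diff_at_entry a 0 (omega_diff Mx).
apply: diff_atM; first exact: (diff_atV p_lh (omega_neq0 i Mx) (we i)).
apply: diff_atD.
  apply: diff_atM; last exact: diff_at_cst.
  by apply: diff_atN; exact: (diff_at_entry i 0 (nablaE_omega_diff k Mx)).
by apply: diff_atM; [exact: (diff_at_entry i j (nablaE_diff_on k Mx))|exact: we].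
Qed.

Lemma product_diff k x : M x -> diff_at (mu k) x.
Proof.
by move=> Mx; apply: (eq_on_diff_at Mx (fun y My => esym (period_productE k My))); exact: diff_at_cst.
Qed.

Lemma metric_diff x : M x -> diff_at g x.
Proof.
move=> Mx; apply: diff_at_mx => i j.
have we a := diff_at_entry a 0 (omega_diff Mx).
apply: (eq_diff_at p_lh (f := fun y => omega y i 0 * omega y i 0 * (i == j)%:R)).
  by apply: filterE => y; rewrite period_metric_entry mulr_natr.
by apply: diff_atM; [exact: (diff_atM (we i) (we i))|exact: diff_at_cst].
Qed.

Lemma euler_diff x : diff_at (euler_field p) x.
Proof.
apply: diff_at_mx => i j; rewrite ord1.
apply: (eq_diff_at p_lh (f := fun y => p y 0 i)); last exact: diff_at_coord.
by apply: filterE => y; rewrite mxE.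
Qed.

Lemma pd_euler k x : pd p k (euler_field p) x = delta_mx k 0.
Proof.
apply/matrixP => i j; rewrite ord1 (pd_entry _ _ _ (euler_diff x)).
rewrite (eq_pd p_lh _ (g := fun y => p y 0 i)); last by apply: filterE => y; rewrite mxE.
by rewrite pd_coord// mxE andbT eq_sym.
Qed.

Lemma covd_coord_coordE k l y : covd p Gamma 'd_k 'd_l y = Gamma k y *m delta_mx l 0.
Proof. by rewrite covd_coord pd_cst add0r. Qed.

Lemma connection_curvature k l x : M x ->
  pd p k (Gamma l) x + Gamma k x *m Gamma l x = pd p l (Gamma k) x + Gamma l x *m Gamma k x.
Proof.
move=> Mx; have Qinj (A B : 'M[C]_n) : Q x *m A = Q x *m B -> A = B.
  by move=> AB; rewrite -[A](mulKmx (period_map_unit Mx)) AB mulKmx// period_map_unit.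
have dQ := period_map_diff Mx.
have dstep r s : pd p r Q x *m Gamma s x + Q x *m pd p r (Gamma s) x =
    pd p r (pd p s Q) x + (pd p r (nablaE F s) x *m Q x + nablaE F s x *m pd p r Q x).
  rewrite -(pd_mulmx p_lh r dQ (connection_diff s Mx)).
  rewrite -(pd_mulmx p_lh r (nablaE_diff_on s Mx) dQ).
  rewrite -pdD; [|exact: pd_period_map_diff|exact: (diff_at_mulmx p_lh (nablaE_diff_on s Mx) dQ)].
  by apply: (eq_on_pd r Mx) => y My; exact: period_connectionE.
have key (q gk gl dgk dgl dqk dql ddq nk nl dnk dnl : 'M[C]_n) :
    dqk *m gl + q *m dgl = ddq + (dnl *m q + nl *m dqk) ->
    dql *m gk + q *m dgk = ddq + (dnk *m q + nk *m dql) ->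
    q *m gk = dqk + nk *m q -> q *m gl = dql + nl *m q ->
    dnl - dnk + (nk *m nl - nl *m nk) = 0 ->
    q *m (dgl + gk *m gl) = q *m (dgk + gl *m gk).
  move=> H1 H2 H3 H4 H5.
  have E1 : q *m dgl = ddq + (dnl *m q + nl *m dqk) - dqk *m gl by rewrite -H1 addrC addKr.
  have E2 : q *m dgk = ddq + (dnk *m q + nk *m dql) - dql *m gk by rewrite -H2 addrC addKr.
  rewrite !mulmxDr !mulmxA H3 H4 E1 E2 !mulmxDl -!mulmxA H3 H4 !mulmxDr !mulmxA.
  have -> : dnl = dnk - (nk *m nl - nl *m nk).
    by apply/eqP; rewrite -subr_eq0 opprD opprK addrA H5.
  rewrite !mulmxBl.
  move: (dqk *m gl) (dql *m gk) (dnk *m q) (nk *m nl *m q) (nl *m nk *m q).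
  move: (nl *m dqk) (nk *m dql) => a b0 c0 d0 e0 f0 g0.
  rewrite addrA subrK [RHS]addrA subrK opprB -!addrA; congr (_ + (_ + _)).
  have -> : a + (b0 + f0) = f0 + (a + b0) by rewrite addrA addrC.
  by rewrite addKr addrCA [g0 + b0]addrC [RHS]addrCA.
apply: Qinj; apply: (key _ _ _ _ _ (pd p k Q x) (pd p l Q x) (pd p k (pd p l Q) x)
  (nablaE F k x) (nablaE F l x) (pd p l (nablaE F k) x) (pd p k (nablaE F l) x)).
- exact: dstep.
- rewrite (pd_period_map_sym k l Mx); exact: dstep.
- exact: period_connectionE.
- exact: period_connectionE.
- exact: nablaE_flat.
Qed.

Lemma pd_omega_sum l x i : M x ->
  pd p l omega x i 0 = - \sum_m nablaE F l x i m * omega x m 0.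
Proof. by move=> Mx; rewrite pd_omega// !mxE. Qed.

Lemma covd_euler l x : M x ->
  Q x *m covd p Gamma 'd_l (euler_field p) x =
  ((1 + b)%:M - U x) *m (Q x *m delta_mx l 0).
Proof.
move=> Mx; apply/colP => i; rewrite period_mapE.
have dE (v : 'cV[C]_n) : (diag_of (omega x) *m v) i 0 = omega x i 0 * v i 0.
  by rewrite mul_diag_mx !mxE.
have -> : diag_of (omega x) *m delta_mx l 0 = omega x l 0 *: (delta_mx l 0 : 'cV[C]_n).
  apply/colP => m; rewrite mul_diag_mx !mxE andbT.
  by case: (m =P l) => [->//|_]; rewrite !mulr0.
rewrite -scalemxAr dE [RHS]mxE mul_delta_col covd_coord pd_euler.
rewrite [(delta_mx l 0 + _) i 0]mxE mulrDr [(Gamma l x *m _) i 0]mxE mulr_sumr.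
have -> : \sum_m omega x i 0 * (Gamma l x i m * euler_field p x m 0) =
    \sum_m (nablaE F l x i m * omega x m 0 * (p x 0 m - p x 0 i)).
  rewrite (eq_bigr (fun m => pd p l omega x i 0 *+ (i == m) * p x 0 m
      + nablaE F l x i m * omega x m 0 * p x 0 m)); last first.
    by move=> m _; rewrite mulrA period_connection_entry// mulrDl [euler_field _ _ _ _]mxE.
  rewrite big_split /= (bigD1 i)//= eqxx big1 ?addr0; last first.
    by move=> m /negPf mi; rewrite eq_sym mi mulr0n mul0r.
  rewrite mulr1n pd_omega_sum// mulNr mulr_suml -sumrN -big_split /=.
  by apply: eq_bigr => m _; ring.
pose u m : C := (p x 0 i - p x 0 m) * F x i m.
have uE m : mxcomm (Lambda p x) (F x) i m = u m by exact: mxcomm_diag.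
have u_omega : \sum_m u m * omega x m 0 = b * omega x i 0.
  have /matrixP/(_ i 0) := U_omega Mx; rewrite mxE [RHS]mxE => <-.
  by apply: eq_bigr => m _; rewrite -uE.
rewrite (eq_bigr (fun m => u m * omega x m 0 *+ (l == i) - u m * omega x m 0 *+ (l == m))); last first.
  move=> m _; rewrite nablaE_entry /u -[X in _ = X - _]mulr_natr.
  by rewrite -[X in _ = _ - X]mulr_natr; ring.
rewrite sumrB sumrMnl u_omega [\sum_(m < n) u m * omega x m 0 *+ (l == m)](bigD1 l)//=.
rewrite eqxx big1 ?addr0; last by move=> m /negPf ml; rewrite eq_sym ml.
rewrite [((1 + b)%:M - _) i l]mxE [(1 + b)%:M i l]mxE [(- _ : 'M[C]_n) i l]mxE uE.
rewrite [delta_mx l 0 i 0]mxE andbT [l == i]eq_sym.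
by case: (i =P l) => [->|_] /=; rewrite ?mulr1n ?mulr0n; ring.
Qed.

Lemma lie_bracket_coord k l x : lie_bracket p 'd_k 'd_l x = 0.
Proof. by rewrite /lie_bracket big1// => m _; rewrite !pd_cst !scaler0 subrr. Qed.

Lemma lie_bracket_euler (eta : X -> 'cV[C]_n) x i :
  lie_bracket p (euler_field p) eta x i 0 =
  (\sum_k p x 0 k *: pd p k eta x) i 0 - eta x i 0.
Proof.
rewrite /lie_bracket sumrB [LHS]mxE [(- _ : 'cV[C]_n) i 0]mxE; congr (_ - _).
  by rewrite !summxE; apply: eq_bigr => k _; rewrite mxE [RHS]mxE mxE.
rewrite summxE (bigD1 i)//= big1 ?addr0.
  by rewrite pd_euler !mxE !eqxx mulr1.
by move=> k /negPf ki; rewrite pd_euler !mxE [i == k]eq_sym ki mulr0.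
Qed.

Lemma lie_bracket_euler_coord k x i :
  lie_bracket p (euler_field p) 'd_k x i 0 = - (i == k)%:R.
Proof.
rewrite lie_bracket_euler big1 ?mxE; last by move=> m _; rewrite pd_cst scaler0.
by rewrite andbT sub0r.
Qed.

Lemma prod_coord_const k l x : M x ->
  prod_field mu 'd_k 'd_l x = (k == l)%:R *: delta_mx k 0.
Proof.
move=> Mx; apply/colP => i; rewrite prod_fieldE// !mxE !andbT -!natrM !mulnb.
by have [->|] := eqVneq i k; rewrite ?andbF ?andbT.
Qed.

Lemma covd_prod_coord k l m x i : M x ->
  covd p Gamma 'd_k (prod_field mu 'd_l 'd_m) x i 0 = (l == m)%:R * Gamma k x i l.
Proof.
move=> Mx; rewrite covd_coord (eq_on_pd _ Mx (prod_coord_const l m)) pd_cst add0r.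
by rewrite prod_coord_const// -scalemxAr mxE mul_delta_col.
Qed.

Lemma frobenius_potential k l m x i : M x ->
  (l == m)%:R * Gamma k x i l - Gamma k x i l * (i == m)%:R - (i == l)%:R * Gamma k x i m =
  (k == m)%:R * Gamma l x i k - Gamma l x i k * (i == m)%:R - (i == k)%:R * Gamma l x i m.
Proof.
move=> Mx; exact: (potential_symmetry (f := fun j => F x i j * omega x j 0)
  (G := fun r s => Gamma r x i s) (omega_neq0 i Mx) (fun r s => connection_formula r i s Mx)).
Qed.

Lemma euler_affine k l x : M x ->
  covd p Gamma 'd_k (covd p Gamma 'd_l (euler_field p)) x
    - covd p Gamma (covd p Gamma 'd_k 'd_l) (euler_field p) x = 0.
Proof.
move=> Mx; apply/eqP; rewrite subr_eq0; apply/eqP.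
have Qinj (u v : 'cV[C]_n) : Q x *m u = Q x *m v -> u = v.
  by move=> uv; rewrite -[u](mulKmx (period_map_unit Mx)) uv mulKmx// period_map_unit.
apply: Qinj.
pose G := covd p Gamma 'd_l (euler_field p).
have GE y : G y = pd p l (euler_field p) y + Gamma l y *m euler_field p y by exact: covd_coord.
have dG : diff_at G x.
  have e y : M y -> delta_mx l 0 + Gamma l y *m euler_field p y = G y.
    by move=> _; rewrite GE pd_euler.
  apply: (eq_on_diff_at Mx e); apply: diff_atD; first exact: diff_at_cst.
  by apply: (diff_at_mulmx p_lh); [exact: connection_diff|exact: euler_diff].
have dQ := period_map_diff Mx.
pose W y : 'M[C]_n := (1 + b)%:M - U y.
have dU : diff_at U x.
  by apply: diff_atB; apply: (diff_at_mulmx p_lh); try exact: F_diff; exact: diff_at_Lambda.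
have dW : diff_at W x by apply: diff_atB; [exact: diff_at_cst|exact: dU].
have pdW : pd p k W x = mxcomm (nablaE F k x) (U x).
  by rewrite (pdB k (diff_at_cst _ _ _) dU) pd_cst sub0r pd_U// opprK.
have dQe : diff_at (fun y => Q y *m delta_mx l (0 : 'I_1)) x.
  by apply: (diff_at_mulmx p_lh); [exact: dQ|exact: diff_at_cst].
have step : pd p k Q x *m G x + Q x *m pd p k G x =
    pd p k W x *m (Q x *m delta_mx l 0) + W x *m (pd p k Q x *m delta_mx l 0).
  rewrite -(pd_mulmx p_lh k dQ dG) (eq_on_pd k Mx (covd_euler l)).
  rewrite (pd_mulmx p_lh k dW dQe); congr (_ + _ *m _).
  by rewrite (pd_mulmx p_lh k dQ (diff_at_cst _ _ _)) pd_cst mulmx0 addr0.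
have rhs : Q x *m covd p Gamma (covd p Gamma 'd_k 'd_l) (euler_field p) x =
    W x *m (Q x *m (Gamma k x *m delta_mx l 0)).
  rewrite covd_sum covd_coord_coordE.
  have {2}-> : Gamma k x *m delta_mx l (0 : 'I_1) =
      \sum_m (Gamma k x *m delta_mx l (0 : 'I_1)) m 0 *: delta_mx m 0.
    rewrite {1}[LHS]matrix_sum_delta; apply: eq_bigr => m _.
    by rewrite big_ord1.
  rewrite !mulmx_sumr; apply: eq_bigr => m _.
  by rewrite -!scalemxAr covd_euler.
rewrite rhs covd_coord -/G.
rewrite pdW in step.
exact: (@euler_key _ n _ _ _ _ (U x) _ _ _ (1 + b) step (period_connectionE k Mx) (covd_euler l Mx)).
Qed.

Lemma period_frobenius :
  frobenius_structure p M g Gamma mu (@unit_field R n X) (euler_field p).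
Proof.
split.
- exact: M_open.
- by apply: holomorphic_on_M => x; exact: metric_diff.
- by move=> k; apply: holomorphic_on_M => x; exact: connection_diff.
- by move=> k; apply: holomorphic_on_M => x; exact: product_diff.
- by apply: holomorphic_on_M => x _; exact: diff_at_cst.
- by apply: holomorphic_on_M => x _; exact: euler_diff.
- by move=> x _; rewrite /period_metric trmx_mul trmxK.
- by move=> x Mx; rewrite /period_metric unitmx_mul unitmx_tr period_map_unit.
- move=> x k l Mx; rewrite lie_bracket_coord.
  have -> : covd p Gamma 'd_k 'd_l x = covd p Gamma 'd_l 'd_k x; last exact: subrr.
  apply/colP => i; apply: etrans (covd_coord_coord k l x i) _.
  by apply: etrans (connection_sym k l i Mx) _; exact: esym (covd_coord_coord l k x i).
- move=> x k i j Mx; rewrite deriv_along_coord pd_pairing_coord//.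
  have e r s : pairing g 'd_r (covd p Gamma 'd_k 'd_s) x =
      omega x r 0 * omega x r 0 * Gamma k x r s.
    by rewrite pairing_coordl covd_coord_coord.
  have e' r s : pairing g (covd p Gamma 'd_k 'd_s) 'd_r x =
      omega x r 0 * omega x r 0 * Gamma k x r s.
    exact: etrans (pairing_sym _ _ _) (e r s).
  rewrite (e' j i) (e i j) -!mulrA !period_connection_entry// !nablaE_entry.
  have -> : F x j i = F x i j by rewrite -[in LHS](F_sym Mx) mxE.
  by have [->|_] := eqVneq i j; rewrite ?mulr1n ?mulr0n; ring.
- move=> x k l m Mx.
  have pdG r s : pd p r (covd p Gamma 'd_s 'd_m) x = pd p r (Gamma s) x *m delta_mx m 0.
    rewrite (eq_on_pd _ Mx (fun y _ => covd_coord_coordE s m y)).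
    rewrite (pd_mulmx p_lh r (connection_diff s Mx) (diff_at_cst _ _ _)).
    by rewrite pd_cst mulmx0 addr0.
  have e r s : covd p Gamma 'd_r (covd p Gamma 'd_s 'd_m) x =
      (pd p r (Gamma s) x + Gamma r x *m Gamma s x) *m delta_mx m 0.
    by rewrite covd_coord pdG covd_coord_coordE mulmxA -mulmxDl.
  apply: etrans (e k l) (etrans _ (esym (e l k))).
  exact: (congr1 (fun A : 'M[C]_n => A *m delta_mx m (0 : 'I_1)) (connection_curvature k l Mx)).
- move=> x k l Mx; apply/colP => i.
  by rewrite [LHS]prod_fieldE// [RHS]prod_fieldE// mulrC.
- move=> x k l m Mx; apply/colP => i; rewrite [LHS]prod_fieldE// [RHS]prod_fieldE//.
  by rewrite (prod_fieldE 'd_k 'd_l i Mx) (prod_fieldE 'd_l 'd_m i Mx) mulrA.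
- by move=> x k Mx; apply/colP => i; rewrite prod_fieldE// mxE mul1r.
- move=> x k l m Mx; rewrite !pairingE; apply: eq_bigr => i _.
  by rewrite !prod_fieldE// !mulrA.
- move=> x k Mx; rewrite covd_coord pd_cst add0r; apply/colP => i.
  apply: (mulfI (omega_neq0 i Mx)); rewrite [RHS]mulrC mxE [(0 : 'cV_n) i 0]mxE mul0r.
  rewrite mulr_sumr (eq_bigr (fun l => (pd p k omega x i 0) *+ (i == l)
      + nablaE F k x i l * omega x l 0)); last first.
    by move=> l _; rewrite [unit_field _ _ _ _ _]mxE mulr1 period_connection_entry.
  rewrite big_split /= (bigD1 i)//= eqxx big1 ?addr0; last first.
    by move=> l /negPf li; rewrite eq_sym li.
  by rewrite mulr1n pd_omega_sum// addNr.
- move=> x k l m Mx; apply/colP => i.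
  have e r s : (covd p Gamma 'd_r (prod_field mu 'd_s 'd_m) x
      - prod_field mu (covd p Gamma 'd_r 'd_s) 'd_m x
      - prod_field mu 'd_s (covd p Gamma 'd_r 'd_m) x) i 0 =
      (s == m)%:R * Gamma r x i s - Gamma r x i s * (i == m)%:R - (i == s)%:R * Gamma r x i m.
    rewrite [LHS]mxE [(_ - _ : 'cV_n) i 0]mxE ![(- _ : 'cV_n) i 0]mxE.
    rewrite covd_prod_coord// (prod_fieldE (covd p Gamma 'd_r 'd_s) 'd_m i Mx).
    rewrite (prod_fieldE 'd_s (covd p Gamma 'd_r 'd_m) i Mx) !coordE.
    exact: (f_equal2 (fun u v : C => (s == m)%:R * Gamma r x i s - u * (i == m)%:R
      - (i == s)%:R * v) (covd_coord_coord r s x i) (covd_coord_coord r m x i)).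
  exact: etrans (e k l) (etrans (frobenius_potential k l m i Mx) (esym (e l k))).
- by move=> x k l; exact: euler_affine.
- move=> x k l Mx; apply/colP => i.
  have e : lie_bracket p (euler_field p) (prod_field mu 'd_k 'd_l) x i 0 =
      - ((i == k)%:R * (i == l)%:R).
    rewrite lie_bracket_euler (prod_fieldE 'd_k 'd_l i Mx) !coordE big1.
      by rewrite mxE sub0r.
    by move=> m _; rewrite (eq_on_pd _ Mx (fun y => @prod_coord_const k l y)) pd_cst scaler0.
  rewrite [LHS]mxE [(_ - _ : 'cV_n) i 0]mxE ![(- _ : 'cV_n) i 0]mxE e.
  rewrite (prod_fieldE (lie_bracket p (euler_field p) 'd_k) 'd_l i Mx).
  rewrite (prod_fieldE 'd_k (lie_bracket p (euler_field p) 'd_l) i Mx).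
  rewrite (prod_fieldE 'd_k 'd_l i Mx).
  rewrite (lie_bracket_euler_coord k) (lie_bracket_euler_coord l) !coordE.
  by move: ((i == k)%:R : C) ((i == l)%:R : C) => u v; ring.
- exists (2 * b + 2) => x k l Mx.
  rewrite [pairing g (lie_bracket _ _ _) _ _]pairing_sym !pairing_coordl.
  rewrite (lie_bracket_euler_coord k) (lie_bracket_euler_coord l) coordE.
  have -> : deriv_along p (euler_field p) (pairing g 'd_k 'd_l) x =
      (2 * (omega x k 0 * (b * omega x k 0))) *+ (k == l).
    rewrite /deriv_along.
    have e m : euler_field p x m 0 * pd p m (pairing g 'd_k 'd_l) x =
       (2 * omega x k 0 * (p x 0 m * pd p m omega x k 0)) *+ (k == l).
      by rewrite pd_pairing_coord// [euler_field _ _ _ _]mxE mulrnAr; congr (_ *+ _); ring.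
    under eq_bigr => m _ do rewrite e.
    rewrite sumrMnl -mulr_sumr; congr (_ *+ _); rewrite -mulrA; congr (_ * (_ * _)).
    have /matrixP/(_ k 0) := U_omega Mx; rewrite mxE [RHS]mxE => <-.
    under eq_bigr => m _ do rewrite pd_omega_sum// mulrN mulr_sumr -sumrN.
    rewrite exchange_big /=; apply: eq_bigr => j _; rewrite /Lambda mxcomm_diag.
    rewrite (eq_bigr (fun m => (p x 0 m * (m == k)%:R - p x 0 m * (m == j)%:R)
        * (F x k j * omega x j 0))); last by move=> m _; rewrite nablaE_entry; ring.
    have delta_sum r : \sum_m p x 0 m * (m == r)%:R = p x 0 r.
      by rewrite (bigD1 r)//= big1 ?eqxx ?mulr1 ?addr0// => m /negPf ->; rewrite mulr0.
    by rewrite -mulr_suml sumrB !delta_sum mulrA.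
  by have [->|_] := eqVneq k l; rewrite /= ?mulr1n ?mulr0n; ring.
Qed.

End PeriodMap.

Lemma dpart_skew (R : realType) (n : nat) (A : 'M[CC R]_n) (c : CC R) :
  skew_symmetric (A - c%:M) -> dpart A = c%:M.
Proof.
move=> skewA; apply/matrixP => i j; rewrite !mxE.
have [<-|] := eqVneq i j; last by rewrite !mulr0n.
have /matrixP/(_ i i) := skewA; rewrite !mxE eqxx !mulr1n => /eqP.
by rewrite -addr_eq0 -mulr2n mulrn_eq0 subr_eq0 => /eqP.
Qed.

Lemma skew_entry_sym (R : realType) (n : nat) (A : 'M[CC R]_n) (c : CC R) i j :
  skew_symmetric (A - c%:M) -> i != j -> A j i = - A i j.
Proof.
move=> /matrixP/(_ i j); rewrite !mxE eq_sym => + /negPf ij.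
by rewrite ij !mulr0n !subr0.
Qed.

Theorem corollary4p10 (R : realType) (n : nat) (t_o : 'rV[CC R]_n)
  (A1 : 'M[CC R]_n) (omega_o : 'cV[CC R]_n) (w : int)
  (rep : 'I_n -> 'I_n) (U : set 'rV[CC R]_n)
  (X : topologicalType) (p : X -> 'rV[CC R]_n) (x_o : X)
  (Theta Theta_omega : set X) (F : X -> 'M[CC R]_n) (omega : X -> 'cV[CC R]_n)
  (t_o_Delta : diagonals t_o)
  (A1_nd : exists B : 'M[CC R]_n, ndpart A1 = mxcomm (diag_mx t_o) B)
  (A1_skew : skew_symmetric (A1 - (w%:~R / 2)%:M))
  (omega_o_eigen : eigenvector A1 omega_o)
  (omega_o_neq0 : forall i, omega_o i 0 != 0)
  (U_open : open U)
  (S_o_sub : stratum t_o `<=` U)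
  (rep_S_o : representatives t_o rep)
  (U_star : star_shaped rep U)
  (U_strata : forall t : 'rV[CC R]_n,
     closure (stratum t) `&` stratum t_o = set0 ->
     U `&` closure (stratum t) = set0)
  (X_univ : universal_covering R p U)
  (x_o_lift : p x_o = t_o)
  (F_deform : integrable_deformation p x_o A1 Theta F)
  (omega_flat : flat_extension p x_o omega_o Theta F omega)
  (Theta_omega_hyp : hypersurface p Theta_omega)
  (omega_neq0 : forall x i, ~ Theta x -> ~ Theta_omega x -> omega x i 0 != 0) :
  period_map_endows_frobenius p (~` (Theta `|` Theta_omega)) F omega.
Proof.
have [cov pathX _] := X_univ.
have p_lh := covering_map_local_homeomorphism cov.
have [[Thyp Txo] [[F_holo _] _] + res_o _] := F_deform.
have [[omega_holo _] flat omega_xo] := omega_flat.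
pose c : CC R := w%:~R / 2.
rewrite (dpart_skew A1_skew) -/c => integrable.
have residue_o : residue p F c x_o = A1.
  have := res_o 1 (oner_neq0 _); rewrite /matrix_z /= (dpart_skew A1_skew) invr1 !scale1r.
  exact: addrI.
have [_ [a A1_eigen]] := omega_o_eigen.
have F_sym_o i j : p x_o 0 i != p x_o 0 j -> F x_o i j = F x_o j i.
  move=> pij; have ij : i != j by apply: contraNneq pij => ->.
  have := skew_entry_sym A1_skew ij; rewrite -residue_o /residue.
  rewrite [LHS]mxE [(_ + _ : 'M[CC R]_n) i j]mxE !mxcomm_diag !mxE [j == i]eq_sym (negPf ij).
  rewrite !mulr0n !addr0 -mulNr opprB => E.
  by apply: (mulfI (_ : p x_o 0 j - p x_o 0 i != 0)); rewrite ?subr_eq0 1?eq_sym// E.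
have defect_o : eigen_defect p F c omega a x_o = 0.
  by rewrite /eigen_defect residue_o omega_xo mulmxBl A1_eigen mul_scalar_mx subrr.
have sym_eigen := symmetric_eigen_everywhere p_lh Thyp.1 F_holo integrable omega_holo flat
  Thyp pathX Txo F_sym_o defect_o.
have notT x : (~` (Theta `|` Theta_omega)) x -> ~ Theta x by move=> nT Tx; apply: nT; left.
have omega_neq0' x i : (~` (Theta `|` Theta_omega)) x -> omega x i 0 != 0.
  by move=> nT; apply: omega_neq0 => Tx; apply: nT; [left|right].
split; first by move=> x; exact: period_map_unit.
apply: (period_frobenius p_lh (b := a - c)).
- by apply: closed_openC; apply: closedU; [exact: Thyp.1|exact: Theta_omega_hyp.1].
- by move=> x /notT; exact: (F_diff p_lh F_holo).
- by move=> x /notT; exact: (omega_diff p_lh omega_holo).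
- exact: omega_neq0'.
- by move=> x /notT/sym_eigen[].
- by move=> x k l /notT; exact: (nablaE_flat p_lh F_holo integrable k l).
- by move=> x k /notT; exact: (pd_omega flat k).
- move=> x k /notT Tx.
  have dF := F_diff p_lh F_holo Tx.
  have dU : diff_at p (fun y => mxcomm (Lambda p y) (F y)) x.
    by apply: diff_atB; apply: (diff_at_mulmx p_lh); try exact: dF; exact: diff_at_Lambda.
  have := pd_residue p_lh F_holo integrable k Tx.
  rewrite (pdD k dU (diff_at_cst _ _ _)) pd_cst addr0 => ->.
  by rewrite /residue mxcommDr mxcomm_scalar addr0.
- move=> x /notT/sym_eigen[_]; rewrite /eigen_defect /residue -addrA -raddfB mulmxDl.
  rewrite mul_scalar_mx => /eqP; rewrite addr_eq0 => /eqP ->.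
  by rewrite -scaleNr opprB.
Qed.
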